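(* The space $\mathcal P^*=\mathcal P\otimes\Lambda^*(\mathbb C^m)$ of polynomial differential forms on $\mathbb R^m$ decomposes as $$\mathcal P^*=\mathcal P^*_{(0,0)}\oplus\left(\bigoplus_{s=1}^{m-1}\bigoplus_{k=0}^{\infty}\mathcal P^*_{(s,k)}\right)\oplus\mathcal P^*_{(m,0)},\qquad\text{where}\qquad \mathcal P^*_{(s,k)}=\bigoplus_{w\in\Omega}wH^s_k .$$ Moreover, all the $O(m)$-modules $H^s_k$ appearing in this decomposition (that is, $(s,k)=(0,0)$, $(s,k)=(m,0)$, and $1\le s\le m-1$, $k\ge 0$) are non-trivial (i.e. nonzero), irreducible and mutually inequivalent, and each $\mathcal P^*_{(s,k)}$ is the corresponding $O(m)$-isotypic component of $\mathcal P^*$ (the isotypic component of type $H^s_k$).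
   Context: Let $m$ be a positive integer and let $\mathcal P$ be the space of complex-valued polynomials on $\mathbb R^m$ in the variables $x_1,\dots,x_m$, with $\mathcal P_k$ the subspace of $k$-homogeneous polynomials. Let $\Lambda^*(\mathbb C^m)=\bigoplus_{s=0}^m\Lambda^s(\mathbb C^m)$ be the Grassmann algebra with generators $dx_1,\dots,dx_m$, and put $\mathcal P^*=\mathcal P\otimes\Lambda^*(\mathbb C^m)$, $\mathcal P^s_k=\mathcal P_k\otimes\Lambda^s(\mathbb C^m)$. Elements of $\mathcal P^s_k$ are written $P=\sum_I P_I\,dx_I$, the sum running over strictly increasing sequences $I=(i_1<\dots<i_s)$ in $\{1,\dots,m\}$, with $P_I\in\mathcal P_k$ and $dx_I=dx_{i_1}\wedge\cdots\wedge dx_{i_s}$. The orthogonal group $O(m)$ acts on $\mathcal P^*$ in the natural way: $(g\cdot(f\otimes\omega))(\underline x)=f(g^{-1}\underline x)\, g\omega$, where $g\omega$ is the natural action of $O(m)$ on $\Lambda^*(\mathbb C^m)$ induced from the standard action on $\mathbb C^m$. The contraction $dx_j\rfloor$ is defined by $dx_j\rfloor\, dx_I=\sum_{l=1}^s(-1)^{l-1}\delta_{j i_l}\,dx_{I\setminus\{i_l\}}$ and $dx_j\rfloor P=\sum_I P_I\,(dx_j\rfloor\, dx_I)$. Define linear operators on $\mathcal P^*$ by $$d=\sum_{j=1}^m\partial_{x_j}\,dx_j\wedge,\qquad d^*=-\sum_{j=1}^m\partial_{x_j}\,dx_j\rfloor,\qquad x=-\sum_{j=1}^m x_j\,dx_j\wedge,\qquad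 x^*=\sum_{j=1}^m x_j\,dx_j\rfloor .$$ These operators commute with the $O(m)$-action. For $0\le s\le m$ and $k\ge 0$ put $$H^s_k=\{P\in\mathcal P^s_k:\ dP=0,\ d^*P=0\},$$ the space of $k$-homogeneous $s$-form solutions of the Hodge-de Rham system. Let $\Omega=\{1,\,x,\,x^*,\,xx^*,\,x^*x,\,xx^*x,\,x^*xx^*,\dots\}$ be the set of all alternating words in $x$ and $x^*$ (including the empty word $1$, the identity). Each word acts as the corresponding composition of operators, and $wH^s_k$ denotes the image of $H^s_k$ under $w$. The direct sum over $w\in\Omega$ is indexed by words; some summands may be the zero space (e.g. $x^*H^0_0=\{0\}$). *)

(* Defs.v *)
(* The field of complex numbers is R[i] for R : realType. *)
From HB Require Import structures.
From mathcomp Require Import all_boot all_order all_algebra.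
From mathcomp Require Import mpoly complex.
From mathcomp Require Import boolp classical_sets functions reals.

Set Implicit Arguments.
Unset Strict Implicit.
Unset Printing Implicit Defensive.

Import GRing.Theory.
Local Open Scope classical_set_scope.
Local Open Scope ring_scope.
Local Open Scope complex_scope.

Section DirectSums.
Variables (K : fieldType) (V : lmodType K).

Definition subspace (U : set V) : Prop :=
  U 0 /\ forall (a : K) u v, U u -> U v -> U (a *: u + v).

(* The algebraic sum of the possibly infinite family (U i), i \in D: each of
   its elements is a finite sum, over a duplicate-free list r of indices. *)
Definition sumspace (I : eqType) (D : set I) (U : I -> set V) : set V :=
  [set v | exists (r : seq I) (u : I -> V),
     [/\ uniq r, forall i, i \in r -> D i /\ U i (u i)
       & v = \sum_(i <- r) u i]].

(* Some of the U i may be {0}, also for several i. *)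
Definition independent (I : eqType) (D : set I) (U : I -> set V) : Prop :=
  forall (r : seq I) (u : I -> V), uniq r ->
    (forall i, i \in r -> D i /\ U i (u i)) ->
    \sum_(i <- r) u i = 0 -> forall i, i \in r -> u i = 0.

Definition is_direct_sum (I : eqType) (D : set I) (U : I -> set V)
    (W : set V) : Prop :=
  [/\ forall i, D i -> subspace (U i), independent D U & W = sumspace D U].

End DirectSums.

Section Modules.
Variables (K : fieldType) (V : lmodType K).
Variables (T : Type) (G : set T) (rho : T -> V -> V).

Definition submodule (U : set V) : Prop :=
  subspace U /\ forall g u, G g -> U u -> U (rho g u).

Definition irreducible (U : set V) : Prop :=
  [/\ submodule U, U <> [set 0]
    & forall W, submodule W -> W `<=` U -> W = [set 0] \/ W = U].

(* Only the restriction of f to U matters; f is junk outside of U. *)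
Definition equivalent (U W : set V) : Prop :=
  exists f : V -> V,
    [/\ set_bij U W f,
        forall (a : K) u v, U u -> U v -> f (a *: u + v) = a *: f u + f v
      & forall g u, G g -> U u -> f (rho g u) = rho g (f u)].

(* The isotypic component of type W, for W irreducible, of the whole module V:
   the sum of all the submodules of V which are equivalent to W. *)
Definition isotypic (W : set V) : set V :=
  sumspace [set U : set V | submodule U /\ equivalent U W] id.

End Modules.

Section Forms.
Variables (R : realType) (m : nat).

Local Notation C := R[i].

(* A strictly increasing sequence in {1,...,m} is encoded by its support, so
   that P : form is \sum_I P_I dx_I with P_I = P I; indices start at 0. *)
Local Notation form := {ffun {set 'I_m} -> {mpoly C[m]}}.

Definition dxs (I : {set 'I_m}) : form := [ffun J => (J == I)%:R].

Definition pmulf (p : {mpoly C[m]}) (P : form) : form :=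
  [ffun I => p * P I].

Definition pos (j : 'I_m) (I : {set 'I_m}) : nat :=
  #|[pred i in I | (i < j)%N]|.

Definition wedge_dxs (j : 'I_m) (I : {set 'I_m}) : form :=
  if j \in I then 0 else (-1) ^+ pos j I *: dxs (j |: I).

(* dx_j /\ P *)
Definition wedge (j : 'I_m) (P : form) : form :=
  \sum_(I : {set 'I_m}) pmulf (P I) (wedge_dxs j I).

(* The l-th element i of I satisfies l - 1 = pos i I. *)
Definition contr_dxs (j : 'I_m) (I : {set 'I_m}) : form :=
  \sum_(i in I) ((-1) ^+ pos i I * (j == i)%:R) *: dxs (I :\ i).

(* dx_j _| P *)
Definition contr (j : 'I_m) (P : form) : form :=
  \sum_(I : {set 'I_m}) pmulf (P I) (contr_dxs j I).

Definition partial (j : 'I_m) (P : form) : form :=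
  [ffun I => mderiv j (P I)].

Definition dop (P : form) : form := \sum_(j < m) partial j (wedge j P).
Definition dstar (P : form) : form := - \sum_(j < m) partial j (contr j P).
Definition xop (P : form) : form := - \sum_(j < m) pmulf 'X_j (wedge j P).
Definition xstar (P : form) : form := \sum_(j < m) pmulf 'X_j (contr j P).

Definition orthogonal_group : set 'M[R]_m := [set g | g *m g^T = 1%:M].

(* g dx_I = g dx_(i_1) /\ ... /\ g dx_(i_s), where g dx_i = \sum_j g_ji dx_j;
   enum I lists I in increasing order. *)
Definition act_dxs (g : 'M[R]_m) (I : {set 'I_m}) : form :=
  foldr (fun i omega => \sum_(j < m) (g j i)%:C *: wedge j omega)
    (dxs finset.set0) (enum I).

(* f (g^-1 x) *)
Definition act_poly (g : 'M[R]_m) (f : {mpoly C[m]}) : {mpoly C[m]} :=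
  comp_mpoly [tuple \sum_(j < m) (invmx g i j)%:C *: 'X_j | i < m] f.

Definition act (g : 'M[R]_m) (P : form) : form :=
  \sum_(I : {set 'I_m}) pmulf (act_poly g (P I)) (act_dxs g I).

Definition homog_form (s k : nat) : set form :=
  [set P | forall I : {set 'I_m},
     P I \is k.-homog /\ (#|I| != s -> P I = 0)].

Definition hodge (s k : nat) : set form :=
  [set P | [/\ homog_form s k P, dop P = 0 & dstar P = 0]].

(* A word in the letters x (true) and x^* (false), leftmost letter first. *)
Definition Omega : set (seq bool) := [set w | sorted [rel a b | a != b] w].

(* Composition of operators: the rightmost letter is applied first. *)
Definition word_op (w : seq bool) (P : form) : form :=
  foldr (fun b Q => if b then xop Q else xstar Q) P w.

Definition wH (s k : nat) (w : seq bool) : set form := word_op w @` hodge s k.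

Definition component (sk : nat * nat) : set form :=
  sumspace Omega (wH sk.1 sk.2).

Definition indices : set (nat * nat) :=
  [set sk | [\/ sk = (0%N, 0%N), sk = (m, 0%N) | (0 < sk.1 < m)%N]].

End Forms.

(* Main.v *)
(* Multiplications by x_j and dx_j, partial derivatives and contractions make
   the polynomial forms a Fock representation.  For the Fischer inner product
   x_j and d/dx_j, resp. dx_j /\ and dx_j _|, are adjoint, so x is adjoint to
   d^* and x^* to d; hence every form of given bidegree is the sum of an element
   of H^s_k = ker d \cap ker d^* and of one of im x + im x^*, and induction on
   the degree gives the spanning part.  Independence follows from orthogonality:
   by the relations [d, x^*]_+ = E + N and [d^*, x]_+ = m + E - N, moving d, d^*
   through a word shortens it, so words applied to different H^s_k are
   orthogonal; two words of the same length are separated by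
   x x^* y = 0 => x^* y = 0, since x x^* + x^* x is multiplication by -|x|^2.

   For 0 < s < m let z = x_1 + i x_2 and v_I = z^k dz /\ dx_J with I = {1} \cup J
   and J contained in {3..m}.  A rotation of the (x_1,x_2)-plane by an angle of
   infinite order and the sign changes of the other coordinates have v_I as only
   common eigenvector in H^s_k for the given characters, and no such eigenvector
   in another H^s'_k' with k' <= k; this gives the inequivalence.  An invariant
   subspace W of H^s_k contains v_I or is orthogonal to it.  In the latter case,
   for P in W the form x x^* P vanishes on all null vectors, so it is a multiple
   of |x|^2, which forces P = 0.  Applying this to W or to its orthogonal
   complement gives irreducibility.  The isotypic components are then identified
   by Schur's lemma. *)
Require Import Defs.
From HB Require Import structures.
From mathcomp Require Import all_boot all_order all_algebra.
From mathcomp Require Import perm mpoly complex.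
From mathcomp Require Import boolp classical_sets functions reals.
From mathcomp Require Import ring zify.

Set Implicit Arguments.
Unset Strict Implicit.
Unset Printing Implicit Defensive.

Import Order.TTheory GRing.Theory Num.Theory.
Local Open Scope ring_scope.

(** * Exterior algebra in coordinates *)

(** The group contains only real orthogonal matrices, yet [lact] lets every complex matrix act, with
    adjoint the action of the conjugate transpose. So z and its conjugate become coordinates through
    the non-orthogonal matrix [hmx], which diagonalises the rotation, and a joint eigenvector is
    found by reading off single coefficients. The rotation records the degree in z and dz minus the
    degree in their conjugates. For polynomial degree at most k this difference reaches k + 1 only
    on z^k dz /\ dx_J, which is why uniqueness assumes k' <= k. Orthogonal projection onto an
    invariant subspace preserves eigenvalues, so it maps v_I to a multiple of v_I; this gives the
    alternative of containing v_I or being orthogonal to it. Orthogonality to v_I, moved around by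
    O(m), only controls coefficients at sets I that contain Z0 and avoid Z1. Applying x x^* removes
    this restriction: in coordinates adapted to a null vector, each coefficient of x x^* P there is,
    up to a factor, a controlled one. Complete reducibility is used only as projection onto
    subspaces of a single finite-dimensional bidegree. *)

Lemma signrZ (K : nzRingType) (A : lalgType K) n (a : A) :
  (-1) ^+ n *: a = (-1) ^+ n * a.
Proof.
by elim: n => [|n IHn]; rewrite ?scale1r ?mul1r // !exprS -scalerA IHn -mulrA scaleN1r mulN1r.
Qed.

Lemma ffun_addE (T : finType) (V : nmodType) (f g : {ffun T -> V}) x :
  (f + g) x = f x + g x.
Proof. exact: ffunE. Qed.

Lemma ffun_oppE (T : finType) (V : zmodType) (f : {ffun T -> V}) x :
  (- f) x = - f x.
Proof. exact: ffunE. Qed.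

Lemma ffun_scaleE (K : pzRingType) (T : finType) (V : lmodType K) a
  (f : {ffun T -> V}) x : (a *: f) x = a *: f x.
Proof. exact: ffunE. Qed.

Lemma ffun_zeroE (T : finType) (V : nmodType) x : (0 : {ffun T -> V}) x = 0.
Proof. exact: ffunE. Qed.

Definition form_coefE := (ffun_addE, ffun_oppE, ffun_scaleE, ffun_zeroE).

Section Exterior.
Variables (F : comNzRingType) (V : lmodType F) (m : nat).
Local Notation eform := {ffun {set 'I_m} -> V}.
Implicit Types (i j : 'I_m) (I K : {set 'I_m}) (P Q : eform).

Lemma pos_setU1 i j K : i \notin K -> pos j (i |: K) = ((i < j) + pos j K)%N.
Proof.
move=> iNK; by rewrite /pos -!sum1_card !big_mkcondr /= big_setU1 //=; case: (i < j)%N.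
Qed.

Lemma pos_setD1 i j K : i \in K -> pos j K = ((i < j) + pos j (K :\ i))%N.
Proof. by move=> iK; rewrite -{1}(finset.setD1K iK) pos_setU1 // !inE eqxx. Qed.

(** Only dx_(K :\ j) contributes to the coefficient of dx_K; the sign moves dx_j past the smaller
    indices. Working with single coefficients turns the Clifford relations into comparisons of
    signs. *)
Definition ewedge j P : eform :=
  [ffun K : {set 'I_m} => if j \in K then (-1) ^+ pos j K *: P (K :\ j) else 0].

Definition econtr j P : eform :=
  [ffun K : {set 'I_m} => if j \in K then 0 else (-1) ^+ pos j K *: P (j |: K)].

Lemma ewedgeE j P K :
  ewedge j P K = if j \in K then (-1) ^+ pos j K *: P (K :\ j) else 0.
Proof. exact: ffunE. Qed.

Lemma econtrE j P K :
  econtr j P K = if j \in K then 0 else (-1) ^+ pos j K *: P (j |: K).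
Proof. exact: ffunE. Qed.

Lemma ewedge_is_linear j : linear (ewedge j).
Proof.
move=> a P Q; apply/ffunP=> K; rewrite !form_coefE !ewedgeE; case: ifP => _.
  by rewrite !form_coefE scalerDr !scalerA mulrC.
by rewrite scaler0 addr0.
Qed.

Lemma econtr_is_linear j : linear (econtr j).
Proof.
move=> a P Q; apply/ffunP=> K; rewrite !form_coefE !econtrE; case: ifP => _.
  by rewrite scaler0 addr0.
by rewrite !form_coefE scalerDr !scalerA mulrC.
Qed.

(** Exactly one of i < j and j < i holds, so inserting the other index changes exactly one of the
    two counts by one. *)
Lemma signr_pos_swap i j K : i != j -> i \notin K -> j \notin K ->
  (-1) ^+ (pos i K + pos j (i |: K)) = - (-1) ^+ (pos j K + pos i (j |: K)) :> F.
Proof.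
move=> nij iK jK; rewrite !pos_setU1 // !exprD.
case: (ltngtP i j) => [lt_ij|lt_ji|/val_inj eij].
- by rewrite /=; ring.
- by rewrite /=; ring.
by rewrite eij eqxx in nij.
Qed.

Lemma econtr_econtr i j P : econtr i (econtr j P) = - econtr j (econtr i P).
Proof.
apply/ffunP=> K; rewrite !form_coefE !econtrE !inE.
have [->|nij] := eqVneq i j.
  by case: ifP => _; rewrite ?eqxx /= ?scaler0 oppr0.
rewrite /=.
case: (boolP (i \in K)) => iK; first by case: ifP => // _; rewrite ?scaler0 oppr0.
case: (boolP (j \in K)) => jK; first by rewrite scaler0 oppr0.
by rewrite !scalerA -!exprD signr_pos_swap // scaleNr finset.setUCA.
Qed.

Lemma ewedge_ewedge i j P : ewedge i (ewedge j P) = - ewedge j (ewedge i P).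
Proof.
apply/ffunP=> K; rewrite !form_coefE !ewedgeE !inE.
have [->|nij] := eqVneq i j.
  by rewrite ?eqxx /= scaler0; case: ifP => _; rewrite oppr0.
rewrite /=.
case: (boolP (i \in K)) => iK; last first.
  by case: ifP; rewrite ?scaler0 oppr0.
case: (boolP (j \in K)) => jK; last by rewrite scaler0 oppr0.
rewrite !scalerA finset.setDDl finset.setUC -finset.setDDl -scaleNr; congr (_ *: _).
rewrite -!exprD (pos_setD1 j iK) (pos_setD1 i jK) !exprD.
case: (ltngtP i j) => [lt_ij|lt_ji|/val_inj eij]; try by rewrite /=; ring.
by rewrite eij eqxx in nij.
Qed.

Lemma econtr_ewedge i j P :
  econtr i (ewedge j P) = (i == j)%:R *: P - ewedge j (econtr i P).
Proof.
apply/ffunP=> K; rewrite !form_coefE econtrE !ewedgeE !econtrE !inE.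
have [->|nij] := eqVneq i j.
  rewrite ?eqxx /= scale1r; case: (boolP (j \in K)) => jK.
    by rewrite scalerA -exprD (pos_setD1 _ jK) ltnn addnn -signr_odd odd_double
      expr0 scale1r finset.setD1K // subrr.
  rewrite scalerA -exprD setU1K // pos_setU1 // ltnn addnn -signr_odd odd_double.
  by rewrite expr0 scale1r subr0.
rewrite scale0r add0r /=.
case: (boolP (i \in K)) => iK; first by case: ifP; rewrite ?scaler0 ?oppr0.
case: (boolP (j \in K)) => jK; last by rewrite scaler0 oppr0.
rewrite !scalerA -scaleNr -!exprD.
have -> : (i |: K) :\ j = i |: (K :\ j).
  by apply/setP=> l; rewrite !inE; case: (eqVneq l i) => [->|] //=; rewrite nij.
congr (_ *: _); rewrite pos_setU1 // (pos_setD1 i jK) !exprD.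
case: (ltngtP i j) => [lt_ij|lt_ji|/val_inj eij]; try by rewrite /=; ring.
by rewrite eij eqxx in nij.
Qed.

End Exterior.

(** * Coordinate formulas for the wedge product and the contraction *)

Section Forms.
Variables (R : realType) (m : nat).
Local Notation C := R[i].
Local Notation form := {ffun {set 'I_m} -> {mpoly C[m]}}.
Implicit Types (i j : 'I_m) (I K : {set 'I_m}) (P Q : form) (p q : {mpoly C[m]}).

Lemma wedgeE j P K :
  wedge j P K = if j \in K then (-1) ^+ pos j K *: P (K :\ j) else 0.
Proof.
rewrite /wedge sum_ffunE; case: ifPn => jK.
  rewrite (bigD1 (K :\ j)) //= big1 ?addr0 => [|I neI].
    rewrite !ffunE /wedge_dxs !inE eqxx /= !ffunE finset.setD1K // eqxx.
    by rewrite (pos_setD1 _ jK) ltnn -scalerAr mulr1.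
  rewrite !ffunE /wedge_dxs; case: ifPn => jI; rewrite !ffunE ?mulr0 //.
  case: eqP => [eK|_]; last by rewrite scaler0 mulr0.
  by case/eqP: neI; rewrite eK setU1K.
rewrite big1 // => I _; rewrite !ffunE /wedge_dxs.
case: ifPn => jI; rewrite !ffunE ?mulr0 //.
case: eqP => [eK|_]; last by rewrite scaler0 mulr0.
by rewrite eK !inE eqxx in jK.
Qed.

Lemma contrE j P K :
  contr j P K = if j \in K then 0 else (-1) ^+ pos j K *: P (j |: K).
Proof.
rewrite /contr sum_ffunE.
have contr1 I : @contr_dxs R m j I K
    = if (j \in I) && (K == I :\ j) then (-1) ^+ pos j I else 0.
  rewrite /contr_dxs sum_ffunE; case: (boolP (j \in I)) => jI /=.
    rewrite (bigD1 j) //= big1 ?addr0 => [|i /andP[_ nij]].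
      rewrite !ffunE eqxx mulr1; by rewrite signrZ; case: eqP; rewrite ?mulr1 ?mulr0.
    by rewrite !ffunE eq_sym (negbTE nij) mulr0 scale0r.
  rewrite big1 // => i iI; rewrite !ffunE.
  have /negbTE-> : j != i by apply: contraNneq jI => ->.
  by rewrite mulr0 scale0r.
case: ifPn => jK.
  rewrite big1 // => I _; rewrite !ffunE contr1; case: ifPn => [/andP[_ /eqP eK]|].
    by rewrite eK !inE eqxx in jK.
  by rewrite mulr0.
rewrite (bigD1 (j |: K)) //= big1 ?addr0 => [|I neI].
  rewrite !ffunE contr1 !inE eqxx setU1K // eqxx /= pos_setU1 // ltnn.
  by rewrite mulrC signrZ.
rewrite !ffunE contr1; case: ifPn => [/andP[jI /eqP eK]|]; last by rewrite mulr0.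
by case/eqP: neI; rewrite eK finset.setD1K.
Qed.

End Forms.

(** * Fock representations of the Weyl and Clifford algebras *)

(** The vacuum is the constant form 1, and [fock_ind] says that it is cyclic. [sum_xm_inj] is
    injectivity of multiplication by |x|^2. [ip] is the Fischer product, linear in its first
    argument. [lact] is substitution by an arbitrary complex matrix, since non-orthogonal changes of
    coordinates occur later. *)
Record fock (F : numClosedFieldType) (m : nat) := Fock {
  fock_sort :> lmodType F;
  xm : 'I_m -> {linear fock_sort -> fock_sort};
  dm : 'I_m -> {linear fock_sort -> fock_sort};
  ew : 'I_m -> {linear fock_sort -> fock_sort};
  ec : 'I_m -> {linear fock_sort -> fock_sort};
  vac : fock_sort;
  ip : fock_sort -> fock_sort -> F;
  lact : 'M[F]_m -> {linear fock_sort -> fock_sort};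
  xm_xm : forall i j u, xm i (xm j u) = xm j (xm i u);
  dm_dm : forall i j u, dm i (dm j u) = dm j (dm i u);
  dm_xm : forall i j u, dm i (xm j u) = (i == j)%:R *: u + xm j (dm i u);
  ew_ew : forall i j u, ew i (ew j u) = - ew j (ew i u);
  ec_ec : forall i j u, ec i (ec j u) = - ec j (ec i u);
  ec_ew : forall i j u, ec i (ew j u) = (i == j)%:R *: u - ew j (ec i u);
  ew_xm : forall i j u, ew i (xm j u) = xm j (ew i u);
  ec_xm : forall i j u, ec i (xm j u) = xm j (ec i u);
  ew_dm : forall i j u, ew i (dm j u) = dm j (ew i u);
  ec_dm : forall i j u, ec i (dm j u) = dm j (ec i u);
  dm_vac : forall j, dm j vac = 0;
  ec_vac : forall j, ec j vac = 0;
  fock_ind : forall Q : fock_sort -> Prop, Q vac ->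
    (forall a u v, Q u -> Q v -> Q (a *: u + v)) ->
    (forall j u, Q u -> Q (xm j u)) -> (forall j u, Q u -> Q (ew j u)) ->
    forall u, Q u;
  sum_xm_inj : (0 < m)%N -> forall u, \sum_j xm j (xm j u) = 0 -> u = 0;
  ip_linear : forall a u v w, ip (a *: u + v) w = a * ip u w + ip v w;
  ip_conj : forall u v, ip v u = (ip u v)^*;
  ip_ge0 : forall u, 0 <= ip u u;
  ip_eq0 : forall u, ip u u = 0 -> u = 0;
  ip_xm : forall j u v, ip (xm j u) v = ip u (dm j v);
  ip_ew : forall j u v, ip (ew j u) v = ip u (ec j v);
  lact_vac : forall A, lact A vac = vac;
  lact_xm : forall A j u, lact A (xm j u) = \sum_i A i j *: xm i (lact A u);
  lact_ew : forall A j u, lact A (ew j u) = \sum_i A i j *: ew i (lact A u)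
}.

Section FockRelations.
Variables (F : numClosedFieldType) (m : nat) (M : fock F m).
Implicit Types (i j : 'I_m) (P Q u v w : M).
Local Notation xm := (@xm F m M).
Local Notation dm := (@dm F m M).
Local Notation ew := (@ew F m M).
Local Notation ec := (@ec F m M).
Local Notation vac := (@vac F m M).
Local Notation lact := (@lact F m M).

Lemma eq_opp0 (v : M) : v = - v -> v = 0.
Proof.
move=> /eqP; rewrite -subr_eq0 opprK -mulr2n -scaler_nat scaler_eq0.
by rewrite pnatr_eq0 => /eqP.
Qed.

Lemma sum_delta (G : 'I_m -> 'I_m -> M) :
  \sum_i \sum_j (i == j)%:R *: G i j = \sum_i G i i.
Proof.
apply: eq_bigr => i _; rewrite (bigD1 i) //= eqxx scale1r big1 ?addr0 // => j.
by rewrite eq_sym => /negbTE->; rewrite scale0r.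
Qed.

(** [eul] and [num] are the operators E and N: E multiplies a k-homogeneous form by k, and N
    multiplies an s-form by s. *)
Definition eul := locked (fun P => \sum_j xm j (dm j P)).
Definition num := locked (fun P => \sum_j ew j (ec j P)).
Definition opX := locked (fun P => - \sum_j xm j (ew j P)).
Definition opXs := locked (fun P => \sum_j xm j (ec j P)).
Definition opD := locked (fun P => \sum_j dm j (ew j P)).
Definition opDs := locked (fun P => - \sum_j dm j (ec j P)).

Lemma eulE P : eul P = \sum_j xm j (dm j P). Proof. by rewrite /eul -lock. Qed.
Lemma numE P : num P = \sum_j ew j (ec j P). Proof. by rewrite /num -lock. Qed.
Lemma opXE P : opX P = - \sum_j xm j (ew j P). Proof. by rewrite /opX -lock. Qed.
Lemma opXsE P : opXs P = \sum_j xm j (ec j P). Proof. by rewrite /opXs -lock. Qed.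
Lemma opDE P : opD P = \sum_j dm j (ew j P). Proof. by rewrite /opD -lock. Qed.
Lemma opDsE P : opDs P = - \sum_j dm j (ec j P). Proof. by rewrite /opDs -lock. Qed.

Fact opX_is_linear : linear opX.
Proof.
move=> a u v; rewrite !opXE scalerN -opprD scaler_sumr -big_split.
by congr (- _); apply: eq_bigr => j _; rewrite !linearP.
Qed.
HB.instance Definition _ := GRing.isLinear.Build F M M *:%R opX opX_is_linear.

Fact opXs_is_linear : linear opXs.
Proof.
move=> a u v; rewrite !opXsE scaler_sumr -big_split.
by apply: eq_bigr => j _; rewrite !linearP.
Qed.
HB.instance Definition _ := GRing.isLinear.Build F M M *:%R opXs opXs_is_linear.

Fact opD_is_linear : linear opD.
Proof.
move=> a u v; rewrite !opDE scaler_sumr -big_split.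
by apply: eq_bigr => j _; rewrite !linearP.
Qed.
HB.instance Definition _ := GRing.isLinear.Build F M M *:%R opD opD_is_linear.

Fact opDs_is_linear : linear opDs.
Proof.
move=> a u v; rewrite !opDsE scalerN -opprD scaler_sumr -big_split.
by congr (- _); apply: eq_bigr => j _; rewrite !linearP.
Qed.
HB.instance Definition _ := GRing.isLinear.Build F M M *:%R opDs opDs_is_linear.

Fact eul_is_linear : linear eul.
Proof.
move=> a u v; rewrite !eulE scaler_sumr -big_split.
by apply: eq_bigr => j _; rewrite !linearP.
Qed.
HB.instance Definition _ := GRing.isLinear.Build F M M *:%R eul eul_is_linear.

Fact num_is_linear : linear num.
Proof.
move=> a u v; rewrite !numE scaler_sumr -big_split.
by apply: eq_bigr => j _; rewrite !linearP.
Qed.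
HB.instance Definition _ := GRing.isLinear.Build F M M *:%R num num_is_linear.


Lemma opX_sum P (G : 'I_m -> M) :
  P = \sum_j G j -> opX P = - \sum_i \sum_j xm i (ew i (G j)).
Proof.
by move=> ->; rewrite opXE; congr (- _); apply: eq_bigr => i _; rewrite !linear_sum.
Qed.

Lemma opXs_sum P (G : 'I_m -> M) :
  P = \sum_j G j -> opXs P = \sum_i \sum_j xm i (ec i (G j)).
Proof.
by move=> ->; rewrite opXsE; apply: eq_bigr => i _; rewrite !linear_sum.
Qed.

Lemma opD_sum P (G : 'I_m -> M) :
  P = \sum_j G j -> opD P = \sum_i \sum_j dm i (ew i (G j)).
Proof.
by move=> ->; rewrite opDE; apply: eq_bigr => i _; rewrite !linear_sum.
Qed.

Lemma opDs_sum P (G : 'I_m -> M) :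
  P = \sum_j G j -> opDs P = - \sum_i \sum_j dm i (ec i (G j)).
Proof.
by move=> ->; rewrite opDsE; congr (- _); apply: eq_bigr => i _; rewrite !linear_sum.
Qed.

(** The product x_i x_j is symmetric and dx_i /\ dx_j antisymmetric, so exchanging the summation
    indices changes the sign. *)
Lemma opX_opX P : opX (opX P) = 0.
Proof.
apply: eq_opp0; rewrite (opXE P) linearN /= (opX_sum (erefl _)) opprK.
rewrite {1}exchange_big -sumrN; apply: eq_bigr => i _ /=.
rewrite -sumrN; apply: eq_bigr => j _ /=.
by rewrite !ew_xm xm_xm ew_ew !linearN.
Qed.

Lemma opXs_opXs P : opXs (opXs P) = 0.
Proof.
apply: eq_opp0; rewrite (opXsE P) (opXs_sum (erefl _)).
rewrite {1}exchange_big -sumrN; apply: eq_bigr => i _ /=.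
rewrite -sumrN; apply: eq_bigr => j _ /=.
by rewrite !ec_xm xm_xm ec_ec !linearN.
Qed.

Lemma ew_id j P : ew j (ew j P) = 0.
Proof. by apply: eq_opp0; rewrite {1}ew_ew. Qed.

Lemma ec_id j P : ec j (ec j P) = 0.
Proof. by apply: eq_opp0; rewrite {1}ec_ec. Qed.

Lemma opD_opX P : opD (opX P) = - opX (opD P).
Proof.
rewrite (opXE P) linearN /= (opD_sum (erefl _)) (opX_sum (opDE P)) opprK.
under eq_bigr do under eq_bigr do rewrite ew_xm dm_xm.
under eq_bigr do rewrite big_split /=.
rewrite big_split /= sum_delta big1 ?add0r; last by move=> i _; exact: ew_id.
rewrite exchange_big /= -sumrN; apply: eq_bigr => j _.
rewrite -sumrN; apply: eq_bigr => i _ /=.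
by rewrite ew_dm ew_ew !linearN opprK.
Qed.

Lemma opDs_opXs P : opDs (opXs P) = - opXs (opDs P).
Proof.
rewrite (opDsE P) linearN /= (opXs_sum (erefl _)) (opDs_sum (opXsE P)) opprK.
under eq_bigr do under eq_bigr do rewrite ec_xm dm_xm.
under eq_bigr do rewrite big_split /=.
rewrite big_split /= sum_delta big1 ?add0r; last by move=> i _; exact: ec_id.
rewrite exchange_big /= -sumrN; apply: eq_bigr => j _.
rewrite -sumrN; apply: eq_bigr => i _ /=.
by rewrite ec_dm ec_ec !linearN opprK.
Qed.

(** Commuting the derivative past x_j leaves N on the diagonal, and anticommuting dx_i /\ with the
    contraction leaves E; the remaining double sum is - x^* d. *)
Lemma opD_opXs P : opD (opXs P) = eul P + num P - opXs (opD P).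
Proof.
rewrite (opD_sum (opXsE P)) (opXs_sum (opDE P)).
under eq_bigr do under eq_bigr do rewrite ew_xm dm_xm.
under eq_bigr do rewrite big_split /=.
rewrite big_split /= sum_delta [RHS]addrAC addrC; congr (_ + _).
rewrite eulE; have -> : \sum_j xm j (dm j P) = \sum_i \sum_j (i == j)%:R *: xm i (dm j P).
  by rewrite sum_delta.
rewrite [X in _ - X]exchange_big /= -sumrB; apply: eq_bigr => i _.
rewrite -sumrB; apply: eq_bigr => j _; rewrite ec_dm ec_ew.
rewrite [in RHS]eq_sym; case: eqVneq => [->|_].
  by rewrite !scale1r (linearB (dm i)) (linearB (xm i)) /= opprB addrCA subrr addr0.
  by rewrite !scale0r !sub0r !linearN opprK.
by rewrite numE.
Qed.

Lemma opDs_opX P :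
  opDs (opX P) = m%:R *: P + eul P - num P - opX (opDs P).
Proof.
rewrite (opXE P) linearN /= (opDs_sum (erefl _)) opprK.
rewrite (opDsE P) linearN /= opprK (opX_sum (erefl _)).
under eq_bigr do under eq_bigr do rewrite ec_xm dm_xm.
under eq_bigr do rewrite big_split /=.
rewrite big_split /= sum_delta.
(* Contraction follows the wedge here, so the diagonal gives m - N instead of N. *)
have -> : \sum_i ec i (ew i P) = m%:R *: P - num P.
  rewrite numE.
  under eq_bigr do rewrite ec_ew eqxx scale1r.
  by rewrite sumrB sumr_const card_ord scaler_nat.
rewrite -[RHS]addrA addrACA; congr (_ + _).
rewrite eulE; have -> : \sum_j xm j (dm j P) = \sum_i \sum_j (i == j)%:R *: xm i (dm j P).
  by rewrite sum_delta.
rewrite exchange_big /= -sumrB; apply: eq_bigr => i _.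
rewrite -sumrB; apply: eq_bigr => j _ /=; rewrite ew_dm ec_ew eq_sym.
by rewrite (linearB (dm j)) (linearB (xm i)) /= !linearZ.
Qed.

(** The coordinates commute with everything in sight, so only the anticommutator of dx_i /\ and a
    contraction survives, on the diagonal. *)
Lemma xop_xstar_q P : opX (opXs P) + opXs (opX P) = - \sum_j xm j (xm j P).
Proof.
rewrite (opX_sum (opXsE P)) (opXE P) linearN /= (opXs_sum (erefl _)).
rewrite -opprD; congr (- _).
rewrite [X in _ + X]exchange_big -big_split /= -(sum_delta (fun i j => xm i (xm j P))).
apply: eq_bigr => i _; rewrite -big_split; apply: eq_bigr => j _ /=.
rewrite ew_xm ec_xm ec_ew (linearB (xm i)) (linearB (xm j)) /= eq_sym !linearZ /=.
by rewrite xm_xm addrCA [xm i (xm j _)]xm_xm subrr addr0 xm_xm.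
Qed.

End FockRelations.

(** * Inner product and linear substitutions *)

Section InnerProduct.
Variables (F : numClosedFieldType) (m : nat) (M : fock F m).
Implicit Types (i j : 'I_m) (u v w : M).
Local Notation xm := (@xm F m M).
Local Notation dm := (@dm F m M).
Local Notation ew := (@ew F m M).
Local Notation ec := (@ec F m M).
Local Notation vac := (@vac F m M).
Local Notation ip := (@ip F m M).
Local Notation lact := (@lact F m M).

Lemma ip0l v : ip 0 v = 0.
Proof.
have /eqP := ip_linear 1 0 0 v; rewrite scale1r addr0 mul1r.
by rewrite -[X in X == _]addr0 (inj_eq (addrI _)) eq_sym => /eqP.
Qed.

Lemma ipDl u v w : ip (u + v) w = ip u w + ip v w.
Proof. by rewrite -[u]scale1r ip_linear mul1r scale1r. Qed.

Lemma ipZl a u w : ip (a *: u) w = a * ip u w.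
Proof. by rewrite -[a *: u]addr0 ip_linear ip0l addr0. Qed.

Lemma ipNl u w : ip (- u) w = - ip u w.
Proof. by rewrite -scaleN1r ipZl mulN1r. Qed.

Lemma ipBl u v w : ip (u - v) w = ip u w - ip v w.
Proof. by rewrite ipDl ipNl. Qed.

Lemma ip_suml I (r : seq I) (G : I -> M) w :
  ip (\sum_(i <- r) G i) w = \sum_(i <- r) ip (G i) w.
Proof. by apply: (big_morph (ip^~ w)) => [u v|]; rewrite ?ipDl ?ip0l. Qed.

Lemma ip0r v : ip v 0 = 0.
Proof. by rewrite ip_conj ip0l conjC0. Qed.

Lemma ipDr u v w : ip w (u + v) = ip w u + ip w v.
Proof. by rewrite !(ip_conj _ w) ipDl rmorphD. Qed.

Lemma ipZr a u w : ip w (a *: u) = a^* * ip w u.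
Proof. by rewrite !(ip_conj _ w) ipZl rmorphM. Qed.

Lemma ipNr u w : ip w (- u) = - ip w u.
Proof. by rewrite !(ip_conj _ w) ipNl rmorphN. Qed.

Lemma ip_sumr I (r : seq I) (G : I -> M) w :
  ip w (\sum_(i <- r) G i) = \sum_(i <- r) ip w (G i).
Proof. by apply: (big_morph (ip w)) => [u v|]; rewrite ?ipDr ?ip0r. Qed.

Lemma ip_sym0 u v : ip u v = 0 -> ip v u = 0.
Proof. by move=> uv0; rewrite ip_conj uv0 conjC0. Qed.

Lemma ip_dm j u v : ip (dm j u) v = ip u (xm j v).
Proof. by rewrite ip_conj -ip_xm -ip_conj. Qed.

Lemma ip_ec j u v : ip (ec j u) v = ip u (ew j v).
Proof. by rewrite ip_conj -ip_ew -ip_conj. Qed.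

Lemma ip_opX u v : ip (opX u) v = ip u (opDs v).
Proof.
rewrite opXE opDsE ipNl ipNr ip_suml ip_sumr; congr (- _).
by apply: eq_bigr => j _; rewrite ip_xm ip_ew ec_dm.
Qed.

Lemma ip_opXs u v : ip (opXs u) v = ip u (opD v).
Proof.
rewrite opXsE opDE ip_suml ip_sumr.
by apply: eq_bigr => j _; rewrite ip_xm ip_ec ew_dm.
Qed.

Lemma ip_opD u v : ip (opD u) v = ip u (opXs v).
Proof. by rewrite ip_conj -ip_opXs -ip_conj. Qed.

Lemma ip_opDs u v : ip (opDs u) v = ip u (opX v).
Proof. by rewrite ip_conj -ip_opX -ip_conj. Qed.

Lemma ip_eul u v : ip (eul u) v = ip u (eul v).
Proof.
by rewrite !eulE ip_suml ip_sumr; apply: eq_bigr => j _; rewrite ip_xm ip_dm.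
Qed.

Lemma ip_num u v : ip (num u) v = ip u (num v).
Proof.
by rewrite !numE ip_suml ip_sumr; apply: eq_bigr => j _; rewrite ip_ew ip_ec.
Qed.

End InnerProduct.

(** * Action of arbitrary matrices and its adjoint *)

Section FockAction.
Variables (F : numClosedFieldType) (m : nat) (M : fock F m).
Implicit Types (i j : 'I_m) (u v w : M) (A B : 'M[F]_m).
Local Notation xm := (@xm F m M).
Local Notation dm := (@dm F m M).
Local Notation ew := (@ew F m M).
Local Notation ec := (@ec F m M).
Local Notation vac := (@vac F m M).
Local Notation ip := (@ip F m M).
Local Notation lact := (@lact F m M).

(** The record fixes the action only on the vacuum and on the creation operators; the rule for
    derivatives follows by induction from the vacuum. The coefficients are those of row j, not of
    column j. *)
Lemma lact_dm A j u : dm j (lact A u) = \sum_i A j i *: lact A (dm i u).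
Proof.
elim/(@fock_ind _ _ M): u => [|a u v IHu IHv|l u IHu|l u IHu].
- rewrite lact_vac dm_vac big1 // => i _.
  by rewrite dm_vac linear0 scaler0.
- rewrite !linearP IHu IHv scaler_sumr -big_split; apply: eq_bigr => i _ /=.
  by rewrite !linearP /= !scalerA mulrC.
- rewrite lact_xm linear_sum /=.
  under eq_bigr do rewrite linearZ /= dm_xm IHu scalerDr linear_sum /=.
  under [RHS]eq_bigr do rewrite dm_xm linearD lact_xm linearZ /= scalerDr.
  rewrite !big_split /=; congr (_ + _).
    rewrite (bigD1 j) //= [RHS](bigD1 l) //= !eqxx !scale1r !big1 //.
      by move=> i /negbTE->; rewrite scale0r scaler0.
    by move=> i; rewrite eq_sym => /negbTE->; rewrite scale0r scaler0.
  under eq_bigr do rewrite scaler_sumr.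
  rewrite exchange_big; apply: eq_bigr => k _; rewrite scaler_sumr.
  by apply: eq_bigr => i _; rewrite linearZ /= !scalerA mulrC.
rewrite lact_ew linear_sum /=.
under eq_bigr do rewrite linearZ /= -ew_dm IHu linear_sum /=.
under [RHS]eq_bigr do rewrite -ew_dm lact_ew scaler_sumr.
rewrite [RHS]exchange_big; apply: eq_bigr => k _; rewrite scaler_sumr.
by apply: eq_bigr => i _; rewrite linearZ /= !scalerA mulrC.
Qed.

Lemma lact_ec A j u : ec j (lact A u) = \sum_i A j i *: lact A (ec i u).
Proof.
elim/(@fock_ind _ _ M): u => [|a u v IHu IHv|l u IHu|l u IHu].
- rewrite lact_vac ec_vac big1 // => i _.
  by rewrite ec_vac linear0 scaler0.
- rewrite !linearP IHu IHv scaler_sumr -big_split; apply: eq_bigr => i _ /=.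
  by rewrite !linearP /= !scalerA mulrC.
- rewrite lact_xm linear_sum /=.
  under eq_bigr do rewrite linearZ /= ec_xm IHu linear_sum /=.
  under [RHS]eq_bigr do rewrite ec_xm lact_xm scaler_sumr.
  rewrite [RHS]exchange_big; apply: eq_bigr => k _; rewrite scaler_sumr.
  by apply: eq_bigr => i _; rewrite linearZ /= !scalerA mulrC.
rewrite lact_ew linear_sum /=.
under eq_bigr do rewrite linearZ /= ec_ew IHu scalerBr linear_sum /=.
under [RHS]eq_bigr do rewrite ec_ew linearB lact_ew linearZ /= scalerBr.
rewrite !sumrB /=; congr (_ - _).
  rewrite (bigD1 j) //= [RHS](bigD1 l) //= !eqxx !scale1r !big1 //.
    by move=> i /negbTE->; rewrite scale0r scaler0.
  by move=> i; rewrite eq_sym => /negbTE->; rewrite scale0r scaler0.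
under eq_bigr do rewrite scaler_sumr.
rewrite exchange_big; apply: eq_bigr => k _; rewrite scaler_sumr.
by apply: eq_bigr => i _; rewrite linearZ /= !scalerA mulrC.
Qed.

Lemma lact_mul A B u : lact (A *m B) u = lact A (lact B u).
Proof.
elim/(@fock_ind _ _ M): u => [|a u v IHu IHv|l u IHu|l u IHu].
- by rewrite !lact_vac.
- by rewrite !linearP IHu IHv.
- rewrite !lact_xm linear_sum IHu /=.
  under [RHS]eq_bigr do rewrite linearZ /= lact_xm scaler_sumr.
  rewrite exchange_big; apply: eq_bigr => i _; rewrite mxE scaler_suml.
  by apply: eq_bigr => k _; rewrite scalerA mulrC.
rewrite !lact_ew linear_sum IHu /=.
under [RHS]eq_bigr do rewrite linearZ /= lact_ew scaler_sumr.
rewrite exchange_big; apply: eq_bigr => i _; rewrite mxE scaler_suml.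
by apply: eq_bigr => k _; rewrite scalerA mulrC.
Qed.

Lemma lact1 u : lact 1%:M u = u.
Proof.
have sum1 (G : 'I_m -> M) l : \sum_i (1%:M : 'M[F]_m) i l *: G i = G l.
  rewrite (bigD1 l) //= mxE eqxx scale1r big1 ?addr0 // => i /negbTE nil.
  by rewrite mxE nil scale0r.
elim/(@fock_ind _ _ M): u => [|a u v IHu IHv|l u IHu|l u IHu].
- exact: lact_vac.
- by rewrite linearP /= IHu IHv.
- by rewrite lact_xm IHu sum1.
- by rewrite lact_ew IHu sum1.
Qed.

Definition adjm A : 'M[F]_m := map_mx Num.conj A^T.

Lemma ip_vac_lact A u : ip vac (lact A u) = ip vac u.
Proof.
elim/(@fock_ind _ _ M): u => [|a u v IHu IHv|l u _|l u _].
- by rewrite lact_vac.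
- by rewrite linearP !ipDr !ipZr IHu IHv.
- rewrite lact_xm ip_sumr -ip_dm dm_vac ip0l big1 // => i _.
  by rewrite ipZr -ip_dm dm_vac ip0l mulr0.
rewrite lact_ew ip_sumr -ip_ec ec_vac ip0l big1 // => i _.
by rewrite ipZr -ip_ec ec_vac ip0l mulr0.
Qed.

(** A creation operator crosses the inner product as its annihilation operator, whose transformation
    rule has the matrix transposed; antilinearity in the second argument adds the conjugation. In
    particular real orthogonal matrices act unitarily. *)
Lemma ip_lact A u v : ip (lact A u) v = ip u (lact (adjm A) v).
Proof.
elim/(@fock_ind _ _ M): u v => [|a u1 u2 IH1 IH2|l u IHu|l u IHu] v.
- by rewrite lact_vac ip_vac_lact.
- by rewrite linearP !ipDl !ipZl IH1 IH2.
- rewrite lact_xm ip_suml ip_xm lact_dm ip_sumr; apply: eq_bigr => i _.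
  by rewrite ipZl ip_xm IHu ipZr !mxE conjCK.
rewrite lact_ew ip_suml ip_ew lact_ec ip_sumr; apply: eq_bigr => i _.
by rewrite ipZl ip_ew IHu ipZr !mxE conjCK.
Qed.

Lemma lact_eul A u : eul (lact A u) = lact A (eul u).
Proof.
rewrite !eulE linear_sum /=.
under eq_bigr do rewrite lact_dm linear_sum /=.
rewrite exchange_big; apply: eq_bigr => i _; rewrite lact_xm.
by apply: eq_bigr => j _; rewrite linearZ.
Qed.

Lemma lact_num A u : num (lact A u) = lact A (num u).
Proof.
rewrite !numE linear_sum /=.
under eq_bigr do rewrite lact_ec linear_sum /=.
rewrite exchange_big; apply: eq_bigr => i _; rewrite lact_ew.
by apply: eq_bigr => j _; rewrite linearZ.
Qed.

Lemma lact_opXs A u : opXs (lact A u) = lact A (opXs u).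
Proof.
rewrite !opXsE linear_sum /=.
under eq_bigr do rewrite lact_ec linear_sum /=.
rewrite exchange_big; apply: eq_bigr => i _; rewrite lact_xm.
by apply: eq_bigr => j _; rewrite linearZ.
Qed.

Lemma sum_mulmx1l A B (G : 'I_m -> M) i : A *m B = 1%:M ->
  \sum_k \sum_j (A i j * B j k) *: G k = G i.
Proof.
move=> AB; under eq_bigr do rewrite -scaler_suml.
have E k : \sum_j A i j * B j k = (i == k)%:R.
  by have := congr1 (fun X : 'M_m => X i k) AB; rewrite !mxE.
under eq_bigr do rewrite E.
rewrite (bigD1 i) //= eqxx scale1r big1 ?addr0 // => k.
by rewrite eq_sym => /negbTE->; rewrite scale0r.
Qed.

Lemma sum_mulmx1r A B (G : 'I_m -> M) i : A *m B = 1%:M ->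
  \sum_k \sum_j (A k j * B j i) *: G k = G i.
Proof.
move=> AB; rewrite -[RHS](sum_mulmx1l G i (_ : B^T *m A^T = 1%:M)).
  by apply: eq_bigr => k _; apply: eq_bigr => j _; rewrite !mxE mulrC.
by rewrite -trmx_mul AB trmx1.
Qed.

(** The operator d is natural under all invertible substitutions, not only orthogonal ones; x and
    d^* involve the metric. This is used for [hmx], which is not orthogonal. *)
Lemma lact_opD A u : A \in unitmx -> opD (lact A u) = lact A (opD u).
Proof.
move=> uA; rewrite !opDE linear_sum /=.
(* The rule [lact_ew] solved for the wedge on the transformed side, which brings in the inverse
   matrix. *)
have ew_lact l : ew l (lact A u) = \sum_j invmx A j l *: lact A (ew j u).
  under eq_bigr do rewrite lact_ew scaler_sumr.
  rewrite exchange_big -[LHS](sum_mulmx1r (fun k => ew k (lact A u)) l (mulmxV uA)).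
  by apply: eq_bigr => k _; apply: eq_bigr => j _; rewrite scalerA mulrC.
under eq_bigr do rewrite ew_lact linear_sum /=.
rewrite exchange_big; apply: eq_bigr => i _ /=.
under eq_bigr do rewrite linearZ /= lact_dm scaler_sumr.
rewrite exchange_big -[RHS](sum_mulmx1l (fun k => lact A (dm k (ew i u))) i (mulVmx uA)).
by apply: eq_bigr => k _; apply: eq_bigr => j _; rewrite scalerA.
Qed.

Lemma lact_opX A u : A *m A^T = 1%:M -> opX (lact A u) = lact A (opX u).
Proof.
move=> AAT; rewrite !opXE linearN /=; congr (- _); rewrite linear_sum /=.
under [RHS]eq_bigr do rewrite lact_xm lact_ew.
under [RHS]eq_bigr do under eq_bigr do rewrite (linear_sum (xm _)) scaler_sumr /=.
rewrite exchange_big /=; apply: eq_bigr => i _.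
rewrite exchange_big -[LHS](sum_mulmx1l (fun k => xm i (ew k (lact A u))) i AAT).
apply: eq_bigr => k _; apply: eq_bigr => j _.
by rewrite linearZ /= scalerA mxE.
Qed.

Lemma lact_opDs A u : A *m A^T = 1%:M -> opDs (lact A u) = lact A (opDs u).
Proof.
move=> AAT; have ATA := mulmx1C AAT.
rewrite !opDsE linearN /=; congr (- _); rewrite linear_sum /=.
under eq_bigr do rewrite lact_ec linear_sum /=.
rewrite exchange_big; apply: eq_bigr => i _ /=.
under eq_bigr do rewrite linearZ /= lact_dm scaler_sumr.
rewrite exchange_big -[RHS](sum_mulmx1l (fun k => lact A (dm k (ec i u))) i ATA).
by apply: eq_bigr => k _; apply: eq_bigr => j _; rewrite scalerA mxE.
Qed.

End FockAction.

Local Open Scope classical_set_scope.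

(** * Direct sums and alternating words *)

Section SumSpaces.
Variables (K : fieldType) (V : lmodType K).
Implicit Types (U W : set V).

Lemma subspaceD U u v : subspace U -> U u -> U v -> U (u + v).
Proof. by move=> [_ UP] Uu Uv; rewrite -[u]scale1r; apply: UP. Qed.

Lemma subspaceZ U a u : subspace U -> U u -> U (a *: u).
Proof. by move=> [U0 UP] Uu; rewrite -[_ *: _]addr0; apply: UP. Qed.

Lemma subspaceN U u : subspace U -> U u -> U (- u).
Proof. by move=> sU Uu; rewrite -scaleN1r; apply: subspaceZ. Qed.

Lemma subspace_sum (I : eqType) U (r : seq I) (F : I -> V) :
  subspace U -> (forall i, i \in r -> U (F i)) -> U (\sum_(i <- r) F i).
Proof.
move=> sU UF; rewrite big_seq; apply: big_ind => [|u v|i]; first by case: sU.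
  exact: subspaceD.
exact: UF.
Qed.

Lemma subspaceI U W : subspace U -> subspace W -> subspace (U `&` W).
Proof.
move=> [U0 UP] [W0 WP]; split=> // a u v [Uu Wu] [Uv Wv].
by split; [apply: UP|apply: WP].
Qed.

Section Family.
Variables (I : eqType) (D : set I) (U : I -> set V).

Lemma sumspace_sub (S : set V) :
  subspace S -> (forall i, D i -> U i `<=` S) -> sumspace D U `<=` S.
Proof.
move=> sS US v [r [u [_ ru ->]]]; apply: subspace_sum => // i /ru[Di].
exact: US.
Qed.

Lemma sumspace_mem i u : D i -> U i u -> sumspace D U u.
Proof.
move=> Di Ui; exists [:: i], (fun=> u); split=> //; last by rewrite big_seq1.
by move=> j; rewrite inE => /eqP->.
Qed.

Lemma sumspace_subspace :
  (forall i, D i -> subspace (U i)) -> subspace (sumspace D U).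
Proof.
move=> sU; split; first by exists [::], (fun=> 0); split=> //; rewrite big_nil.
move=> a u v [r [f [ur rf ->]]] [q [g [uq qg ->]]].
(* Both families are extended by zero to a common duplicate-free list of indices. *)
pose ext (s : seq I) (h : I -> V) i := if i \in s then h i else 0.
exists (undup (r ++ q)), (fun i => a *: ext r f i + ext q g i).
have sum_ext s h : uniq s -> {subset s <= r ++ q} ->
    \sum_(i <- undup (r ++ q)) ext s h i = \sum_(i <- s) h i.
  move=> us ss; rewrite /ext -big_mkcond -big_filter; apply: perm_big.
  apply: uniq_perm => //; first by rewrite filter_uniq ?undup_uniq.
  by move=> i; rewrite mem_filter mem_undup; case: (boolP (i \in s)) => //= /ss.
split; first exact: undup_uniq.
- move=> i; rewrite mem_undup mem_cat => irq.
  have Di : D i by case/orP: irq => [/rf|/qg] [].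
  split=> //; have [U0 UP] := sU _ Di.
  apply: UP; rewrite /ext; case: ifP => //; first by case/rf.
  by case/qg.
rewrite big_split -scaler_sumr /= !sum_ext // => i mulii; rewrite mem_cat mulii //.
by rewrite orbT.
Qed.

End Family.
End SumSpaces.

(** * Bidegrees and words applied to solutions of the Hodge-de Rham system *)

Section FockDecomposition.
Variables (F : numClosedFieldType) (m : nat) (M : fock F m).
Implicit Types (i j : 'I_m) (u v h : M) (w : seq bool).
Local Notation xm := (@xm F m M).
Local Notation dm := (@dm F m M).
Local Notation ew := (@ew F m M).
Local Notation ec := (@ec F m M).
Local Notation vac := (@vac F m M).
Local Notation ip := (@ip F m M).
Local Notation lact := (@lact F m M).

(** The degrees are scalars of F rather than natural numbers, so that lowering them needs no case
    distinction; [bieig_ge0] later excludes negative values. *)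
Definition bieig (a b : F) u := eul u = a *: u /\ num u = b *: u.

Lemma bieig_subspace a b : subspace (bieig a b).
Proof.
split; first by split; rewrite linear0 scaler0.
move=> c u v [Eu Nu] [Ev Nv]; split.
  by rewrite eul_is_linear Eu Ev scalerDr !scalerA mulrC.
by rewrite num_is_linear Nu Nv scalerDr !scalerA mulrC.
Qed.

Lemma sum_delta1 (G : 'I_m -> M) j : \sum_i (i == j)%:R *: G i = G j.
Proof.
rewrite (bigD1 j) //= eqxx scale1r big1 ?addr0 // => i /negbTE->.
by rewrite scale0r.
Qed.

Lemma eul_xm j u : eul (xm j u) = xm j u + xm j (eul u).
Proof.
rewrite !eulE linear_sum /=; under eq_bigr do rewrite dm_xm linearD linearZ /=.
rewrite big_split /= (sum_delta1 (fun i => xm i u)); congr (_ + _).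
by apply: eq_bigr => i _; rewrite xm_xm.
Qed.

Lemma num_xm j u : num (xm j u) = xm j (num u).
Proof.
by rewrite !numE linear_sum; apply: eq_bigr => i _; rewrite ec_xm ew_xm.
Qed.

Lemma eul_dm j u : eul (dm j u) = dm j (eul u) - dm j u.
Proof.
rewrite !eulE linear_sum /=; under [in RHS]eq_bigr do rewrite dm_xm eq_sym.
rewrite big_split /= (sum_delta1 (fun i => dm i u)) [RHS]addrAC subrr add0r.
by apply: eq_bigr => i _; rewrite dm_dm.
Qed.

Lemma num_dm j u : num (dm j u) = dm j (num u).
Proof.
by rewrite !numE linear_sum; apply: eq_bigr => i _; rewrite ec_dm ew_dm.
Qed.

Lemma eul_ew j u : eul (ew j u) = ew j (eul u).
Proof.
by rewrite !eulE linear_sum; apply: eq_bigr => i _; rewrite ew_xm ew_dm.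
Qed.

Lemma eul_ec j u : eul (ec j u) = ec j (eul u).
Proof.
by rewrite !eulE linear_sum; apply: eq_bigr => i _; rewrite ec_xm ec_dm.
Qed.

Lemma num_ew j u : num (ew j u) = ew j u + ew j (num u).
Proof.
rewrite !numE linear_sum /=; under eq_bigr do rewrite ec_ew linearB linearZ /=.
rewrite sumrB (sum_delta1 (fun i => ew i u)) -sumrN; congr (_ + _).
by apply: eq_bigr => i _; rewrite [in RHS]ew_ew.
Qed.

Lemma num_ec j u : num (ec j u) = ec j (num u) - ec j u.
Proof.
rewrite !numE linear_sum /=; under [in RHS]eq_bigr do rewrite ec_ew eq_sym.
rewrite sumrB (sum_delta1 (fun i => ec i u)) [RHS]addrAC subrr add0r -sumrN.
by apply: eq_bigr => i _; rewrite ec_ec linearN.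
Qed.

Lemma bieig_xm a b j u : bieig a b u -> bieig (a + 1) b (xm j u).
Proof.
case=> Eu Nu; split; rewrite ?eul_xm ?num_xm ?Eu ?Nu linearZ //=.
by rewrite scalerDl scale1r addrC.
Qed.

Lemma bieig_dm a b j u : bieig a b u -> bieig (a - 1) b (dm j u).
Proof.
case=> Eu Nu; split; rewrite ?eul_dm ?num_dm ?Eu ?Nu linearZ //=.
by rewrite scalerBl scale1r.
Qed.

Lemma bieig_ew a b j u : bieig a b u -> bieig a (b + 1) (ew j u).
Proof.
case=> Eu Nu; split; rewrite ?eul_ew ?num_ew ?Eu ?Nu linearZ //=.
by rewrite scalerDl scale1r addrC.
Qed.

Lemma bieig_ec a b j u : bieig a b u -> bieig a (b - 1) (ec j u).
Proof.
case=> Eu Nu; split; rewrite ?eul_ec ?num_ec ?Eu ?Nu linearZ //=.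
by rewrite scalerBl scale1r.
Qed.

Lemma bieig_opX a b u : bieig a b u -> bieig (a + 1) (b + 1) (opX u).
Proof.
move=> bu; rewrite opXE; apply: subspaceN; first exact: bieig_subspace.
by apply: subspace_sum => [|j _]; [exact: bieig_subspace|apply/bieig_xm/bieig_ew].
Qed.

Lemma bieig_opXs a b u : bieig a b u -> bieig (a + 1) (b - 1) (opXs u).
Proof.
move=> bu; rewrite opXsE.
by apply: subspace_sum => [|j _]; [exact: bieig_subspace|apply/bieig_xm/bieig_ec].
Qed.

Lemma bieig_opD a b u : bieig a b u -> bieig (a - 1) (b + 1) (opD u).
Proof.
move=> bu; rewrite opDE.
by apply: subspace_sum => [|j _]; [exact: bieig_subspace|apply/bieig_dm/bieig_ew].
Qed.

Lemma bieig_opDs a b u : bieig a b u -> bieig (a - 1) (b - 1) (opDs u).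
Proof.
move=> bu; rewrite opDsE; apply: subspaceN; first exact: bieig_subspace.
by apply: subspace_sum => [|j _]; [exact: bieig_subspace|apply/bieig_dm/bieig_ec].
Qed.

Lemma bieig_vac : bieig 0 0 vac.
Proof.
by split; rewrite ?eulE ?numE scale0r big1 // => j _;
  rewrite ?dm_vac ?ec_vac linear0.
Qed.

Lemma ip_gt0 u : u != 0 -> 0 < ip u u.
Proof.
by move=> u0; rewrite lt_def ip_ge0 andbT; apply: contraNneq u0 => /ip_eq0->.
Qed.

(** E, N and m - N are sums of operators of the form T^* T, the last one through contraction after
    wedge. *)
Lemma bieig_ge0 a b u : bieig a b u -> u != 0 -> [/\ 0 <= a, 0 <= b & b <= m%:R].
Proof.
move=> [Eu Nu] /ip_gt0 u_gt0; split.
- rewrite -(pmulr_lge0 _ u_gt0) -ipZl -Eu eulE ip_suml sumr_ge0 // => j _.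
  by rewrite ip_xm ip_ge0.
- rewrite -(pmulr_lge0 _ u_gt0) -ipZl -Nu numE ip_suml sumr_ge0 // => j _.
  by rewrite ip_ew ip_ge0.
rewrite -subr_ge0 -(pmulr_lge0 _ u_gt0) mulrBl -(ipZl b) -Nu numE ip_suml
  mulr_natl -[X in _ *+ X]card_ord.
rewrite -sumr_const -sumrB sumr_ge0 // => j _.
have <- : ip (ec j (ew j u)) u = ip u u - ip (ew j (ec j u)) u.
  by rewrite ec_ew eqxx scale1r ipBl.
by rewrite ip_ec ip_ge0.
Qed.

(** E and N are self-adjoint: a nonzero product would make a and b the conjugates of a' and b', and
    a and b are real. *)
Lemma bieig_orth a b a' b' u v : a \is Num.real -> b \is Num.real ->
  bieig a b u -> bieig a' b' v -> (a, b) != (a', b') -> ip u v = 0.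
Proof.
move=> /CrealP ra /CrealP rb [Eu Nu] [Ev Nv]; rewrite xpair_eqE negb_and.
have [|u0] := eqVneq (ip u v) 0; first by [].
have := ip_eul u v; have := ip_num u v; rewrite Eu Ev Nu Nv !ipZl !ipZr.
move=> /(mulIf u0) bb /(mulIf u0) aa; rewrite -{1}ra -{1}rb bb aa !conjCK.
by rewrite !eqxx.
Qed.

Definition bihom s k u := bieig k%:R s%:R u.

Lemma bihom_orth s k s' k' u v :
  bihom s k u -> bihom s' k' v -> (s, k) != (s', k') -> ip u v = 0.
Proof.
move=> bu bv neq; apply: (bieig_orth _ _ bu bv); rewrite ?realn //.
by apply: contraNneq neq => -[/eqP kk /eqP ss]; move: kk ss; rewrite !eqr_nat => /eqP-> /eqP->.
Qed.

Definition hod s k : set M := [set h | [/\ bihom s k h, opD h = 0 & opDs h = 0]].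

Lemma hod_subspace s k : subspace (hod s k).
Proof.
split; first by split; rewrite ?linear0 //; case: (bieig_subspace k%:R s%:R).
move=> c u v [bu Du Dsu] [bv Dv Dsv]; split.
- by case: (bieig_subspace k%:R s%:R) => _; apply.
- by rewrite linearP /= Du Dv scaler0 addr0.
by rewrite linearP /= Dsu Dsv scaler0 addr0.
Qed.

Definition wop (w : seq bool) u : M :=
  foldr (fun (c : bool) v => if c then opX v else opXs v) u w.

Lemma wop_is_linear w : linear (wop w).
Proof.
by move=> a u v; elim: w => //= b w ->; case: b; rewrite linearP.
Qed.

Lemma wop0 w : wop w 0 = 0.
Proof. by elim: w => //= b w ->; case: b; rewrite linear0. Qed.

Lemma wop_bieig w a b h : bieig a b h ->
  exists b', bieig (a + (size w)%:R) b' (wop w h).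
Proof.
move=> bh; elim: w => [|c w [b' IHw]] /=; first by exists b; rewrite addr0.
rewrite -addn1 natrD addrA; case: c.
  by exists (b' + 1); apply: bieig_opX.
by exists (b' - 1); apply: bieig_opXs.
Qed.

Lemma opD_opXs_eig a b u : bieig a b u ->
  opD (opXs u) = (a + b) *: u - opXs (opD u).
Proof. by move=> [Eu Nu]; rewrite opD_opXs Eu Nu scalerDl. Qed.

Lemma opDs_opX_eig a b u : bieig a b u ->
  opDs (opX u) = (m%:R + a - b) *: u - opX (opDs u).
Proof. by move=> [Eu Nu]; rewrite opDs_opX Eu Nu scalerBl scalerDl. Qed.

(** The span of all words of length n applied to h, as an intersection of subspaces. Non-alternating
    words are included, so no bookkeeping of letters is needed when words are rewritten. *)
Definition wspan h n : set M :=
  [set y | forall U : set M, subspace U ->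
    (forall w, size w = n -> U (wop w h)) -> U y].

Lemma wspan_subspace h n : subspace (wspan h n).
Proof.
split; first by move=> U [].
move=> a u v hu hv U sU Uw; case: (sU) => _; apply; [exact: hu|exact: hv].
Qed.

Lemma wspan_wop h w : wspan h (size w) (wop w h).
Proof. by move=> U sU; apply. Qed.

Lemma preim_subspace (f : {linear M -> M}) (U : set M) :
  subspace U -> subspace (f @^-1` U).
Proof.
move=> [U0 UP]; split; first by rewrite /preimage /= linear0.
by move=> a u v; rewrite /preimage /= linearP; apply: UP.
Qed.

Lemma wspan_opX h n y : wspan h n y -> wspan h n.+1 (opX y).
Proof.
move=> hy U sU Uw; change ((@opX F m M @^-1` U) y); apply: hy; first exact: preim_subspace.
by move=> w sw; apply: (Uw (true :: w)); rewrite /= sw.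
Qed.

Lemma wspan_opXs h n y : wspan h n y -> wspan h n.+1 (opXs y).
Proof.
move=> hy U sU Uw; change ((@opXs F m M @^-1` U) y); apply: hy; first exact: preim_subspace.
by move=> w sw; apply: (Uw (false :: w)); rewrite /= sw.
Qed.

(** Moved to the right through the word, d and d^* either anticommute with a letter or produce E + N
    or m + E - N, a scalar on the bihomogeneous vector standing there; at the end they kill h. *)
Lemma wspan_opD s k h w : hod s k h ->
  wspan h (size w).-1 (opD (wop w h)) /\ wspan h (size w).-1 (opDs (wop w h)).
Proof.
case=> bh Dh Dsh; elim: w => [|c w [IHD IHDs]] /=.
  by rewrite Dh Dsh; split; case: (wspan_subspace h 0).
have sW := wspan_subspace h (size w).
(* For the empty word the predecessor of the length is not one less, so there y has to be 0. *)
have stepX y : (w = [::] -> y = 0) -> wspan h (size w).-1 y ->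
    wspan h (size w) (opX y).
  case: (w) => [->//|c' w' _]; last exact: wspan_opX.
  by rewrite linear0; case: (wspan_subspace h 0).
have stepXs y : (w = [::] -> y = 0) -> wspan h (size w).-1 y ->
    wspan h (size w) (opXs y).
  case: (w) => [->//|c' w' _]; last exact: wspan_opXs.
  by rewrite linear0; case: (wspan_subspace h 0).
have [b bw] := wop_bieig w bh.
have wD0 : w = [::] -> opD (wop w h) = 0 by move=> ->.
have wDs0 : w = [::] -> opDs (wop w h) = 0 by move=> ->.
case: c; split.
- by rewrite opD_opX; apply: (subspaceN sW); exact: stepX _ wD0 IHD.
- rewrite (opDs_opX_eig bw); apply: (subspaceD sW).
    by apply: (subspaceZ _ sW); apply: wspan_wop.
  by apply: (subspaceN sW); exact: stepX _ wDs0 IHDs.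
- rewrite (opD_opXs_eig bw); apply: (subspaceD sW).
    by apply: (subspaceZ _ sW); apply: wspan_wop.
  by apply: (subspaceN sW); exact: stepXs _ wD0 IHD.
by rewrite opDs_opXs; apply: (subspaceN sW); exact: stepXs _ wDs0 IHDs.
Qed.

Lemma orth_subspace u : subspace [set y | ip u y = 0].
Proof.
by split; rewrite /= ?ip0r // => a y z uy uz; rewrite ipDr ipZr uy uz mulr0 addr0.
Qed.

(** The first letter of the shorter word crosses the product as d or d^* and shortens the longer
    word, which keeps the inequality of lengths. Once the shorter word is empty, a letter of the
    other one crosses back and kills h. *)
Lemma wop_orth_le s k s' k' h h' w w' : hod s k h -> hod s' k' h' ->
  ip h h' = 0 -> (size w <= size w')%N -> ip (wop w h) (wop w' h') = 0.
Proof.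
move=> Hh Hh' hh'; elim: w w' => [|b w IHw] [|b' w'] //=.
  case: Hh => _ Dh Dsh _; case: b'; first by rewrite -ip_opDs Dsh ip0l.
  by rewrite -ip_opD Dh ip0l.
rewrite ltnS => sw; have [WD WDs] := wspan_opD (b' :: w') Hh'.
have orth y : wspan h' (size w') y -> ip (wop w h) y = 0.
  move=> Wy; apply: (Wy _ (orth_subspace (wop w h))) => w1 /= sw1.
  by apply: IHw; rewrite sw1.
by case: b; rewrite ?ip_opX ?ip_opXs; apply: orth.
Qed.

Lemma wop_orth s k s' k' h h' w w' : hod s k h -> hod s' k' h' ->
  ip h h' = 0 -> ip (wop w h) (wop w' h') = 0.
Proof.
move=> Hh Hh' hh'; case/orP: (leq_total (size w) (size w')) => sw.
  exact: (wop_orth_le Hh Hh').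
by apply: ip_sym0; apply: (wop_orth_le Hh' Hh) => //; apply: ip_sym0.
Qed.

Definition wHod s k w : set M := wop w @` hod s k.

Lemma wHod_subspace s k w : subspace (wHod s k w).
Proof.
have [H0 HP] := hod_subspace s k.
split; first by exists 0; rewrite ?wop0.
move=> a _ _ [u Hu <-] [v Hv <-]; exists (a *: u + v); first exact: HP.
exact: wop_is_linear.
Qed.

Definition comp sk : set M := sumspace Omega (wHod sk.1 sk.2).

Lemma comp_subspace sk : subspace (comp sk).
Proof. by apply: sumspace_subspace => w _; apply: wHod_subspace. Qed.

Lemma comp_orth sk sk' u v : sk != sk' -> comp sk u -> comp sk' v -> ip u v = 0.
Proof.
move=> neq cu cv; move: v cv; apply: sumspace_sub; first exact: orth_subspace.
move=> w' _ _ [h' Hh' <-] /=; apply: ip_sym0.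
move: u cu; apply: sumspace_sub; first exact: orth_subspace.
move=> w _ _ [h Hh <-] /=; apply: wop_orth (Hh') (Hh) _.
case: Hh Hh' => bh _ _ [bh' _ _]; apply: bihom_orth bh' bh _.
by rewrite eq_sym -!surjective_pairing.
Qed.

Lemma opX_cancel u : (0 < m)%N -> opX (opXs u) = 0 -> opXs u = 0.
Proof.
move=> m_gt0 Xu; apply: (sum_xm_inj m_gt0); apply: oppr_inj.
by rewrite -xop_xstar_q Xu opXs_opXs !linear0 addr0.
Qed.

Lemma opXs_cancel u : (0 < m)%N -> opXs (opX u) = 0 -> opX u = 0.
Proof.
move=> m_gt0 Xu; apply: (sum_xm_inj m_gt0); apply: oppr_inj.
by rewrite -xop_xstar_q Xu opX_opX !linear0 addr0.
Qed.

Lemma Omega_eq b w w' : Omega (b :: w) -> Omega (b :: w') ->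
  size w = size w' -> w = w'.
Proof.
rewrite /Omega /=; elim: w w' b => [|c w IHw] [|c' w'] b //= /andP[bc pw].
move=> /andP[bc' pw'] [sw]; have cc' : c = c' by case: b c c' bc bc' {pw pw'} => [] [] [].
by rewrite -cc' in pw' *; rewrite (IHw w' c).
Qed.

Lemma words_independent s k : (0 < m)%N -> independent Omega (wHod s k).
Proof.
move=> m_gt0 r u ur ru sum0 w wr.
(* A word of length n raises the degree by n, so the parts of different length in a relation are
   orthogonal and vanish separately. *)
pose Y n := \sum_(w <- r | size w == n) u w.
have Y0 n : Y n = 0.
  apply: ip_eq0; have -> : ip (Y n) (Y n) = ip (\sum_(w <- r) u w) (Y n).
    rewrite (bigID (fun w => size w == n)) /= ipDl [X in _ = _ + X](_ : _ = 0) ?addr0 //.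
    rewrite -big_filter ip_suml big_seq big1 // => w1; rewrite mem_filter
      => /andP[sw1 w1r].
    rewrite /Y -big_filter ip_sumr big_seq big1 // => w2; rewrite mem_filter
      => /andP[/eqP sw2 w2r].
    have [_ [h1 [bh1 _ _] <-]] := ru _ w1r; have [_ [h2 [bh2 _ _] <-]] := ru _ w2r.
    have [b1 e1] := wop_bieig w1 bh1; have [b2 e2] := wop_bieig w2 bh2.
    have [b1r|] := boolP (b1 \is Num.real); last first.
      have [->|nz] := eqVneq (wop w1 h1) 0; first by rewrite ip0l.
      by have [_ /ger0_real-> _] := bieig_ge0 e1 nz.
    apply: bieig_orth e1 e2 _ => //; first by rewrite -natrD realn.
    rewrite xpair_eqE negb_and -!natrD eqr_nat eqn_add2l sw2 sw1 //.
  by rewrite sum0 ip0l.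
have [Ow Hw] := ru _ wr; case: w => [|b w] in wr Ow Hw *.
  have := Y0 0%N; rewrite /Y -big_filter.
  have -> : [seq w <- r | size w == 0%N] = [:: [::]].
    apply: perm_small_eq => //; apply: uniq_perm; rewrite ?filter_uniq // => w1.
    by rewrite mem_filter inE size_eq0; case: eqP => // ->.
  by rewrite big_seq1.
(* [op] is the letter that w does not start with. All other alternating words of this length start
   with it and are killed, whereas it is injective on the image of the first letter of w. *)
pose op (v : M) := if b then opXs v else opX v.
have op_cancel v : (exists y, v = if b then opX y else opXs y) -> op v = 0 -> v = 0.
  by rewrite /op; case: b {wr Ow Hw op} => -[y ->]; [apply: opXs_cancel|apply: opX_cancel].
apply: op_cancel.
  by case: Hw => h _ <-; exists (wop w h); case: (b).
have : op (Y (size w).+1) = 0 by rewrite Y0 /op; case: (b); rewrite linear0.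
rewrite /Y -big_filter (bigD1_seq (b :: w)) ?filter_uniq //=; last first.
  by rewrite mem_filter /= eqxx wr.
have -> : forall v y : M, op (v + y) = op v + op y.
  by move=> v y; rewrite /op; case: (b); rewrite linearD.
suff -> : op (\sum_(i <- [seq w0 <- r | size w0 == (size w).+1] | i != b :: w) u i) = 0.
  by rewrite addr0.
have op_sub : subspace [set v | op v = 0].
  by rewrite /op; case: (b); split; rewrite /= ?linear0 // => a v y v0 y0;
    rewrite linearP /= v0 y0 scaler0 addr0.
rewrite -big_filter; apply: (subspace_sum op_sub) => w1.
rewrite !mem_filter => /and3P[ne /eqP sw1 w1r].
have [Ow1 [h1 _ <-]] := ru _ w1r.
case: w1 => [//|b1 w1] in ne sw1 w1r Ow1 *; case: sw1 => sw1.
have nb : b1 != b.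
  by apply: contraNneq ne => eb; rewrite eb in Ow1 *; rewrite (Omega_eq Ow1 Ow).
by rewrite /op /=; case: (b) (b1) nb => [] []; rewrite ?opX_opX ?opXs_opXs.
Qed.

End FockDecomposition.

(** * Orthogonal projections *)

Section FockProjection.
Variables (F : numClosedFieldType) (m : nat) (M : fock F m).
Implicit Types (i j : 'I_m) (u v h : M) (w : seq bool).
Local Notation xm := (@xm F m M).
Local Notation dm := (@dm F m M).
Local Notation ew := (@ew F m M).
Local Notation ec := (@ec F m M).
Local Notation vac := (@vac F m M).
Local Notation ip := (@ip F m M).

Fixpoint inspan (l : seq M) : set M :=
  if l is x :: l' then [set a *: x + y | a in setT & y in inspan l'] else [set 0].

Lemma inspan_subspace l : subspace (inspan l).
Proof.
elim: l => [|x l [IH0 IH]] /=.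
  by split=> // a u v -> ->; rewrite /= scaler0 addr0.
split; first by exists 0 => //; exists 0; rewrite ?scale0r ?addr0.
move=> c _ _ [a1 _ [y1 y1l <-]] [a2 _ [y2 y2l <-]].
exists (c * a1 + a2) => //; exists (c *: y1 + y2); first exact: IH.
by rewrite scalerDl scalerDr -scalerA addrACA.
Qed.

Lemma inspan_mem l x : x \in l -> inspan l x.
Proof.
elim: l => //= y l IH; rewrite inE => /orP[/eqP->|xl].
  by exists 1 => //; exists 0; rewrite ?scale1r ?addr0 //; case: (inspan_subspace l).
by exists 0 => //; exists x; rewrite ?scale0r ?add0r //; apply: IH.
Qed.

(** Gram-Schmidt, one spanning vector at a time: W meets the span of the tail in codimension at most
    one. *)
Lemma ip_projection l (W : set M) : subspace W -> W `<=` inspan l ->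
  forall v, exists2 u, W u & forall y, W y -> ip (v - u) y = 0.
Proof.
elim: l W => [|x l IH] W sW Wl v.
  exists 0; first by case: sW.
  by move=> y /Wl /= ->; rewrite ip0r.
have sW0 := subspaceI sW (inspan_subspace l).
have {}IH := IH _ sW0 (@subIsetr _ _ _).
have [Wsub|] := pselect (W `<=` inspan l).
  have [u [Wu _] uP] := IH v; exists u => // y Wy.
  by apply: uP; split=> //; apply: Wsub.
move=> /existsNP[b /not_implyP[Wb nb]].
(* After this correction W is the orthogonal sum of its intersection with [inspan l] and the line of
   b'. *)
have [b0 [Wb0 lb0] b0P] := IH b; pose b' := b - b0.
have Wb' : W b' by apply: subspaceD => //; apply: subspaceN.
have [be _ [yb yl eb]] := Wl _ Wb.
have be0 : be != 0.
  by apply: contra_notN nb => /eqP z; rewrite -eb z scale0r add0r.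
have Wdec y : W y -> exists c, (W `&` inspan l) (y - c *: b').
  move=> Wy; have [a _ [y0 y0l ey]] := Wl _ Wy.
  exists (a / be); split.
    by apply: subspaceD => //; apply: subspaceN => //; apply: subspaceZ.
  have -> : y - (a / be) *: b' = y0 - (a / be) *: yb + (a / be) *: b0.
    rewrite -ey /b' -eb scalerBr scalerDr scalerA divfK // opprB addrA.
    by rewrite opprD [a *: x + y0]addrC addrACA addrK [_ *: b0 - _]addrC addrA.
  have sl := inspan_subspace l.
  by apply: subspaceD => //; [apply: subspaceD => //; apply: subspaceN => //|]; apply: subspaceZ.
have [v0 [Wv0 _] v0P] := IH v.
pose v1 := v - v0; pose c := ip v1 b' / ip b' b'.
exists (v0 + c *: b') => [|y Wy].
  by apply: subspaceD => //; apply: subspaceZ.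
have [d Wd] := Wdec y Wy; rewrite opprD addrA -/v1.
rewrite -[y](subrK (d *: b')) ipDr ipBl ipZl v0P // [ip b' _]b0P // mulr0 subr0 add0r.
rewrite ipZr ipBl ipZl.
have nz : ip b' b' != 0.
  apply/eqP => /ip_eq0 /eqP; rewrite subr_eq0 => /eqP eb0.
  by apply: nb; rewrite eb0.
by rewrite /c divfK // subrr mulr0.
Qed.

End FockProjection.

(** * Intertwiners of irreducible modules *)

Section Modules.
Variables (K : fieldType) (V : lmodType K) (T : Type) (G : set T) (rho : T -> V -> V).
Implicit Types (U W : set V) (f : V -> V).

Definition intertwines U f :=
  (forall a u v, U u -> U v -> f (a *: u + v) = a *: f u + f v) /\
  (forall g u, G g -> U u -> f (rho g u) = rho g (f u)).

Lemma intertwines0 U f : subspace U -> intertwines U f -> f 0 = 0.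
Proof.
move=> [U0 _] [fl _]; have /eqP := fl 1 0 0 U0 U0.
by rewrite !scale1r addr0 -[X in X == _]addr0 (inj_eq (addrI _)) eq_sym => /eqP.
Qed.

Lemma intertwines_image U f :
  submodule G rho U -> intertwines U f -> submodule G rho (f @` U).
Proof.
move=> [sU Ug] fi; have f0 := intertwines0 sU fi; case: fi => fl fg.
case: (sU) => U0 UP; split; first split; first by exists 0.
  move=> a _ _ [u Uu <-] [v Uv <-]; exists (a *: u + v); first exact: UP.
  exact: fl.
move=> g _ Gg [u Uu <-]; exists (rho g u); first exact: Ug.
exact: fg.
Qed.

Lemma irreducible_image U f :
  (forall g, G g -> rho g 0 = 0) -> irreducible G rho U -> intertwines U f ->
  (exists2 u, U u & f u <> 0) -> equivalent G rho U (f @` U).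
Proof.
move=> rho0 [[sU Ug] _ Uirr] fi [u0 Uu0 fu0]; have f0 := intertwines0 sU fi.
have [fl fg] := fi; have [U0 UP] := sU.
pose N := [set u | U u /\ f u = 0].
have [| |N0|NU] := Uirr N.
- split; first split=> // a u v [Uu fu] [Uv fv].
    by split; [exact: UP|rewrite fl // fu fv scaler0 addr0].
  move=> g u Gg [Uu fu]; split; first exact: Ug.
  by rewrite fg // fu rho0.
- by move=> u [].
- exists f; split=> //; split; [by move=> u Uu; exists u| |by []].
  move=> u v; rewrite !inE => Uu Uv fuv.
  have H x : N x -> x = 0 by rewrite N0.
  apply/eqP; rewrite -subr_eq0; apply/eqP; apply: H; split.
    by apply: subspaceD => //; apply: subspaceN.
  by rewrite -scaleN1r addrC fl // fuv scaleN1r addNr.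
by case: fu0; have [] : N u0 by rewrite NU.
Qed.

Lemma schur U W f :
  (forall g, G g -> rho g 0 = 0) -> irreducible G rho U -> irreducible G rho W ->
  intertwines U f -> (forall u, U u -> W (f u)) ->
  ~ equivalent G rho U W -> forall u, U u -> f u = 0.
Proof.
move=> rho0 iU [_ _ iW] fi fUW neq u Uu; apply: contra_notP neq => fu0.
have [||f0|<-] := iW (f @` U).
- by apply: intertwines_image => //; case: iU.
- by move=> _ [v Uv <-]; apply: fUW.
- by case: fu0; have : (f @` U) (f u) by [exists u]; rewrite f0.
by apply: irreducible_image => //; exists u.
Qed.

Lemma equivalent_sym U W : submodule G rho U ->
  equivalent G rho U W -> equivalent G rho W U.
Proof.
move=> [[U0 UP] Ug] [f [[fW finj fsurj] fl fg]].
have /choice[h hP] : forall y, exists x, W y -> U x /\ f x = y.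
  move=> y; have [Wy|nWy] := pselect (W y); last by exists 0.
  by have [x Ux fx] := fsurj _ Wy; exists x.
have hf x : U x -> h (f x) = x.
  move=> Ux; have [Uh fh] := hP _ (fW _ Ux).
  by apply: finj; rewrite ?inE.
have fP y : W y -> exists2 x, U x & y = f x.
  by move=> Wy; have [x Ux <-] := fsurj _ Wy; exists x.
exists h; split.
- split.
  + by move=> y Wy; case: (hP _ Wy).
  + move=> y z; rewrite !inE => Wy Wz hyz.
    by have [_ <-] := hP _ Wy; have [_ <-] := hP _ Wz; rewrite hyz.
  by move=> x Ux; exists (f x); [exact: fW|exact: hf].
- move=> a _ _ /fP[u Uu ->] /fP[v Uv ->].
  by rewrite -fl // !hf //; apply: UP.
by move=> g _ Gg /fP[u Uu ->]; rewrite -fg // !hf //; apply: Ug.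
Qed.

End Modules.

(** * Decomposition of a Fock representation *)

Section FockTheorem.
Variables (F : numClosedFieldType) (m : nat) (M : fock F m).
Hypothesis m_gt0 : (0 < m)%N.
Hypothesis fin : forall s k, exists l : seq M, forall u, bihom s k u -> inspan l u.
Implicit Types (i j : 'I_m) (u v h : M) (w : seq bool) (sk : nat * nat).
Local Notation xm := (@xm F m M).
Local Notation dm := (@dm F m M).
Local Notation ew := (@ew F m M).
Local Notation ec := (@ec F m M).
Local Notation vac := (@vac F m M).
Local Notation ip := (@ip F m M).
Local Notation lact := (@lact F m M).
Local Notation hod := (@hod F m M).
Local Notation comp := (@comp F m M).
Local Notation wHod := (@wHod F m M).

Lemma bihom_projection s k (W : set M) : subspace W -> W `<=` bihom s k ->
  forall v, exists2 u, W u & forall y, W y -> ip (v - u) y = 0.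
Proof.
move=> sW Wb; have [l lP] := fin s k; apply: (@ip_projection _ _ _ l) => //.
by move=> u /Wb; apply: lP.
Qed.

(** Projection of u onto im x + im x^*, with the arguments of x and x^* kept in the two bidegrees
    that land in (s, k), so that the target space is finite-dimensional. *)
Lemma decomposition_step s k u : bihom s k u -> exists h a b,
  [/\ hod s k h, bieig (k%:R - 1) (s%:R - 1) a, bieig (k%:R - 1) (s%:R + 1) b
    & u = h + (opX a + opXs b)].
Proof.
move=> bu.
pose W : set M := [set y | exists a b, [/\ bieig (k%:R - 1) (s%:R - 1) a,
  bieig (k%:R - 1) (s%:R + 1) b & y = opX a + opXs b]].
have sW : subspace W.
  split; first by exists 0, 0; split; rewrite ?linear0 ?addr0 //;
    case: (@bieig_subspace _ _ M (k%:R - 1) (s%:R - 1));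
    case: (@bieig_subspace _ _ M (k%:R - 1) (s%:R + 1)).
  move=> c _ _ [a1 [b1 [ea1 eb1 ->]]] [a2 [b2 [ea2 eb2 ->]]].
  exists (c *: a1 + a2), (c *: b1 + b2); split.
  - by case: (@bieig_subspace _ _ M (k%:R - 1) (s%:R - 1)) => _; apply.
  - by case: (@bieig_subspace _ _ M (k%:R - 1) (s%:R + 1)) => _; apply.
  by rewrite !linearP /= scalerDr addrACA.
have Wb : W `<=` bihom s k.
  move=> _ [a [b [ea eb ->]]]; apply: subspaceD; first exact: bieig_subspace.
    by have := bieig_opX ea; rewrite !subrK.
  by have := bieig_opXs eb; rewrite subrK addrK.
have [y Wy yP] := bihom_projection sW Wb u.
have bh : bihom s k (u - y).
  apply: subspaceD => //; first exact: bieig_subspace.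
  by apply: subspaceN; [exact: bieig_subspace|exact: Wb].
case: (Wy) => a [b [ea eb ey]]; exists (u - y), a, b; split => //; last first.
  by rewrite -ey subrK.
have z1 : bieig (k%:R - 1) (s%:R - 1) (0 : M).
  by case: (@bieig_subspace _ _ M (k%:R - 1) (s%:R - 1)).
have z2 : bieig (k%:R - 1) (s%:R + 1) (0 : M).
  by case: (@bieig_subspace _ _ M (k%:R - 1) (s%:R + 1)).
(* The remainder u - y is orthogonal to x^* d (u - y) and to x d^* (u - y); moving x^* and x across
   gives the squared norms of d (u - y) and d^* (u - y). *)
split=> //; apply: ip_eq0; rewrite ?ip_opD ?ip_opDs; apply: yP.
  exists 0, (opD (u - y)); split; rewrite // ?linear0 ?add0r //.
  exact: bieig_opD.
exists (opDs (u - y)), 0; split; rewrite // ?linear0 ?addr0 //.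
exact: bieig_opDs.
Qed.

Lemma bieig_neg a b u : (a = -1) \/ (b = -1) -> bieig a b u -> u = 0.
Proof.
move=> ab bu; apply/eqP; apply: contraT => u0.
have [a0 b0 _] := bieig_ge0 bu u0.
by case: ab => e; [move: a0|move: b0]; rewrite e oppr_ge0 ler10.
Qed.

Lemma total_bihom (S : set M) : subspace S ->
  (forall u, S u -> S (opX u)) -> (forall u, S u -> S (opXs u)) ->
  (forall s k h, hod s k h -> S h) -> forall s k u, bihom s k u -> S u.
Proof.
move=> sS SX SXs SH s k; elim: k s => [|k IHk] s u bu;
  have [h [a [b [Hh ea eb ->]]]] := decomposition_step bu.
  (* In degree 0 the arguments of x and x^* have degree -1 and vanish. *)
  rewrite sub0r in ea eb.
  rewrite (bieig_neg _ ea) ?(bieig_neg _ eb); try by left.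
  by rewrite !linear0 !addr0; apply: SH Hh.
rewrite -natr1 addrK in ea eb.
apply: (subspaceD sS); first exact: SH Hh.
apply: (subspaceD sS); last by apply/SXs/(IHk s.+1); rewrite /bihom -natr1.
apply: SX; case: s => [|s] in bu Hh ea eb *.
  rewrite sub0r in ea; rewrite (bieig_neg _ ea); last by right.
  by case: sS.
by apply: (IHk s); rewrite -natr1 addrK in ea.
Qed.

Lemma subspace_total (S : set M) : subspace S ->
  (forall u, S u -> S (opX u)) -> (forall u, S u -> S (opXs u)) ->
  (forall s k h, hod s k h -> S h) -> forall u, S u.
Proof.
move=> sS SX SXs SH u.
have bS := total_bihom sS SX SXs SH.
(* A form is never split into bihomogeneous parts. Quantifying over all subspaces U lets the
   induction from the vacuum pass to the preimage of U under a creation operator. *)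
suff : forall U : set M, subspace U -> (forall s k v, bihom s k v -> U v) -> U u.
  by apply.
elim/(@fock_ind _ _ M): u => [|a u v IHu IHv|j u IHu|j u IHu] U sU bU.
- by apply: (bU 0%N 0%N); apply: bieig_vac.
- by case: (sU) => _; apply; [apply: IHu|apply: IHv].
- apply: (IHu (xm j @^-1` U)); first exact: preim_subspace.
  by move=> s k v /(bieig_xm j) bv; apply: (bU s k.+1); rewrite /bihom -natr1.
apply: (IHu (ew j @^-1` U)); first exact: preim_subspace.
by move=> s k v /(bieig_ew j) bv; apply: (bU s.+1 k); rewrite /bihom -natr1.
Qed.

(** For s = m the form x h vanishes by its degree, so d^* x h = (m + k - s) h gives k h = 0. For s =
    0 the same happens with x^* h and d x^* h = (k + s) h. *)
Lemma hod_indices s k h : hod s k h -> h <> 0 -> indices m (s, k).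
Proof.
move=> Hh /eqP h0; have [bh Dh Dsh] := Hh.
have [_ _] := bieig_ge0 bh h0; rewrite ler_nat leq_eqVlt => /orP[/eqP sm|sm].
  have := opDs_opX_eig bh; rewrite Dsh (linear0 (@opX F m M)) subr0 sm addrAC subrr add0r.
  have -> : opX h = 0.
    apply/eqP; apply: contraT => Xh0.
    have [_ _] := bieig_ge0 (bieig_opX bh) Xh0.
    by rewrite natr1 ler_nat sm ltnn.
  rewrite linear0 => /esym/eqP; rewrite scaler_eq0 (negbTE h0) orbF pnatr_eq0 => /eqP->.
  by apply: Or32.
case: (posnP s) => [s0|s_gt0]; last by apply: Or33; rewrite /= s_gt0.
have := opD_opXs_eig bh; rewrite Dh (linear0 (@opXs F m M)) subr0 s0 addr0.
have -> : opXs h = 0.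
  have := bieig_opXs bh; rewrite s0 sub0r; apply: bieig_neg; by right.
rewrite linear0 => /esym/eqP; rewrite scaler_eq0 (negbTE h0) orbF pnatr_eq0 => /eqP->.
by apply: Or31.
Qed.

(** A new first letter x either keeps the word alternating or meets another x and gives 0. *)
Lemma comp_opX sk u : comp sk u -> comp sk (opX u).
Proof.
move: u; have sc := comp_subspace M sk.
apply: (@sumspace_sub _ _ _ _ _ (@opX F m M @^-1` comp sk)); first exact: preim_subspace.
move=> w Ow _ [h Hh <-]; rewrite /preimage /=.
case: w => [|[] w] in Ow *; last 1 first.
- by apply: (@sumspace_mem _ _ _ _ _ [:: true, false & w]) => //; exists h.
- by apply: (@sumspace_mem _ _ _ _ _ [:: true]) => //; exists h.
by rewrite /= opX_opX; case: sc.
Qed.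

Lemma comp_opXs sk u : comp sk u -> comp sk (opXs u).
Proof.
move: u; have sc := comp_subspace M sk.
apply: (@sumspace_sub _ _ _ _ _ (@opXs F m M @^-1` comp sk)); first exact: preim_subspace.
move=> w Ow _ [h Hh <-]; rewrite /preimage /=.
case: w => [|[] w] in Ow *.
- by apply: (@sumspace_mem _ _ _ _ _ [:: false]) => //; exists h.
- by apply: (@sumspace_mem _ _ _ _ _ [:: false, true & w]) => //; exists h.
by rewrite /= opXs_opXs; case: sc.
Qed.

Lemma sumspace_linear (f : {linear M -> M}) (I : eqType) (D : set I) (U : I -> set M) :
  (forall x u, D x -> U x u -> U x (f u)) -> (forall x, D x -> subspace (U x)) ->
  forall u, sumspace D U u -> sumspace D U (f u).
Proof.
move=> fU sU; apply: (@sumspace_sub _ _ _ _ _ (f @^-1` sumspace D U)).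
  by apply: preim_subspace; apply: sumspace_subspace.
by move=> x Dx u Uu; apply: (sumspace_mem Dx); apply: fU.
Qed.

Lemma direct_sum_comp : is_direct_sum (indices m) comp setT.
Proof.
split.
- by move=> sk _; apply: comp_subspace.
- move=> r u ur ru sum0 sk skr; apply: ip_eq0.
  transitivity (ip (u sk) (\sum_(i <- r) u i)); last by rewrite sum0 ip0r.
  rewrite (bigD1_seq sk) //= ipDr [X in _ = _ + X](_ : _ = 0) ?addr0 //.
  rewrite -big_filter ip_sumr big_seq big1 // => sk'.
  rewrite mem_filter => /andP[ne skr'].
  have [_ cu] := ru _ skr; have [_ cu'] := ru _ skr'.
  by apply: (comp_orth _ cu cu'); rewrite eq_sym.
apply/seteqP; split=> // u _; apply: subspace_total u.
- by apply: sumspace_subspace => sk _; apply: comp_subspace.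
- apply: sumspace_linear => [sk u _|sk _]; [exact: comp_opX|exact: comp_subspace].
- apply: sumspace_linear => [sk u _|sk _]; [exact: comp_opXs|exact: comp_subspace].
move=> s k h Hh; have [->|/eqP h0] := eqVneq h 0.
  by have [] := @sumspace_subspace _ _ _ (indices m) comp (fun sk _ => comp_subspace M sk).
apply: (sumspace_mem (hod_indices Hh h0)).
by apply: (@sumspace_mem _ _ _ _ _ [::]) => //; exists h.
Qed.

Lemma direct_sum_words sk : is_direct_sum Omega (wHod sk.1 sk.2) (comp sk).
Proof.
split=> //; first by move=> w _; apply: wHod_subspace.
exact: words_independent.
Qed.

Section Action.
Variables (T : Type) (G : set T) (rho : T -> M -> M) (toM : T -> 'M[F]_m).
Hypothesis rhoE : forall g, G g -> forall u, rho g u = lact (toM g) u.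
Hypothesis toM_orth : forall g, G g -> toM g *m (toM g)^T = 1%:M.
Hypothesis G_adj : forall g, G g -> exists2 g', G g' & toM g' = adjm (toM g).

Lemma rho0 g : G g -> rho g 0 = 0.
Proof. by move=> Gg; rewrite rhoE // linear0. Qed.

Lemma toM_unit g : G g -> toM g \in unitmx.
Proof. by move=> /toM_orth/mulmx1_unit[]. Qed.

Lemma hod_lact g s k h : G g -> hod s k h -> hod s k (lact (toM g) h).
Proof.
move=> Gg [[Eh Nh] Dh Dsh]; split; first split.
- by rewrite lact_eul Eh linearZ.
- by rewrite lact_num Nh linearZ.
- by rewrite lact_opD ?toM_unit // Dh linear0.
by rewrite lact_opDs ?toM_orth // Dsh linear0.
Qed.

Lemma hod_submodule s k : submodule G rho (hod s k).
Proof.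
split; first exact: hod_subspace.
by move=> g h Gg Hh; rewrite rhoE //; apply: hod_lact.
Qed.

Lemma wop_lact g w u : G g -> wop w (lact (toM g) u) = lact (toM g) (wop w u).
Proof.
move=> Gg; elim: w => //= c w ->.
by case: c; rewrite ?lact_opX ?lact_opXs ?toM_orth.
Qed.

Lemma wop_intertwines (U : set M) w : submodule G rho U -> intertwines G rho U (wop w).
Proof.
move=> [_ Ug]; split; first by move=> a u v _ _; apply: wop_is_linear.
by move=> g u Gg Uu; rewrite !rhoE // wop_lact.
Qed.

Lemma wHod_submodule s k w : submodule G rho (wHod s k w).
Proof.
apply: intertwines_image; first exact: hod_submodule.
by apply: wop_intertwines; apply: hod_submodule.
Qed.

(** The adjoint of [wop w]: the letters are applied in the opposite order, with x replaced by d^*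
    and x^* by d. *)
Fixpoint wdag w u : M :=
  if w is c :: w' then wdag w' (if c then opDs u else opD u) else u.

Lemma ip_wop w u v : ip (wop w u) v = ip u (wdag w v).
Proof.
elim: w u v => //= c w IHw u v.
by case: c; rewrite ?ip_opX ?ip_opXs IHw.
Qed.

Lemma wdag_is_linear w : linear (wdag w).
Proof.
by elim: w => //= c w IHw a u v; case: c; rewrite linearP IHw.
Qed.

Lemma wdag_lact g w u : G g -> wdag w (lact (toM g) u) = lact (toM g) (wdag w u).
Proof.
move=> Gg; elim: w u => //= c w IHw u.
by case: c; rewrite ?lact_opDs ?lact_opD ?toM_orth ?toM_unit.
Qed.

Hypothesis irr : forall sk, indices m sk -> irreducible G rho (hod sk.1 sk.2).
Hypothesis ineq : forall sk sk', indices m sk -> indices m sk' -> sk <> sk' ->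
  ~ equivalent G rho (hod sk.1 sk.2) (hod sk'.1 sk'.2).

(** Apply f, then the adjoint of the word, then the orthogonal projection onto the second Hodge
    space. All three commute with the group, so the composite is an intertwiner of inequivalent
    irreducible modules and vanishes by Schur's lemma. *)
Lemma intertwiner_orth sk sk' f w h h' : indices m sk -> indices m sk' -> sk <> sk' ->
  intertwines G rho (hod sk.1 sk.2) f ->
  hod sk.1 sk.2 h -> hod sk'.1 sk'.2 h' -> ip (f h) (wop w h') = 0.
Proof.
move=> isk isk' neq [fl fg] Hh Hh'; apply: ip_sym0; rewrite ip_wop; apply: ip_sym0.
have sH' := hod_subspace M sk'.1 sk'.2.
have /choice[t tP] : forall v, exists u, hod sk'.1 sk'.2 u /\
    forall y, hod sk'.1 sk'.2 y -> ip (wdag w (f v) - u) y = 0.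
  move=> v; have [||u Hu uP] := @bihom_projection sk'.1 sk'.2 (hod sk'.1 sk'.2) _ _ (wdag w (f v)) => //.
    by move=> u [].
  by exists u.
(* Uniqueness of the projection makes the chosen map [t] linear and equivariant. *)
have t_uniq v u : hod sk'.1 sk'.2 u ->
    (forall y, hod sk'.1 sk'.2 y -> ip (wdag w (f v) - u) y = 0) -> t v = u.
  move=> Hu uP; have [Ht tvP] := tP v; apply/eqP; rewrite -subr_eq0; apply/eqP.
  have Htu : hod sk'.1 sk'.2 (t v - u) by apply: subspaceD => //; apply: subspaceN.
  apply: ip_eq0; rewrite -[X in ip X _](_ : wdag w (f v) - u - (wdag w (f v) - t v) = _).
    by rewrite ipBl uP // tvP // subr0.
  by rewrite opprB addrC addrA subrK.
have ti : intertwines G rho (hod sk.1 sk.2) t.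
  split=> [a u v Hu Hv|g u Gg Hu]; apply: t_uniq.
  - by case: sH' => _ HP; apply: HP; [case: (tP u)|case: (tP v)].
  - move=> y Hy; have [_ tu] := tP u; have [_ tv] := tP v.
    rewrite fl // wdag_is_linear opprD addrACA -scalerBr ipDl ipZl.
    by rewrite tu // tv // mulr0 addr0.
  - rewrite rhoE //; apply: hod_lact => //; by case: (tP u).
  move=> y Hy; rewrite fg // !rhoE // wdag_lact // -linearB ip_lact.
  have [g' Gg' <-] := G_adj Gg.
  by have [_] := tP u; apply; apply: hod_lact.
have t0 := schur rho0 (irr isk) (irr isk') ti (fun u _ => (tP u).1) (ineq isk isk' neq).
by have [_ /(_ _ Hh')] := tP h; rewrite t0 // subr0.
Qed.

(** A word is an intertwiner, so a nonzero image of an irreducible Hodge space is a copy of it.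
    Conversely a copy of type [sk] is orthogonal to every other component, hence lies in its own. *)
Lemma isotypic_comp sk : indices m sk -> comp sk = isotypic G rho (hod sk.1 sk.2).
Proof.
move=> isk; have [sumI sumO sumT] := direct_sum_comp.
apply/seteqP; split; apply: sumspace_sub.
- by apply: sumspace_subspace => U [[]].
- move=> w Ow u wu; have [->|/eqP u0] := eqVneq u 0.
    by have [] := @sumspace_subspace _ _ _ [set U | submodule G rho U /\
      equivalent G rho U (hod sk.1 sk.2)] id (fun U HU => HU.1.1).
  apply: (@sumspace_mem _ _ _ _ _ (wHod sk.1 sk.2 w)) => //; split.
    exact: wHod_submodule.
  apply: equivalent_sym; first exact: hod_submodule.
  apply: irreducible_image => //; first exact: rho0.
  - exact: irr.
  - by apply: wop_intertwines; apply: hod_submodule.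
  by case: wu => h Hh hu; exists h => //; rewrite hu.
- exact: comp_subspace.
move=> U [sU eU] y Uy.
have [f [[fU finj fsurj] fl fg]] := equivalent_sym sU eU.
have [h Hh hy] := fsurj _ Uy; rewrite -hy in Uy *.
have fi : intertwines G rho (hod sk.1 sk.2) f by split.
have : [set: M] (f h) by [].
rewrite sumT => -[r [u [ur ru fE]]].
(* By orthogonality of the components, pairing f h with its part u sk' gives the squared norm of
   that part. *)
have u0 sk' : sk' \in r -> sk' != sk -> u sk' = 0.
  move=> rsk' ne; have [isk' cu] := ru _ rsk'; apply: ip_eq0.
  transitivity (ip (f h) (u sk')).
    rewrite fE (bigD1_seq sk') //= ipDl [X in _ = _ + X](_ : _ = 0) ?addr0 //.
    rewrite -big_filter ip_suml big_seq big1 // => sk1.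
    rewrite mem_filter => /andP[ne1 r1]; have [_ cu1] := ru _ r1.
    exact: comp_orth cu1 cu.
  move: cu; apply: (@sumspace_sub _ _ _ _ _ [set y | ip (f h) y = 0]).
    exact: orth_subspace.
  move=> w _ _ [h' Hh' <-] /=; apply: intertwiner_orth Hh Hh' => //.
  by apply/eqP; rewrite eq_sym.
rewrite fE; apply: subspace_sum; first exact: comp_subspace.
move=> sk' rsk'; have [<-|ne] := eqVneq sk' sk; first by case: (ru _ rsk').
by rewrite u0 //; case: (comp_subspace M sk).
Qed.

End Action.
End FockTheorem.

Local Close Scope classical_set_scope.

(** * Polynomial differential forms as a Fock representation *)

Section FischerPoly.
Variables (F : numClosedFieldType) (n : nat).
Implicit Types (p q r : {mpoly F[n]}) (a b : 'X_{1..n}).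

Definition mfact a := (\prod_(i < n) (a i)`!)%N.

(** The Fischer product: monomials are orthogonal, with squared norm the product of the factorials
    of the exponents. *)
Definition mdot p q := \sum_(a <- msupp p) p@_a * ((q@_a)^* * (mfact a)%:R).

Lemma mdotw k p q : (msize p <= k)%N ->
  mdot p q = \sum_(a : 'X_{1..n < k}) p@_a * ((q@_a)^* * (mfact a)%:R).
Proof.
move=> lt_pk; pose I : subFinType _ := 'X_{1..n < k}.
rewrite /mdot (ssrcomplements.big_mksub I) /=; first last.
- by move=> x /msize_mdeg_lt /leq_trans; apply.
- by rewrite msupp_uniq.
by rewrite big_rmcond //= => i; move/memN_msupp_eq0 ->; rewrite mul0r.
Qed.

Lemma mdot_linear c p q r : mdot (c *: p + q) r = c * mdot p r + mdot q r.
Proof.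
pose k := maxn (msize (c *: p + q)) (maxn (msize p) (msize q)).
rewrite !(@mdotw k) ?leq_max ?leqnn ?orbT // mulr_sumr -big_split /=.
by apply: eq_bigr => a _; rewrite mcoeffD mcoeffZ mulrDl -mulrA.
Qed.

Lemma mdotZ c p r : mdot (c *: p) r = c * mdot p r.
Proof. by rewrite -[c *: p]addr0 mdot_linear /mdot msupp0 big_nil addr0. Qed.

Lemma mdot_sum I (s : seq I) (G : I -> {mpoly F[n]}) r :
  mdot (\sum_(i <- s) G i) r = \sum_(i <- s) mdot (G i) r.
Proof.
apply: (big_morph (mdot^~ r)) => [p q|]; last by rewrite /mdot msupp0 big_nil.
by rewrite -[p]scale1r mdot_linear mul1r scale1r.
Qed.

Lemma mdot_conj p q : mdot q p = (mdot p q)^*.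
Proof.
pose k := maxn (msize p) (msize q).
rewrite !(@mdotw k) ?leq_max ?leqnn ?orbT // rmorph_sum.
by apply: eq_bigr => a _; rewrite !rmorphM /= conjCK conjC_nat mulrCA.
Qed.

Lemma mdot_ge0 p : 0 <= mdot p p.
Proof.
by apply: sumr_ge0 => a _; rewrite mulrA mulr_ge0 ?mul_conjC_ge0 ?ler0n.
Qed.

Lemma mdot_eq0 p : mdot p p = 0 -> p = 0.
Proof.
move=> /eqP; rewrite psumr_eq0 => [/allP h|a _]; last first.
  by rewrite mulrA mulr_ge0 ?mul_conjC_ge0 ?ler0n.
apply/mpolyP=> a; rewrite mcoeff0; apply/eqP; apply: contraT => pa.
have := h a; rewrite mcoeff_msupp pa => /(_ isT).
rewrite mulrA mulf_eq0 mul_conjC_eq0 (negbTE pa) /= pnatr_eq0 -leqn0 leqNgt.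
by rewrite prodn_gt0 // => i; rewrite fact_gt0.
Qed.

Lemma mdotX a q : mdot 'X_[a] q = (q@_a)^* * (mfact a)%:R.
Proof. by rewrite /mdot msuppX big_seq1 mcoeffX eqxx mul1r. Qed.

(** On monomials this is (a + e_j)! = (a_j + 1) a!, the factor being the one produced by
    differentiation. *)
Lemma mdot_mulX j p q : mdot ('X_j * p) q = mdot p (mderiv j q).
Proof.
rewrite [p]mpolyE mulr_sumr !mdot_sum; apply: eq_bigr => a _.
rewrite -scalerAr !mdotZ -mpolyXD !mdotX mcoeff_deriv; congr (_ * _).
rewrite rmorphMn /= mulrnAl -mulrnAr -mulrnA addmC; congr (_ * _%:R).
rewrite /mfact (bigD1 j) //= [in RHS](bigD1 j) //= mnmDE mnm1E eqxx addn1 factS.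
rewrite [RHS]mulnC mulnA; congr (_ * _)%N; apply: eq_bigr => i /negbTE nij.
by rewrite mnmDE mnm1E eq_sym nij addn0.
Qed.

End FischerPoly.

(** * Creation and annihilation operators on polynomial forms *)

Section PolyForms.
Variables (F : numClosedFieldType) (m : nat).
Local Notation poly := {mpoly F[m]}.
Local Notation gform := {ffun {set 'I_m} -> poly}.
Implicit Types (i j : 'I_m) (I K : {set 'I_m}) (P Q : gform) (p q : poly).
Implicit Types (A : 'M[F]_m).

Definition gpm p P : gform := [ffun K => p * P K].
Definition gxm j P : gform := gpm 'X_j P.
Definition gdm j P : gform := [ffun K => mderiv j (P K)].
Definition gew j P : gform := ewedge j P.
Definition gec j P : gform := econtr j P.
Definition gdx I : gform := [ffun K => (K == I)%:R].
Definition gip P Q := \sum_(K : {set 'I_m}) mdot (P K) (Q K).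

Lemma gpmE p P K : gpm p P K = p * P K. Proof. exact: ffunE. Qed.
Lemma gxmE j P K : gxm j P K = 'X_j * P K. Proof. exact: ffunE. Qed.
Lemma gdmE j P K : gdm j P K = mderiv j (P K). Proof. exact: ffunE. Qed.
Lemma gdxE I K : gdx I K = (K == I)%:R. Proof. exact: ffunE. Qed.
Lemma gewE j P K :
  gew j P K = if j \in K then (-1) ^+ pos j K *: P (K :\ j) else 0.
Proof. exact: ffunE. Qed.
Lemma gecE j P K :
  gec j P K = if j \in K then 0 else (-1) ^+ pos j K *: P (j |: K).
Proof. exact: ffunE. Qed.

Fact gpm_is_linear p : linear (gpm p).
Proof.
by move=> a P Q; apply/ffunP=> K; rewrite !form_coefE !gpmE !form_coefE mulrDr scalerAr.
Qed.
HB.instance Definition _ p :=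
  GRing.isLinear.Build F gform gform *:%R (gpm p) (gpm_is_linear p).

Fact gxm_is_linear j : linear (gxm j). Proof. exact: gpm_is_linear. Qed.
HB.instance Definition _ j :=
  GRing.isLinear.Build F gform gform *:%R (gxm j) (gxm_is_linear j).

Fact gdm_is_linear j : linear (gdm j).
Proof.
by move=> a P Q; apply/ffunP=> K; rewrite !form_coefE !gdmE !form_coefE linearP.
Qed.
HB.instance Definition _ j :=
  GRing.isLinear.Build F gform gform *:%R (gdm j) (gdm_is_linear j).

Fact gew_is_linear j : linear (gew j). Proof. exact: ewedge_is_linear. Qed.
HB.instance Definition _ j :=
  GRing.isLinear.Build F gform gform *:%R (gew j) (gew_is_linear j).

Fact gec_is_linear j : linear (gec j). Proof. exact: econtr_is_linear. Qed.
HB.instance Definition _ j :=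
  GRing.isLinear.Build F gform gform *:%R (gec j) (gec_is_linear j).

Lemma gew_gew i j P : gew i (gew j P) = - gew j (gew i P).
Proof. exact: ewedge_ewedge. Qed.

Lemma gec_gec i j P : gec i (gec j P) = - gec j (gec i P).
Proof. exact: econtr_econtr. Qed.

Lemma gec_gew i j P : gec i (gew j P) = (i == j)%:R *: P - gew j (gec i P).
Proof. exact: econtr_ewedge. Qed.

Lemma gpmA p q P : gpm p (gpm q P) = gpm (p * q) P.
Proof. by apply/ffunP=> K; rewrite !gpmE mulrA. Qed.

Lemma gpmDl p q P : gpm (p + q) P = gpm p P + gpm q P.
Proof. by apply/ffunP=> K; rewrite form_coefE !gpmE mulrDl. Qed.

Lemma gpmZl c p P : gpm (c *: p) P = c *: gpm p P.
Proof. by apply/ffunP=> K; rewrite form_coefE !gpmE scalerAl. Qed.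

Lemma gpm0l P : gpm 0 P = 0.
Proof. by apply/ffunP=> K; rewrite form_coefE gpmE mul0r. Qed.

Lemma gpm1l P : gpm 1 P = P.
Proof. by apply/ffunP=> K; rewrite gpmE mul1r. Qed.

Lemma gpm_suml (T : Type) (r : seq T) (G : T -> poly) P :
  gpm (\sum_(i <- r) G i) P = \sum_(i <- r) gpm (G i) P.
Proof. by apply: (big_morph (gpm^~ P)) => [p q|]; rewrite ?gpmDl ?gpm0l. Qed.

Lemma gxm_gxm i j P : gxm i (gxm j P) = gxm j (gxm i P).
Proof. by rewrite /gxm !gpmA mulrC. Qed.

Lemma gdm_gdm i j P : gdm i (gdm j P) = gdm j (gdm i P).
Proof. by apply/ffunP=> K; rewrite !gdmE mderiv_comm. Qed.

Lemma mderivU i j : mderiv i 'X_j = (i == j)%:R :> poly.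
Proof.
rewrite mderivX mnm1E eq_sym; case: eqVneq => [->|_]; rewrite ?scale0r //.
by rewrite scale1r -[X in (X - _)%MM]add0m addmK mpolyX0.
Qed.

Lemma gdm_gxm i j P : gdm i (gxm j P) = (i == j)%:R *: P + gxm j (gdm i P).
Proof.
apply/ffunP=> K; rewrite !form_coefE gdmE !gxmE gdmE mderivM mderivU.
by case: eqVneq => _; rewrite ?scale1r ?mul1r ?scale0r ?mul0r.
Qed.

Lemma gew_gpm i p P : gew i (gpm p P) = gpm p (gew i P).
Proof.
by apply/ffunP=> K; rewrite gpmE !gewE gpmE; case: ifP => _; rewrite ?mulr0 ?scalerAr.
Qed.

Lemma gec_gpm i p P : gec i (gpm p P) = gpm p (gec i P).
Proof.
by apply/ffunP=> K; rewrite gpmE !gecE gpmE; case: ifP => _; rewrite ?mulr0 ?scalerAr.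
Qed.

Lemma gew_gdm i j P : gew i (gdm j P) = gdm j (gew i P).
Proof.
by apply/ffunP=> K; rewrite gdmE !gewE gdmE; case: ifP => _; rewrite ?linear0 ?linearZ.
Qed.

Lemma gec_gdm i j P : gec i (gdm j P) = gdm j (gec i P).
Proof.
by apply/ffunP=> K; rewrite gdmE !gecE gdmE; case: ifP => _; rewrite ?linear0 ?linearZ.
Qed.

Lemma gdm_vac j : gdm j (gdx finset.set0) = 0.
Proof.
apply/ffunP=> K; rewrite form_coefE gdmE gdxE.
by case: eqP => _; rewrite ?mderivC ?mderiv0.
Qed.

Lemma gec_vac j : gec j (gdx finset.set0) = 0.
Proof.
apply/ffunP=> K; rewrite form_coefE gecE gdxE; case: ifP => // _.
case: eqP => [/setP/(_ j)|_]; last by rewrite scaler0.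
by rewrite !inE eqxx.
Qed.

Lemma gform_sum P : P = \sum_I gpm (P I) (gdx I).
Proof.
apply/ffunP=> K; rewrite sum_ffunE (bigD1 K) //= big1 ?addr0 => [|I /negbTE neI].
  by rewrite gpmE gdxE eqxx mulr1.
by rewrite gpmE gdxE eq_sym neI mulr0.
Qed.

Lemma gdx_gew j I : j \in I -> gdx I = (-1) ^+ pos j I *: gew j (gdx (I :\ j)).
Proof.
move=> jI; apply/ffunP=> K; rewrite form_coefE gewE !gdxE.
case: ifPn => jK; last first.
  by rewrite scaler0; case: eqP => // eK; rewrite eK jI in jK.
rewrite scalerA -exprD; have -> : (K :\ j == I :\ j) = (K == I).
  apply/eqP/eqP => [eK|->//].
  by rewrite -(finset.setD1K jK) eK finset.setD1K.
by case: eqP => [->|_]; rewrite ?scaler0 // addnn -signr_odd odd_double scale1r.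
Qed.

Lemma gform_ind (S : gform -> Prop) : S (gdx finset.set0) ->
  (forall a P Q, S P -> S Q -> S (a *: P + Q)) ->
  (forall j P, S P -> S (gxm j P)) -> (forall j P, S P -> S (gew j P)) ->
  forall P, S P.
Proof.
move=> S1 SP Sx Sw.
have S0 : S 0 by rewrite -(addNr (gdx finset.set0)) -scaleN1r; apply: SP.
have Spm p P : S P -> S (gpm p P).
  elim/mpolyind: p P => [|c a p _ _ IHp] P SPP; first by rewrite gpm0l.
  rewrite gpmDl gpmZl; apply: SP; last exact: IHp.
  rewrite mpolyXE_id; move: P SPP.
  apply: (big_ind (fun p => forall P, S P -> S (gpm p P))) => [P|p1 p2 IH1 IH2 P SPP|i _].
  - by rewrite gpm1l.
  - by rewrite -gpmA; apply/IH1/IH2.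
  elim: (a i) => [|k IHk] P SPP; first by rewrite expr0 gpm1l.
  by rewrite exprS -gpmA; apply/Sx/IHk.
have Sdx I : S (gdx I).
  have [k] := ubnP #|I|; elim: k I => // k IHk I.
  have [->//|[j jI]] := set_0Vmem I; rewrite (cardsD1 j) jI ltnS => Ik.
  rewrite (gdx_gew jI) -[_ *: _]addr0; apply: SP => //.
  by apply/Sw/IHk.
move=> P; rewrite (gform_sum P); apply: (big_ind S) => // [Q1 Q2 S1' S2'|I _].
  by rewrite -[Q1]scale1r; apply: SP.
exact: Spm.
Qed.

Lemma gsum_xm_inj : (0 < m)%N -> forall P, \sum_j gxm j (gxm j P) = 0 -> P = 0.
Proof.
move=> m_gt0 P /ffunP qP0; apply/ffunP=> K; rewrite form_coefE.
have := qP0 K; rewrite sum_ffunE form_coefE.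
under eq_bigr do rewrite !gxmE mulrA.
rewrite -mulr_suml => /eqP; rewrite mulf_eq0 => /orP[/eqP s0|/eqP//].
(* The coefficient of x_j^2 in |x|^2 is 1, so |x|^2 is not zero and cancels in the domain of
   polynomials. *)
pose j := Ordinal m_gt0.
have := congr1 (mcoeff (U_(j) + U_(j))%MM) s0.
rewrite mcoeff0 linear_sum (bigD1 j) //= big1 ?addr0.
  by rewrite -mpolyXD mcoeffX eqxx => /eqP; rewrite oner_eq0.
move=> i nij; rewrite -mpolyXD mcoeffX; case: eqP => // /(congr1 (fun a : 'X_{1..m} => a j)).
by rewrite !mnmDE !mnm1E eqxx (negbTE nij).
Qed.

Lemma gip_linear a P Q S : gip (a *: P + Q) S = a * gip P S + gip Q S.
Proof.
rewrite mulr_sumr -big_split; apply: eq_bigr => K _ /=.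
by rewrite !form_coefE mdot_linear.
Qed.

Lemma gip_conj P Q : gip Q P = (gip P Q)^*.
Proof. by rewrite rmorph_sum; apply: eq_bigr => K _; rewrite /= mdot_conj. Qed.

Lemma gip_ge0 P : 0 <= gip P P.
Proof. by apply: sumr_ge0 => K _; apply: mdot_ge0. Qed.

Lemma gip_eq0 P : gip P P = 0 -> P = 0.
Proof.
move=> /eqP; rewrite psumr_eq0 => [/allP h|K _]; last exact: mdot_ge0.
apply/ffunP=> K; rewrite form_coefE; apply/mdot_eq0/eqP/h.
by rewrite mem_index_enum.
Qed.

Lemma gip_xm j P Q : gip (gxm j P) Q = gip P (gdm j Q).
Proof. by apply: eq_bigr => K _; rewrite gxmE gdmE mdot_mulX. Qed.

Lemma mdotZr c p q : mdot p (c *: q) = c^* * mdot p q.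
Proof. by rewrite mdot_conj mdotZ rmorphM /= -mdot_conj. Qed.

Lemma mdot0r p : mdot p 0 = 0.
Proof. by rewrite -(scale0r (0 : poly)) mdotZr conjC0 mul0r. Qed.

Lemma sum_setU1 j (G : {set 'I_m} -> F) :
  \sum_(K : {set 'I_m} | j \in K) G K = \sum_(K : {set 'I_m} | j \notin K) G (j |: K).
Proof.
rewrite (reindex_onto (fun K => j |: K) (fun K => K :\ j)) /=; last first.
  by move=> K jK; rewrite finset.setD1K.
apply: eq_bigl => K; rewrite !inE eqxx /=; apply/eqP/idP => [<-|jK].
  by rewrite !inE eqxx.
exact: setU1K.
Qed.

Lemma gip_ew j P Q : gip (gew j P) Q = gip P (gec j Q).
Proof.
rewrite /gip (bigID (fun K : {set 'I_m} => j \in K)) /= [X in _ + X]big1 ?addr0; last first.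
  by move=> K /negbTE jK; rewrite gewE jK /mdot msupp0 big_nil.
rewrite [RHS](bigID (fun K : {set 'I_m} => j \in K)) /= [X in X + _]big1 ?add0r; last first.
  by move=> K jK; rewrite gecE jK mdot0r.
rewrite sum_setU1; apply: eq_bigr => K jK; rewrite gewE gecE !inE eqxx (negbTE jK) /=.
by rewrite mdotZ mdotZr rmorphXn rmorphN1 setU1K // pos_setU1 // ltnn.
Qed.

End PolyForms.

(** * Matrix substitutions in polynomial forms *)

Section PolyFormAction.
Variables (F : numClosedFieldType) (m : nat).
Local Notation poly := {mpoly F[m]}.
Local Notation gform := {ffun {set 'I_m} -> poly}.
Implicit Types (i j : 'I_m) (I K : {set 'I_m}) (P Q : gform) (p q : poly).
Implicit Types (A : 'M[F]_m).
Local Notation gvac := (@gdx F m finset.set0).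

(** The wedge product with the image of dx_j under the substitution A. *)
Definition yop A j P : gform := \sum_i A i j *: gew i P.

Fact yop_is_linear A j : linear (yop A j).
Proof.
move=> a P Q; rewrite /yop scaler_sumr -big_split; apply: eq_bigr => i _ /=.
by rewrite linearP scalerDr !scalerA mulrC.
Qed.
HB.instance Definition _ A j :=
  GRing.isLinear.Build F gform gform *:%R (yop A j) (yop_is_linear A j).

Lemma gform_eq_opp0 P : P = - P -> P = 0.
Proof.
move=> /eqP; rewrite -subr_eq0 opprK -mulr2n -scaler_nat scaler_eq0.
by rewrite pnatr_eq0 => /eqP.
Qed.

Lemma yop_yop A i j P : yop A i (yop A j P) = - yop A j (yop A i P).
Proof.
rewrite /yop -sumrN; under eq_bigr do rewrite linear_sum scaler_sumr.
rewrite exchange_big; apply: eq_bigr => k _ /=.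
rewrite linear_sum scaler_sumr -sumrN; apply: eq_bigr => l _.
by rewrite !linearZ /= !scalerA gew_gew scalerN mulrC.
Qed.

Lemma yop_id A j P : yop A j (yop A j P) = 0.
Proof. by apply: gform_eq_opp0; rewrite {1}yop_yop. Qed.

Definition glact_dx A I : gform := foldr (yop A) gvac (enum I).

Lemma enum_set_filter I : enum I = [seq i <- enum 'I_m | i \in I].
Proof. by rewrite [in RHS]enumT {1}/enum_mem; apply: eq_filter. Qed.

(** Stated for every increasing list so that induction is possible. Moving the factor of j to the
    front passes the factors of the smaller elements of I, each with a sign. *)
Lemma yop_filter A j I (l : seq 'I_m) : j \in l -> j \notin I ->
  sorted ltn (map val l) ->
  foldr (yop A) gvac [seq i <- l | i \in j |: I] =
  (-1) ^+ count (fun i : 'I_m => (i \in I) && (i < j)%N) l *: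
    yop A j (foldr (yop A) gvac [seq i <- l | i \in I]).
Proof.
move=> jl jI; elim: l jl => // a l IHl; rewrite inE => jl sl.
have al : all (fun i : 'I_m => (a < i)%N) l.
  by have := order_path_min ltn_trans sl; rewrite all_map.
have sl' : sorted ltn (map val l) by apply: path_sorted sl.
have [eja|nja] := eqVneq j a.
  have jl' : j \notin l.
    by apply/negP => /(allP al); rewrite eja ltnn.
  have -> : [seq i <- a :: l | i \in j |: I] = j :: [seq i <- l | i \in I].
    rewrite /= !inE eja eqxx /=; congr (_ :: _); apply: eq_in_filter => i il.
    by rewrite !inE; case: eqP => // ei; rewrite eja -ei il in jl'.
  have -> : [seq i <- a :: l | i \in I] = [seq i <- l | i \in I].
    by rewrite /= -eja (negbTE jI).
  rewrite (_ : count _ _ = 0%N) ?scale1r //.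
  rewrite -eja /= (negbTE jI) add0n; apply/eqP; rewrite -leqn0 leqNgt -has_count.
  apply/hasPn => i /(allP al); rewrite -eja => ji.
  by rewrite negb_and -leqNgt (ltnW ji) orbT.
have {}jl : j \in l by move: jl; rewrite (negbTE nja).
have aj : (a < j)%N := allP al _ jl.
rewrite /= !inE eq_sym (negbTE nja) /= aj andbT.
case: (boolP (a \in I)) => aI /=; rewrite IHl // add1n exprS.
by rewrite linearZ /= yop_yop scalerN mulN1r scaleNr.
Qed.

Lemma glact_dxU A j I : j \notin I ->
  glact_dx A (j |: I) = (-1) ^+ pos j I *: yop A j (glact_dx A I).
Proof.
move=> jI; rewrite /glact_dx !enum_set_filter yop_filter ?mem_enum //.
  by congr (_ ^+ _ *: _); rewrite /pos cardE [in RHS]/enum_mem size_filter -[in RHS]enumT; apply: eq_count.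
by rewrite val_enum_ord iota_ltn_sorted.
Qed.

Lemma yop_glact_dx A j I : j \in I -> yop A j (glact_dx A I) = 0.
Proof.
move=> jI; rewrite -(finset.setD1K jI) glact_dxU ?inE ?eqxx //.
by rewrite linearZ /= yop_id scaler0.
Qed.

Definition gsub A p : poly := p \mPo [tuple \sum_i A i j *: 'X_i | j < m].

Definition glact A P : gform := \sum_I gpm (gsub A (P I)) (glact_dx A I).

Fact glact_is_linear A : linear (glact A).
Proof.
move=> a P Q; rewrite /glact scaler_sumr -big_split; apply: eq_bigr => I _ /=.
by rewrite !form_coefE /gsub linearP gpmDl gpmZl.
Qed.
HB.instance Definition _ A :=
  GRing.isLinear.Build F gform gform *:%R (glact A) (glact_is_linear A).

Lemma glact_vac A : glact A gvac = gvac.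
Proof.
rewrite /glact (bigD1 finset.set0) //= big1 ?addr0 => [|I /negbTE I0].
  by rewrite gdxE eqxx /gsub comp_mpoly1 gpm1l /glact_dx finset.enum_set0.
by rewrite gdxE I0 /gsub comp_mpoly0 gpm0l.
Qed.

Lemma glact_xm A j P : glact A (gxm j P) = \sum_i A i j *: gxm i (glact A P).
Proof.
under [RHS]eq_bigr do rewrite linear_sum scaler_sumr.
rewrite exchange_big; apply: eq_bigr => I _.
rewrite gxmE /gsub rmorphM /= comp_mpolyXU nth_mktuple -gpmA gpm_suml.
by apply: eq_bigr => i _; rewrite gpmZl.
Qed.

Lemma glact_ew A j P : glact A (gew j P) = \sum_i A i j *: gew i (glact A P).
Proof.
rewrite -/(yop A j (glact A P)) linear_sum /=.
rewrite /glact (bigID (fun K : {set 'I_m} => j \in K)) /= [X in _ + X]big1 ?addr0; last first.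
  by move=> K /negbTE jK; rewrite gewE jK /gsub comp_mpoly0 gpm0l.
rewrite [RHS](bigID (fun K : {set 'I_m} => j \in K)) /= [X in X + _]big1 ?add0r; last first.
  move=> K jK; rewrite /yop; under eq_bigr do rewrite gew_gpm -linearZ.
  by rewrite -linear_sum -/(yop A j _) yop_glact_dx // linear0.
rewrite (reindex_onto (fun K => j |: K) (fun K => K :\ j)) /=; last first.
  by move=> K jK; rewrite finset.setD1K.
apply: eq_big => [K|K /andP[_ /eqP jK]].
  rewrite !inE eqxx /=; apply/eqP/idP => [<-|jK]; first by rewrite !inE eqxx.
  exact: setU1K.
have {}jK : j \notin K by rewrite -jK !inE eqxx.
rewrite gewE !inE eqxx setU1K //= glact_dxU // /gsub comp_mpolyZ gpmZl.
rewrite linearZ /= scalerA -exprD pos_setU1 // ltnn addnn -signr_odd odd_double scale1r.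
rewrite /yop linear_sum; apply: eq_bigr => i _.
by rewrite linearZ /= gew_gpm.
Qed.

Definition form_fock : fock F m :=
  @Fock F m gform (fun j => gxm j) (fun j => gdm j) (fun j => gew j)
    (fun j => gec j) gvac (@gip F m) (fun A => glact A)
    (@gxm_gxm F m) (@gdm_gdm F m) (@gdm_gxm F m) (@gew_gew F m) (@gec_gec F m)
    (@gec_gew F m) (fun i j => gew_gpm i _) (fun i j => gec_gpm i _)
    (@gew_gdm F m) (@gec_gdm F m) (@gdm_vac F m) (@gec_vac F m)
    (@gform_ind F m) (@gsum_xm_inj F m) (@gip_linear F m) (@gip_conj F m)
    (@gip_ge0 F m) (@gip_eq0 F m) (@gip_xm F m) (@gip_ew F m)
    glact_vac glact_xm glact_ew.

Lemma euler_mpoly p : \sum_j 'X_j * mderiv j p =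
  \sum_(a <- msupp p) ((mdeg a)%:R * p@_a) *: 'X_[a].
Proof.
rewrite {1}[p]mpolyE; under eq_bigr do rewrite linear_sum mulr_sumr.
rewrite exchange_big; apply: eq_bigr => a _ /=.
under eq_bigr do rewrite linearZ /= mderivX -!scalerAr.
rewrite -scaler_sumr mulrC -scalerA; congr (_ *: _).
rewrite mdegE natr_sum scaler_suml; apply: eq_bigr => j _.
have [->|aj] := posnP (a j); first by rewrite !scale0r.
congr (_ *: _); rewrite -mpolyXD addmC submK //.
by apply/mnm_lepP => i; rewrite mnm1E; case: eqP => // <-.
Qed.

Lemma eul_coef P I a : ((eul (P : form_fock) : gform) I)@_a = (mdeg a)%:R * (P I)@_a.
Proof.
rewrite eulE sum_ffunE; under eq_bigr do rewrite gxmE gdmE.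
rewrite euler_mpoly linear_sum /= big_mkcond /=.
under eq_bigr do rewrite mcoeffZ mcoeffX.
have [pa|pa] := boolP (a \in msupp (P I)); last first.
  rewrite (memN_msupp_eq0 pa) mulr0 big_seq big1 // => b pb.
  by case: eqP => [eb|_]; rewrite ?mulr0 //; rewrite eb (negbTE pa) in pb.
rewrite (bigD1_seq a) ?msupp_uniq //= eqxx mulr1 big1 ?addr0 // => b /negbTE->.
by rewrite mulr0.
Qed.

Lemma num_coef P I : (num (P : form_fock) : gform) I = #|I|%:R *: P I.
Proof.
rewrite numE sum_ffunE -sum1_card natr_sum scaler_suml big_mkcond.
rewrite [RHS]big_mkcond; apply: eq_bigr => j _ /=.
rewrite gewE gecE; case: ifP => // jI; rewrite !inE eqxx /= scalerA -exprD.
by rewrite finset.setD1K // (pos_setD1 _ jI) ltnn addnn -signr_odd odd_double !scale1r.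
Qed.

(** E and N are diagonal on the terms x^a dx_I with eigenvalues [mdeg a] and [#|I|], and distinct
    natural numbers stay distinct in F. *)
Lemma bihomP s k P : bihom s k (P : form_fock) <->
  forall I : {set 'I_m}, P I \is k.-homog /\ (#|I| != s -> P I = 0).
Proof.
split=> [[EP NP] I|hP].
  split.
    apply/dhomogP => a; rewrite mcoeff_msupp => pa.
    have := congr1 (fun Q : gform => (Q I)@_a) EP; rewrite eul_coef form_coefE mcoeffZ.
    by move=> /(mulIf pa)/eqP; rewrite eqr_nat => /eqP.
  move=> sI; have := congr1 (fun Q : gform => Q I) NP; rewrite num_coef form_coefE.
  move/eqP; rewrite -subr_eq0 -scalerBl scaler_eq0 subr_eq0 eqr_nat (negbTE sI).
  by move/eqP.
split; apply/ffunP => I; have [hk hs] := hP I.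
  rewrite form_coefE; apply/mpolyP => a; rewrite eul_coef mcoeffZ.
  have [->|pa] := eqVneq ((P I)@_a) 0; first by rewrite !mulr0.
  by rewrite (dhomog_mf hk) // mcoeff_msupp.
rewrite num_coef form_coefE; have [->//|/hs->] := eqVneq #|I| s.
by rewrite !scaler0.
Qed.

Lemma form_fin s k : exists l : seq form_fock, forall u, bihom s k u -> inspan l u.
Proof.
exists (allpairs (fun (K : {set 'I_m}) (b : 'X_{1..m < k.+1}) => gpm 'X_[b] (gdx F K))
  (index_enum _) (index_enum _)) => u /bihomP hu.
rewrite (gform_sum u); apply: subspace_sum; first exact: inspan_subspace.
move=> I _; rewrite [u I](mpolywE (k := k.+1)); last first.
  rewrite msizeE; apply/bigmax_leqP_seq => a pa _; have [hk _] := hu I.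
  by rewrite (dhomog_mf hk).
rewrite gpm_suml; apply: subspace_sum; first exact: inspan_subspace.
move=> a _; rewrite gpmZl; apply: subspaceZ; first exact: inspan_subspace.
apply: inspan_mem; apply: (allpairs_f (fun K (b : 'X_{1..m < k.+1}) => gpm 'X_[b] (gdx F K)));
  exact: mem_index_enum.
Qed.

End PolyFormAction.

(** * Polynomials vanishing on the null cone *)

Section PolynomialFacts.
Variables (F : numClosedFieldType) (n : nat).
Local Notation poly := {mpoly F[n]}.
Implicit Types (p q r : poly) (i j : 'I_n) (v : 'I_n -> F).

Lemma mpoly_ind_mulX (S : poly -> Prop) : S 1 ->
  (forall c p q, S p -> S q -> S (c *: p + q)) ->
  (forall j p, S p -> S ('X_j * p)) -> forall p, S p.
Proof.
move=> S1 SP SX.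
have S0 : S 0 by rewrite -(addNr 1) -scaleN1r; apply: SP.
have SXa a p : S p -> S ('X_[a] * p).
  rewrite mpolyXE_id; move: p.
  apply: (big_ind (fun q => forall p, S p -> S (q * p))) => [p|p1 p2 IH1 IH2 p Sp|i _].
  - by rewrite mul1r.
  - by rewrite -mulrA; apply/IH1/IH2.
  elim: (a i) => [|k IHk] p Sp; first by rewrite expr0 mul1r.
  by rewrite exprS -mulrA; apply/SX/IHk.
elim/mpolyind => // c a p _ _ Sp; apply: SP => //.
by rewrite -[X in S X]mulr1; apply: SXa.
Qed.

(** The line through v in direction e_j with formal parameter; it reduces vanishing of a polynomial
    function to one variable. *)
Definition line v j : 'I_n -> {poly F} := fun i => (v i)%:P + (i == j)%:R *: 'X.

Lemma line_deriv v j p :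
  (mmap polyC (line v j) p)^`() = mmap polyC (line v j) (mderiv j p).
Proof.
elim/mpoly_ind_mulX: p => [|c p q IHp IHq|i p IHp].
- by rewrite rmorph1 derivC mderivC rmorph0.
- rewrite mderivD mderivZ -!mul_mpolyC !rmorphD !rmorphM /= mmapC.
  by rewrite derivD derivM derivC mul0r add0r IHp IHq.
rewrite mderivM rmorphD !rmorphM /= derivM IHp mmapX mmap1U; congr (_ * _ + _).
rewrite /line derivD derivC add0r derivZ derivX mderivX mnm1E mmapZ.
case: eqVneq => [->|_]; last by rewrite !scale0r mul0r.
by rewrite -[X in (X - _)%MM]add0m addmK mpolyX0 scale1r /= mul1r -mpolyC1 mmapC.
Qed.

Lemma line_horner v j p t :
  (mmap polyC (line v j) p).[t] = p.@[fun i => v i + (i == j)%:R * t].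
Proof.
elim/mpoly_ind_mulX: p => [|c p q IHp IHq|i p IHp].
- by rewrite rmorph1 hornerE meval1.
- by rewrite -!mul_mpolyC !rmorphD !rmorphM /= mmapC !hornerE IHp IHq mevalC.
by rewrite !rmorphM /= hornerM IHp mmapX mmap1U mevalXU /line !hornerE.
Qed.

Lemma poly_all_roots (p : {poly F}) : (forall t, p.[t] = 0) -> p = 0.
Proof.
move=> p0; apply: (@roots_geq_poly_eq0 _ p [seq (l%:R : F) | l <- iota 0 (size p)]).
- by apply/allP => _ /mapP[i _ ->]; apply/rootP.
- rewrite map_inj_uniq ?iota_uniq // => i j /eqP.
  by rewrite eqr_nat => /eqP.
by rewrite size_map size_iota.
Qed.

(** On each line the polynomial has infinitely many roots, so its restriction is zero, and so is the
    derivative of the restriction. *)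
Lemma meval_mderiv p j : (forall v, p.@[v] = 0) -> forall v, (mderiv j p).@[v] = 0.
Proof.
move=> p0 v; have E : mmap polyC (line v j) p = 0.
  by apply: poly_all_roots => t; rewrite line_horner.
have := line_horner v j (mderiv j p) 0; rewrite -line_deriv E derivC horner0.
by move=> ->; apply: meval_eq => i; rewrite mulr0 addr0.
Qed.

Lemma meval_eq0 p : (forall v, p.@[v] = 0) -> p = 0.
Proof.
(* Induction on a strict bound for the degree: the derivatives vanish identically by induction, so
   only a constant is left. *)
suff H k q : (forall a, (k <= mdeg a)%N -> q@_a = 0) -> (forall v, q.@[v] = 0) -> q = 0.
  by apply: (H (msize p)) => a /msize_mdeg_ge/memN_msupp_eq0.
elim: k q => [|k IHk] {}p pk p0; first by apply/mpolyP => a; rewrite pk // mcoeff0.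
have dp0 j : mderiv j p = 0.
  apply: IHk => [a ka|]; last exact: meval_mderiv.
  by rewrite mcoeff_deriv pk ?mul0rn // mdegD mdeg1 addn1.
have pa0 a : a != 0%MM -> p@_a = 0.
  move=> a0; have /existsP[j aj] : [exists j, a j != 0%N].
    rewrite -negb_forall; apply: contra a0 => /forallP a0.
    by apply/eqP/mnmP => j; rewrite mnm0E; apply/eqP/a0.
  have := mcoeff_deriv j (a - U_(j))%MM p; rewrite dp0 mcoeff0 submK; last first.
    by apply/mnm_lepP => i; rewrite mnm1E; case: eqP => // <-; rewrite lt0n.
  by move/esym/eqP; rewrite mulrn_eq0 /= => /eqP.
have pC : p = (p@_0%MM)%:MP.
  apply/mpolyP => a; rewrite mcoeffC; have [->|/pa0->] := eqVneq a 0%MM.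
    by rewrite mulr1.
  by rewrite mulr0.
by have := p0 (fun=> 0); rewrite pC mevalC => ->.
Qed.

(** Divide by |x|^2, which is monic quadratic in x_o: p = |x|^2 q + x_o A + B with A and B not
    depending on x_o. Above each choice of the other coordinates the null cone has the points x_o =
    s and x_o = - s, so s A + B and - s A + B both vanish. Hence B = 0 and s^2 A = 0, where s^2 = -
    rho. *)
Lemma quadric_dvd (o o' : 'I_n) p : o' != o ->
  (forall v, \sum_i v i * v i = 0 -> p.@[v] = 0) ->
  exists q, p = (\sum_i 'X_i * 'X_i) * q.
Proof.
move=> oo' pN.
pose indep q := forall v v', (forall i, i != o -> v i = v' i) -> q.@[v] = q.@[v'].
pose rho : poly := \sum_(i | i != o) 'X_i * 'X_i.
pose r2 : poly := \sum_i 'X_i * 'X_i.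
have r2E : r2 = 'X_o * 'X_o + rho by rewrite /r2 (bigD1 o).
have rhoV v : rho.@[v] = \sum_(i | i != o) v i * v i.
  by rewrite /rho raddf_sum; apply: eq_bigr => i _; rewrite /= mevalM !mevalXU.
have irho : indep rho.
  by move=> v v' vv'; rewrite !rhoV; apply: eq_bigr => i /vv'->.
have iD q r : indep q -> indep r -> indep (q + r).
  by move=> iq ir v v' vv'; rewrite !mevalD (iq v v') // (ir v v').
have iM q r : indep q -> indep r -> indep (q * r).
  by move=> iq ir v v' vv'; rewrite !mevalM (iq v v') // (ir v v').
have iC c : indep c%:MP by move=> v v' _; rewrite !mevalC.
have [q [A [B [iA iB pE]]]] : exists q A B,
    [/\ indep A, indep B & p = r2 * q + 'X_o * A + B].
  elim/mpoly_ind_mulX: {pN} p => [|c p1 p2 [q1 [A1 [B1 [iA1 iB1 ->]]]] [q2 [A2 [B2 [iA2 iB2 ->]]]]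
    |j p [q [A [B [iA iB ->]]]]].
  - by exists 0, 0, 1; split; rewrite ?mulr0 ?add0r // -?mpolyC1 -?mpolyC0; exact: iC.
  - exists (c%:MP * q1 + q2), (c%:MP * A1 + A2), (c%:MP * B1 + B2); split.
    + by apply: iD => //; apply: iM.
    + by apply: iD => //; apply: iM.
    by rewrite -mul_mpolyC; ring.
  have [->|jo] := eqVneq j o.
    (* The term x_o^2 A is rewritten with x_o^2 = |x|^2 - rho. *)
    exists ('X_o * q + A), B, ((-1)%:MP * (rho * A)); split=> //.
      by apply: (iM _ _) => //; apply: iM.
    by rewrite r2E mpolyCN mpolyC1; ring.
  have iX : indep 'X_j by move=> v v' vv'; rewrite !mevalXU vv'.
  exists ('X_j * q), ('X_j * A), ('X_j * B); split; try exact: iM.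
  by ring.
have AB v s : s * s = - \sum_(i | i != o) v i * v i ->
    s * A.@[v] + B.@[v] = 0.
  move=> ss; pose v' i := if i == o then s else v i.
  have vv' i : i != o -> v i = v' i by rewrite /v' => /negbTE->.
  have v'o : v' o = s by rewrite /v' eqxx.
  have r2v' : r2.@[v'] = 0.
    rewrite r2E mevalD mevalM !mevalXU rhoV v'o ss.
    by rewrite -(eq_bigr _ (fun i io => congr1 (fun t => t * t) (vv' i io))) addNr.
  have : p.@[v'] = 0.
    by apply: pN; rewrite -[RHS]r2v' /r2 raddf_sum; apply: eq_bigr => i _;
      rewrite /= mevalM !mevalXU.
  by rewrite pE !mevalD !mevalM r2v' mul0r add0r mevalXU v'o (iA v v') // (iB v v').
have AB0 v : B.@[v] = 0 /\ (rho * A).@[v] = 0.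
  pose S := \sum_(i | i != o) v i * v i; pose s := sqrtC (- S).
  have ss : s * s = - S by rewrite -expr2 sqrtCK.
  have e1 := AB v s ss; have /AB e2 : (- s) * (- s) = - S by rewrite mulrNN.
  have Bv : B.@[v] = 0.
    have : B.@[v] + B.@[v] = 0 by rewrite -[RHS](addr0 0) -{1}e1 -e2; ring.
    by move/eqP; rewrite -mulr2n mulrn_eq0 /= => /eqP.
  split=> //; rewrite mevalM rhoV -/S -[S]opprK -ss mulNr -mulrA.
  by move: e1; rewrite Bv addr0 => ->; rewrite mulr0 oppr0.
have B0 : B = 0 by apply: meval_eq0 => v; case: (AB0 v).
have /eqP : rho * A = 0 by apply: meval_eq0 => v; case: (AB0 v).
rewrite mulf_eq0 => /orP[/eqP rho0|/eqP A0]; last first.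
  by exists q; rewrite pE A0 B0 mulr0 !addr0.
(* The second index o' shows that rho is not the zero polynomial: it takes the value 1 at the unit
   vector of o'. *)
have := rhoV (fun i => (i == o')%:R); rewrite rho0 meval0 (bigD1 o') //= eqxx.
rewrite big1 ?addr0 => [/esym/eqP|i /andP[_ /negbTE->]]; last by rewrite mulr0.
by rewrite mulr1 oner_eq0.
Qed.

End PolynomialFacts.

(** * Real orthogonal matrices and reflections *)

Section Householder.
Variables (F : numClosedFieldType) (n : nat).
Implicit Types (x y z : 'rV[F]_n) (A : 'M[F]_n).

Definition realmx p q (A : 'M[F]_(p, q)) := map_mx Num.conj A = A.
Definition orthoR A := A *m A^T = 1%:M /\ realmx A.
Definition dotr x y : F := (x *m y^T) 0 0.

Lemma dotrE x y : dotr x y = \sum_i x 0 i * y 0 i.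
Proof. by rewrite /dotr mxE; apply: eq_bigr => i _; rewrite mxE. Qed.

Lemma orthoR1 : orthoR 1%:M.
Proof. by split; [rewrite trmx1 mulmx1|rewrite /realmx map_mx1]. Qed.

Lemma orthoRM A B : orthoR A -> orthoR B -> orthoR (A *m B).
Proof.
move=> [oA rA] [oB rB]; split; last by rewrite /realmx map_mxM rA rB.
by rewrite trmx_mul mulmxA -[A *m B *m _]mulmxA oB mulmx1.
Qed.

(** The Householder reflection in the hyperplane orthogonal to w = x - y. [dotr] is bilinear;
    realness makes w.w a sum of |w_i|^2, hence nonzero when x and y differ. *)
Lemma reflection x y : realmx x -> realmx y -> dotr x x = dotr y y ->
  exists A, [/\ orthoR A, x *m A = y &
    forall z, dotr z x = dotr z y -> z *m A = z].
Proof.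
move=> rx ry xy; have [->|nxy] := eqVneq x y.
  by exists 1%:M; split; [exact: orthoR1|rewrite mulmx1|move=> z _; rewrite mulmx1].
pose w := x - y; have rw : realmx w by rewrite /realmx map_mxB rx ry.
have rwi i : (w 0 i)^* = w 0 i by rewrite -[in RHS]rw [RHS]mxE.
pose N := dotr w w.
have N0 : N != 0.
  apply: contraNneq nxy => /eqP; rewrite /N dotrE psumr_eq0 => [/allP wN|i _].
    rewrite -subr_eq0; apply/eqP/rowP => i; have := wN i (mem_index_enum i).
    by rewrite mulf_eq0 orbb -/w => /eqP->; rewrite mxE.
  by rewrite -{2}rwi mul_conjC_ge0.
have wwT : w *m w^T = N%:M by rewrite [LHS]mx11_scalar.
pose A := 1%:M - (2 / N) *: (w^T *m w).
have rN : N^* = N.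
  by rewrite /N dotrE rmorph_sum; apply: eq_bigr => i _; rewrite rmorphM /= rwi.
have actA z : z *m A = z - (2 / N * dotr z w) *: w.
  rewrite mulmxBr mulmx1 -scalemxAr mulmxA [z *m w^T]mx11_scalar mul_scalar_mx.
  by rewrite scalerA.
have AT : A^T = A.
  by rewrite linearB /= trmx1 linearZ /= trmx_mul trmxK.
have dotDl z z1 z2 : dotr z (z1 - z2) = dotr z z1 - dotr z z2.
  by rewrite /dotr linearB /= mulmxBr !mxE.
have dotC z z1 : dotr z z1 = dotr z1 z.
  by rewrite !dotrE; apply: eq_bigr => i _; rewrite mulrC.
have dotBZ z c : dotr (z - c *: w) w = dotr z w - c * N.
  rewrite dotC dotDl dotC; congr (_ - _).
  by rewrite /dotr linearZ /= -scalemxAr wwT !mxE mulr1n.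
exists A; split.
- split; last first.
    rewrite /realmx map_mxB map_mx1 map_mxZ map_mxM -map_trmx rw.
    by rewrite rmorphM /= fmorphV /= rN conjC_nat.
  apply/row_matrixP => i; rewrite AT row_mul !rowE mulmx1 [delta_mx _ _ *m A]actA.
  rewrite actA; set z := delta_mx _ _; rewrite dotBZ -addrA -opprD -scalerDl.
  set t := dotr z w; suff -> : 2 / N * t + 2 / N * (t - 2 / N * t * N) = 0.
    by rewrite scale0r subr0.
  by field.
- rewrite actA; suff -> : 2 / N * dotr x w = 1 by rewrite scale1r subKr.
  (* Equal lengths give y.w = - x.w; then the coefficient of w is 1 and x goes to x - w = y. *)
  have NE : N = 2 * dotr x w.
    rewrite /N dotC dotDl ![dotr w _]dotC /w !dotDl -xy [dotr y x]dotC.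
    by ring.
  have : dotr x w != 0 by apply: contraNneq N0 => xw; rewrite NE xw mulr0.
  by rewrite NE => xw0; field.
move=> z zxy; rewrite actA /w dotDl zxy subrr mulr0 scale0r subr0.
by [].
Qed.

End Householder.

(** * A rotation of infinite order *)

Section Rotation.
Variable F : numClosedFieldType.

(* A point of the unit circle which is not a root of unity: modulo 5 all the
   powers of 3 + 4i are 3 + 4i. *)
Definition rotz : F := (3%:R + 4%:R * 'i) / 5%:R.

Lemma rotz_pow n : exists x y : int,
  (3%:R + 4%:R * 'i) ^+ n.+1 = (5 * x + 3)%:~R + (5 * y + 4)%:~R * 'i :> F.
Proof.
elim: n => [|n [x [y IHn]]]; first by exists 0, 0; rewrite expr1.
(* Real and imaginary part of (3 + 4i)((5x + 3) + (5y + 4)i), with -7 = 5 (-2) + 3 and 24 = 5 * 4 +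
   4. *)
exists (3 * x - 4 * y - 2), (4 * x + 3 * y + 4).
have mulii : 'i * 'i = -1 :> F by rewrite -expr2 sqrCi.
rewrite exprS IHn !(rmorphD, rmorphB, rmorphN, rmorphM, rmorph_nat) /=.
transitivity (3 * (5 * x%:~R + 3) + (4 * (5 * x%:~R + 3) + 3 * (5 * y%:~R + 4)) * 'i
   + 4 * (5 * y%:~R + 4) * ('i * 'i) : F); first by ring.
by rewrite mulii; ring.
Qed.

Lemma rotz_not_unity n : (0 < n)%N -> rotz ^+ n != 1.
Proof.
case: n => // n _; rewrite /rotz expr_div_n; have [x [y ->]] := rotz_pow n.
apply/eqP => /(congr1 (fun t => t * 5%:R ^+ n.+1)); rewrite divfK; last first.
  by rewrite expf_neq0 // pnatr_eq0.
rewrite mul1r => /(congr1 (fun t => 'Im t)); rewrite -natrX.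
(* A power of 5 is real, but the imaginary part 5y + 4 is never zero. *)
rewrite [_ * 'i]mulrC Im_rect ?rpred_int // (Creal_ImP _ _) ?realn // => /eqP.
by rewrite intr_eq0; lia.
Qed.

Lemma rotz_norm : rotz * rotz^* = 1.
Proof.
rewrite /rotz !(rmorphM, rmorphD, fmorphV, rmorph_nat) /= conjCi.
have mulii : 'i * 'i = -1 :> F by rewrite -expr2 sqrCi.
transitivity ((9 - 16 * ('i * 'i)) / 25 : F); first by field.
by rewrite mulii; field.
Qed.

End Rotation.

(** * Highest weight vectors *)

Section AdaptedMatrices.
Variables (F : numClosedFieldType) (n : nat).
Local Notation m := (2 + n)%N.
Local Notation M := (form_fock F m).
Local Notation gform := {ffun {set 'I_m} -> {mpoly F[m]}}.
Implicit Types (I K : {set 'I_m}) (A : 'M[F]_m) (Q : M) (a : 'X_{1..m}).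

Definition Z0 : 'I_m := lshift n ord0.
Definition Z1 : 'I_m := lshift n ord_max.
Definition bmx (X : 'M[F]_2) (Y : 'M[F]_n) : 'M[F]_m := block_mx X 0 0 Y.

Lemma bmxM X X' Y Y' : bmx X Y *m bmx X' Y' = bmx (X *m X') (Y *m Y').
Proof. by rewrite /bmx mulmx_block !mulmx0 !mul0mx !addr0 add0r. Qed.

Lemma bmx1 : bmx 1%:M 1%:M = 1%:M.
Proof. by rewrite /bmx -scalar_mx_block. Qed.

Lemma bmx_tr X Y : (bmx X Y)^T = bmx X^T Y^T.
Proof. by rewrite /bmx tr_block_mx !trmx0. Qed.

Lemma bmx_conj X Y : map_mx Num.conj (bmx X Y) = bmx (map_mx Num.conj X) (map_mx Num.conj Y).
Proof. by rewrite /bmx map_block_mx !map_mx0. Qed.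

Definition mx2 (x y z t : F) : 'M[F]_2 :=
  \matrix_(i, j) nth 0 (nth [::] [:: [:: x; y]; [:: z; t]] i) j.

Lemma mx2M x y z t x' y' z' t' : mx2 x y z t *m mx2 x' y' z' t' =
  mx2 (x * x' + y * z') (x * y' + y * t') (z * x' + t * z') (z * y' + t * t').
Proof.
apply/matrixP => i j; rewrite !mxE !big_ord_recl big_ord0 !mxE addr0 /=.
by case: i => [[|[|]]] // ?; case: j => [[|[|]]].
Qed.

Lemma mx2_1 : mx2 1 0 0 1 = 1%:M.
Proof.
apply/matrixP => i j; rewrite !mxE.
by case: i => [[|[|]]] // ?; case: j => [[|[|]]].
Qed.

Lemma mx2_tr x y z t : (mx2 x y z t)^T = mx2 x z y t.
Proof.
apply/matrixP => i j; rewrite !mxE.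
by case: i => [[|[|]]] // ?; case: j => [[|[|]]].
Qed.

Lemma mx2_conj x y z t : map_mx Num.conj (mx2 x y z t) = mx2 x^* y^* z^* t^*.
Proof.
apply/matrixP => i j; rewrite !mxE.
by case: i => [[|[|]]] // ?; case: j => [[|[|]]].
Qed.

(** Column j of a matrix gives the image of x_j. So [hmx] substitutes z = x_0 + 'i x_1 for the first
    variable and its conjugate for the second; [rmx] is the rotation with cosine 3/5 and sine 4/5,
    and [dmx] is its diagonal form in these coordinates. *)
Definition hmx : 'M[F]_m := bmx (mx2 1 1 'i (- 'i)) 1%:M.
Definition rmx : 'M[F]_m :=
  bmx (mx2 (3%:R / 5%:R) (4%:R / 5%:R) (- (4%:R / 5%:R)) (3%:R / 5%:R)) 1%:M.
Definition dmx : 'M[F]_m := bmx (mx2 (rotz F) 0 0 (rotz F)^*) 1%:M.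
Definition nmx (l : 'I_n) : 'M[F]_m :=
  bmx 1%:M (diag_mx (\row_i (-1) ^+ (i == l))).
Definition tmx (i j : 'I_n) : 'M[F]_m := bmx 1%:M (tperm_mx i j).

Lemma mulii : 'i * 'i = -1 :> F. Proof. by rewrite -expr2 sqrCi. Qed.

Lemma hmx_unit : hmx \in unitmx.
Proof.
suff /mulmx1_unit[] : hmx *m bmx (mx2 (1 / 2) (- ('i / 2)) (1 / 2) ('i / 2)) 1%:M = 1%:M by [].
rewrite bmxM mx2M mulmx1 -bmx1 -mx2_1; congr (bmx (mx2 _ _ _ _) _).
- by field.
- by rewrite mul1r mul1r addNr.
- by field.
by transitivity (- ('i * 'i) : F); [field|rewrite mulii opprK].
Qed.

Lemma rmx_hmx : rmx *m hmx = hmx *m dmx.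
Proof.
have ci : (rotz F)^* = (3%:R - 4%:R * 'i) / 5%:R.
  by rewrite /rotz rmorphM rmorphD rmorphM fmorphV /= !conjC_nat conjCi mulrN.
rewrite /rmx /hmx /dmx !bmxM !mx2M !mulmx1 ci /rotz; congr (bmx (mx2 _ _ _ _) _).
- by field.
- by field.
- transitivity ((3 * 'i + 4 * ('i * 'i)) / 5 : F); first by rewrite mulii; field.
  by field.
transitivity ((- (3 * 'i) + 4 * ('i * 'i)) / 5 : F); first by rewrite mulii; field.
by field.
Qed.

Lemma nmx_hmx l : nmx l *m hmx = hmx *m nmx l.
Proof. by rewrite !bmxM !mulmx1 !mul1mx. Qed.

Lemma tmx_hmx i j : tmx i j *m hmx = hmx *m tmx i j.
Proof. by rewrite !bmxM !mulmx1 !mul1mx. Qed.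

Lemma rmx_orthoR : orthoR rmx.
Proof.
split; last first.
  rewrite /realmx bmx_conj mx2_conj map_mx1.
  by rewrite !rmorphN !rmorphM !fmorphV /= !conjC_nat.
rewrite bmx_tr bmxM mx2_tr mx2M trmx1 mulmx1 -bmx1 -mx2_1.
by congr (bmx (mx2 _ _ _ _) _); field.
Qed.

Lemma nmx_orthoR l : orthoR (nmx l).
Proof.
split; last first.
  rewrite /realmx bmx_conj map_mx1; congr bmx; apply/matrixP => i j.
  by rewrite !mxE rmorphMn rmorphXn rmorphN1.
rewrite bmx_tr bmxM trmx1 mulmx1 tr_diag_mx -bmx1; congr bmx.
apply/matrixP => i j; rewrite mul_diag_mx !mxE.
by rewrite mulrnAr -expr2 sqrr_sign.
Qed.

Lemma tmx_orthoR i j : orthoR (tmx i j).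
Proof.
split; last first.
  rewrite /realmx bmx_conj map_mx1; congr bmx; exact: map_perm_mx.
rewrite bmx_tr bmxM trmx1 mulmx1 tr_tperm_mx -bmx1; congr bmx.
by rewrite /tperm_mx -perm_mxM tperm2 perm_mx1.
Qed.

End AdaptedMatrices.

Section DiagonalAction.
Variables (F : numClosedFieldType) (m : nat).
Local Notation M := (form_fock F m).
Local Notation gform := {ffun {set 'I_m} -> {mpoly F[m]}}.
Implicit Types (I K : {set 'I_m}) (A : 'M[F]_m) (a : 'X_{1..m}).

Lemma mcoeff_XM j (p : {mpoly F[m]}) a :
  ('X_j * p)@_a = if a j == 0%N then 0 else p@_(a - U_(j)).
Proof.
have [aj|aj] := eqVneq (a j) 0%N.
  rewrite [p]mpolyE mulr_sumr linear_sum big1 //= => b _.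
  rewrite -scalerAr mcoeffZ -mpolyXD mcoeffX; case: eqP => [ab|_]; last by rewrite mulr0.
  by move: aj; rewrite -ab mnmDE mnm1E eqxx.
have {1}<- : (a - U_(j) + U_(j) = a)%MM.
  by apply/submK/mnm_lepP => i; rewrite mnm1E; case: eqP => // <-; rewrite lt0n.
by rewrite mulrC addmC mcoeffMX.
Qed.

(** The character by which a diagonal substitution acts on x^a dx_I; dx_j transforms like x_j, so it
    adds one to the exponent of j. *)
Definition weight A a I := \prod_j A j j ^+ (a j + (j \in I)).

Lemma diag_coef A (Q : M) : is_diag_mx A -> forall I a,
  ((lact M A Q : gform) I)@_a = weight A a I * ((Q : gform) I)@_a.
Proof.
move=> /is_diag_mxP dA.
have sumA j (G : 'I_m -> M) : \sum_i A i j *: G i = A j j *: G j.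
  rewrite (bigD1 j) //= big1 ?addr0 // => i nij.
  by rewrite dA ?scale0r.
elim/(@fock_ind _ _ M): Q => [|c u v IHu IHv|l u IHu|l u IHu] I a.
- rewrite lact_vac gdxE; case: eqP => [->|_]; last by rewrite mcoeff0 mulr0.
  rewrite mcoeff1; case: eqP => [->|_]; last by rewrite mulr0.
  by rewrite mulr1 /weight big1 // => j _; rewrite mnm0E inE expr0.
- rewrite linearP /= !form_coefE !mcoeffD !mcoeffZ IHu IHv.
  by rewrite mulrDr mulrCA.
- rewrite lact_xm sumA form_coefE /= !gxmE mcoeffZ !mcoeff_XM IHu.
  case: eqP => [_|/eqP al]; first by rewrite !mulr0.
  rewrite mulrA; congr (_ * _).
  rewrite /weight (bigD1 l) //= [RHS](bigD1 l) //= mulrA -exprS mnmBE mnm1E eqxx.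
  rewrite -addSn subn1 prednK ?lt0n //; congr (_ * _).
  apply: eq_bigr => j /negbTE nj; by rewrite mnmBE mnm1E eq_sym nj subn0.
rewrite lact_ew sumA form_coefE /= !gewE mcoeffZ.
case: ifP => lI; last by rewrite !mcoeff0 !mulr0.
rewrite !mcoeffZ IHu mulrCA [RHS]mulrCA; congr (_ * _); rewrite mulrA; congr (_ * _).
rewrite /weight (bigD1 l) //= [RHS](bigD1 l) //= mulrA -exprS !inE eqxx lI addn0 addn1.
by congr (_ * _); apply: eq_bigr => j /negbTE nj; rewrite !inE nj.
Qed.

End DiagonalAction.

(** An eigenvector of g becomes, in the coordinates given by h, an eigenvector of the conjugate D of
    g. *)
Lemma lact_conj_eig (F : numClosedFieldType) (m : nat) (M : fock F m)
    (g h D : 'M[F]_m) c (Q : M) :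
  h \in unitmx -> g *m h = h *m D -> lact M g Q = c *: Q ->
  lact M D (lact M (invmx h) Q) = c *: lact M (invmx h) Q.
Proof.
move=> hu gh gQ; rewrite -linearZ -gQ -!lact_mul; congr (lact M _ _).
by rewrite -[LHS](mulKmx hu) [h *m _]mulmxA -gh mulmxK.
Qed.

Lemma lact_bihom (F : numClosedFieldType) (m : nat) (M : fock F m) (A : 'M[F]_m)
    s k (Q : M) : bihom s k Q -> bihom s k (lact M A Q).
Proof. by move=> [EQ NQ]; split; rewrite ?lact_eul ?lact_num ?EQ ?NQ linearZ. Qed.

Section JointEigenvectors.
Variables (F : numClosedFieldType) (n : nat).
Local Notation m := (2 + n)%N.
Local Notation M := (form_fock F m).
Local Notation gform := {ffun {set 'I_m} -> {mpoly F[m]}}.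
Implicit Types (I K : {set 'I_m}) (A : 'M[F]_m) (Q : M) (a : 'X_{1..m}).
Local Notation Z0 := (Z0 n).
Local Notation Z1 := (Z1 n).
Local Notation hmx := (hmx F n).

Definition tope k I : gform := gpm 'X_[U_(Z0) *+ k] (gdx F I).
(* For I = Z0 |: J this is z^k dz /\ dx_J, where z = x_0 + 'i * x_1.  It is made
   opaque to keep unification from unfolding the action. *)
Fact topv_key : {f : nat -> {set 'I_m} -> M | forall k I, f k I = lact M hmx (tope k I)}.
Proof. by exists (fun k I => lact M hmx (tope k I)). Qed.
Definition topv k I : M := sval topv_key k I.
Lemma topvE k I : topv k I = lact M hmx (tope k I).
Proof. exact: svalP topv_key k I. Qed.

(** The exponent k + 1 counts k factors z and the factor dz; the sign changes of the remaining
    coordinates record which of their differentials occur. *)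
Definition joint k I Q := lact M (rmx F n) Q = rotz F ^+ k.+1 *: Q /\
  forall l : 'I_n, lact M (nmx F l) Q = (-1) ^+ (rshift 2 l \in I) *: Q.

Lemma tope_coef k I K a :
  (tope k I K)@_a = ((K == I) && (a == (U_(Z0) *+ k)%MM))%:R.
Proof.
rewrite gpmE gdxE; case: eqP => _; last by rewrite mulr0 mcoeff0.
by rewrite mulr1 mcoeffX eq_sym.
Qed.

Lemma dmx_diag : is_diag_mx (dmx F n).
Proof.
apply/is_diag_mxP => i j nij; rewrite -(fintype.splitK i) -(fintype.splitK j) in nij *.
case: (fintype.split i) (fintype.split j) nij => [i1|i2] [j1|j2] /= nij; rewrite /dmx /bmx
  ?block_mxEul ?block_mxEur ?block_mxEdl ?block_mxEdr ?mxE //.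
  by case: i1 j1 nij => [[|[|]]] // ? [[|[|]]] //= ? /negP[]; apply/eqP/val_inj.
by rewrite -val_eqE -(eqn_add2l 2) (negbTE nij).
Qed.

Lemma nmx_diag (l : 'I_n) : is_diag_mx (nmx F l).
Proof.
apply/is_diag_mxP => i j nij; rewrite -(fintype.splitK i) -(fintype.splitK j) in nij *.
case: (fintype.split i) (fintype.split j) nij => [i1|i2] [j1|j2] /= nij; rewrite /nmx /bmx
  ?block_mxEul ?block_mxEur ?block_mxEdl ?block_mxEdr ?mxE //.
  by rewrite -val_eqE (negbTE nij).
have -> : (i2 == j2) = false by rewrite -val_eqE -(eqn_add2l 2) (negbTE nij).
by [].
Qed.

Lemma weight_dmx a I :
  weight (dmx F n) a I = rotz F ^+ (a Z0 + (Z0 \in I)) * (rotz F)^* ^+ (a Z1 + (Z1 \in I)).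
Proof.
rewrite /weight big_split_ord /= !big_ord_recl big_ord0 mulr1.
rewrite [X in _ * X]big1 ?mulr1 => [|j _]; last first.
  by rewrite /dmx /bmx block_mxEdr mxE eqxx expr1n.
rewrite /dmx /bmx !block_mxEul !mxE /=.
have -> : lift ord0 ord0 = ord_max :> 'I_2 by apply/val_inj.
by [].
Qed.

Lemma weight_nmx (l : 'I_n) a I :
  weight (nmx F l) a I = (-1) ^+ (a (rshift 2 l) + (rshift 2 l \in I)).
Proof.
rewrite /weight big_split_ord /= [X in X * _]big1 ?mul1r => [|j _]; last first.
  by rewrite /nmx /bmx block_mxEul mxE eqxx expr1n.
rewrite (bigD1 l) //= big1 ?mulr1 => [|j nj].
  by rewrite /nmx /bmx block_mxEdr !mxE eqxx mulr1n expr1.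
by rewrite /nmx /bmx block_mxEdr !mxE eqxx mulr1n (negbTE nj) expr0 expr1n.
Qed.

Lemma rotz_pow_inj x y : rotz F ^+ x = rotz F ^+ y -> x = y.
Proof.
wlog xy : x y / (x <= y)%N => [H|] e.
  by case/orP: (leq_total x y) => xy; [apply: H|apply/esym/H].
apply/eqP; rewrite eqn_leq xy leqNgt -subn_gt0; apply/negP => /rotz_not_unity-/(_ F)/eqP; apply.
have z0 : rotz F != 0.
  by apply: contraTneq isT => z0; have /eqP := rotz_norm F; rewrite z0 mul0r eq_sym oner_eq0.
by apply: (mulfI (expf_neq0 x z0)); rewrite -exprD subnKC // mulr1.
Qed.

Lemma Z01 : Z0 != Z1. Proof. by []. Qed.

Lemma joint_top k I : Z0 \in I -> Z1 \notin I -> joint k I (topv k I).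
Proof.
move=> I0 I1; split=> [|l]; rewrite !topvE -lact_mul.
  rewrite rmx_hmx lact_mul -linearZ; congr (lact M _ _).
  apply/ffunP => K; apply/mpolyP => a; rewrite diag_coef ?dmx_diag // form_coefE.
  rewrite mcoeffZ !tope_coef; case: eqP => [->|_] /=; last by rewrite !mulr0.
  case: eqP => [->|_] /=; last by rewrite !mulr0.
  rewrite weight_dmx I0 (negbTE I1) !mulmnE !mnm1E eqxx (negbTE Z01).
  by rewrite mul1n mul0n addn1 addn0 expr0 !mulr1.
rewrite nmx_hmx lact_mul -linearZ; congr (lact M _ _).
apply/ffunP => K; apply/mpolyP => a; rewrite diag_coef ?nmx_diag // form_coefE.
rewrite mcoeffZ !tope_coef; case: eqP => [->|_] /=; last by rewrite !mulr0.
case: eqP => [->|_] /=; last by rewrite !mulr0.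
by rewrite weight_nmx mulmnE mnm1E.
Qed.

Lemma set_split_eq I K : Z0 \in I -> Z0 \in K -> Z1 \notin I -> Z1 \notin K ->
  (forall l : 'I_n, (rshift 2 l \in I) = (rshift 2 l \in K)) -> I = K.
Proof.
move=> I0 K0 I1 K1 IK; apply/setP => i; rewrite -(fintype.splitK i).
case: (fintype.split i) => [i1|i2] /=; last exact: IK.
case: i1 => [[|[|]]] // lt.
  by rewrite (_ : lshift n _ = Z0) ?I0 ?K0 //; apply/val_inj.
by rewrite (_ : lshift n _ = Z1) ?(negbTE I1) ?(negbTE K1) //; apply/val_inj.
Qed.

(** In diagonal coordinates let x^a dx_K have a nonzero coefficient. The rotation says that the
    exponent at Z0, counting dx_Z0, exceeds the one at Z1 by k + 1. As the degree of a is k' <= k,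
    this forces k' = k, a = k at Z0 alone, Z0 in K and Z1 not in K. The signs then determine the
    rest of K. *)
Lemma joint_unique k I s' k' Q : Z0 \in I -> Z1 \notin I ->
  bihom s' k' Q -> (k' <= k)%N -> joint k I Q ->
  exists c, Q = c *: topv k I /\ (c <> 0 -> s' = #|I| /\ k' = k).
Proof.
move=> I0 I1 bQ kk [JR JN].
pose Q' := lact M (invmx hmx) Q.
have QE : Q = lact M hmx Q' by rewrite -lact_mul mulmxV ?hmx_unit // lact1.
have bQ' : bihom s' k' Q' by apply: lact_bihom.
have DQ : lact M (dmx F n) Q' = rotz F ^+ k.+1 *: Q'.
  exact: lact_conj_eig (hmx_unit F n) (rmx_hmx F n) JR.
have NQ l : lact M (nmx F l) Q' = (-1) ^+ (rshift 2 l \in I) *: Q'.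
  exact: lact_conj_eig (hmx_unit F n) (nmx_hmx F l) (JN l).
have /bihomP hQ' := bQ'.
have coefQ' K a : ((Q' : gform) K)@_a != 0 ->
    [/\ K = I, a = (U_(Z0) *+ k)%MM, s' = #|I| & k' = k].
  move=> qa; have [hk hs] := hQ' K.
  have sK : #|K| = s'.
    apply/eqP; apply: contraNT qa => /hs->.
    by rewrite mcoeff0.
  have ak : mdeg a = k' by rewrite (dhomog_mf hk) // mcoeff_msupp.
  have := congr1 (fun P : gform => (P K)@_a) DQ.
  rewrite diag_coef ?dmx_diag // form_coefE mcoeffZ => /(mulIf qa).
  rewrite weight_dmx => e1.
  (* The conjugate of [rotz] is its inverse; moving it to the other side leaves natural exponents,
     which infinite order makes comparable. *)
  have e2 : (a Z0 + (Z0 \in K) = k.+1 + (a Z1 + (Z1 \in K)))%N.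
    apply: rotz_pow_inj; rewrite [RHS]exprD -e1 -mulrA -exprMn [_^* * _]mulrC.
    by rewrite rotz_norm expr1n mulr1.
  have a0k : (a Z0 <= mdeg a)%N by rewrite mdegE (bigD1 Z0) //= leq_addr.
  have [a0 K0 K1 kk'] : [/\ a Z0 = k, Z0 \in K, Z1 \notin K & k' = k].
    move: e2 a0k; rewrite ak; move: (a Z0) (a Z1) => x y.
    by case: (Z0 \in K); case: (Z1 \in K) => /= e2 a0k; try (exfalso; lia); split=> //; lia.
  have aE : a = (U_(Z0) *+ k)%MM.
    apply/mnmP => i; rewrite mulmnE mnm1E; case: eqP => [<-|/eqP i0].
      by rewrite mul1n.
    move: ak; rewrite mdegE (bigD1 Z0) //= a0 kk' (bigD1 i) 1?eq_sym //=.
    rewrite mul0n; move: (a i) (\sum_(_ | _) _)%N => x y; lia.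
  have KI : K = I.
    apply: set_split_eq => // l.
    have := congr1 (fun P : gform => (P K)@_a) (NQ l).
    rewrite diag_coef ?nmx_diag // form_coefE mcoeffZ => /(mulIf qa).
    rewrite weight_nmx aE mulmnE mnm1E /= add0n => /eqP.
    by case: (_ \in K); case: (_ \in I) => //; rewrite ?expr0 ?expr1 ?eqNr ?oner_eq0 // eq_sym eqNr oner_eq0.
  by rewrite -KI sK.
exists (((Q' : gform) I)@_(U_(Z0) *+ k)); split; last first.
  by move=> /eqP/coefQ'[].
rewrite {1}QE topvE -linearZ; congr (lact M _ _).
apply/ffunP => K; apply/mpolyP => a; rewrite form_coefE mcoeffZ tope_coef.
have [z|/coefQ'[-> -> _ _]] := eqVneq ((Q' : gform) K)@_a 0; last by rewrite !eqxx mulr1.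
rewrite z; case: eqP => [eK|_] /=; last by rewrite mulr0.
case: eqP => [ea|_]; last by rewrite mulr0.
by rewrite -eK -ea z mul0r.
Qed.

End JointEigenvectors.

(** * Multiples of |x|^2 *)

Section QuadricMultiples.
Variables (F : numClosedFieldType) (m : nat) (M : fock F m).
Implicit Types (u v P Q : M) (A B : 'M[F]_m).
Local Notation xm := (@xm F m M).
Local Notation dm := (@dm F m M).
Local Notation ew := (@ew F m M).
Local Notation ec := (@ec F m M).
Local Notation ip := (@ip F m M).
Local Notation lact := (@lact F m M).

(** For general A the failure of d^* to commute with the action is measured by the Gram matrix of
    the columns of A; for x the rows take their place. For [hmx] these matrices are explicit and
    sparse. *)
Lemma opDs_lact A u : opDs (lact A u) =
  - \sum_i \sum_j (A^T *m A) i j *: lact A (dm i (ec j u)).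
Proof.
rewrite opDsE; congr (- _).
under eq_bigr do rewrite lact_ec linear_sum /=.
under eq_bigr do under eq_bigr do rewrite linearZ /= lact_dm scaler_sumr.
rewrite exchange_big /= [RHS]exchange_big; apply: eq_bigr => j _.
rewrite exchange_big; apply: eq_bigr => i _ /=.
rewrite mxE scaler_suml; apply: eq_bigr => l _.
by rewrite scalerA mxE mulrC.
Qed.

Lemma lact_opX_gen A u : lact A (opX u) =
  - \sum_i \sum_j (A *m A^T) i j *: xm i (ew j (lact A u)).
Proof.
rewrite opXE linearN linear_sum /=; congr (- _).
under eq_bigr do rewrite lact_xm lact_ew.
rewrite exchange_big /=; apply: eq_bigr => i _.
under eq_bigr do rewrite (linear_sum (xm i)) scaler_sumr /=.
rewrite exchange_big; apply: eq_bigr => j _ /=.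
rewrite mxE scaler_suml; apply: eq_bigr => l _.
by rewrite linearZ /= scalerA mxE.
Qed.

Lemma sum_xm_opX u : opX (\sum_j xm j (xm j u)) = \sum_j xm j (xm j (opX u)).
Proof.
apply: oppr_inj; rewrite -(xop_xstar_q (opX u)) opX_opX (linear0 (@opXs F m M)) addr0.
by rewrite -linearN -xop_xstar_q linearD /= opX_opX add0r.
Qed.

Lemma sum_xm_opXs u : opXs (\sum_j xm j (xm j u)) = \sum_j xm j (xm j (opXs u)).
Proof.
apply: oppr_inj; rewrite -(xop_xstar_q (opXs u)) opXs_opXs (linear0 (@opX F m M)) add0r.
by rewrite -linearN -xop_xstar_q linearD /= opXs_opXs addr0.
Qed.

Lemma sum_xm_eul u : eul (\sum_j xm j (xm j u)) =
  \sum_j xm j (xm j (2%:R *: u + eul u)).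
Proof.
rewrite linear_sum; apply: eq_bigr => j _ /=.
by rewrite !eul_xm scaler_nat mulr2n !linearD /= addrA.
Qed.

Lemma sum_xm_num u : num (\sum_j xm j (xm j u)) = \sum_j xm j (xm j (num u)).
Proof. by rewrite linear_sum; apply: eq_bigr => j _ /=; rewrite !num_xm. Qed.

(** Cancelling |x|^2 gives x Q = 0 and x^* (P + Q) = 0. The commutation relations then write (m + k
    - s) Q as x d^* Q and (k + s) (P + Q) as x^* d Q. Both are orthogonal to P, since P is killed by
    d^* and d. Both factors are nonzero for 0 < s < m, so Q and P + Q, and hence P itself, are
    orthogonal to P. *)
Lemma hod_xxs_multiple s k P Q : (0 < s < m)%N -> @hod F m M s k P ->
  opX (opXs P) = \sum_j xm j (xm j Q) -> P = 0.
Proof.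
move=> /andP[s_gt0 sm] [bP DP DsP] PQ; have m_gt0 : (0 < m)%N := leq_ltn_trans (leq0n s) sm.
have q_inj u v : \sum_j xm j (xm j u) = \sum_j xm j (xm j v) -> u = v.
  move=> /eqP; rewrite -subr_eq0 -sumrB => /eqP uv; apply/eqP; rewrite -subr_eq0.
  apply/eqP/(sum_xm_inj m_gt0); rewrite -[RHS]uv; apply: eq_bigr => j _.
  by rewrite !linearB.
have XQ : opX Q = 0.
  by apply: q_inj; rewrite -sum_xm_opX -PQ opX_opX big1 // => j _; rewrite !linear0.
have XsQ : opXs Q = - opXs P.
  apply: q_inj; rewrite -sum_xm_opXs -PQ.
  have := xop_xstar_q (opXs P); rewrite opXs_opXs (linear0 (@opX F m M)) add0r => ->.
  by rewrite -sumrN; apply: eq_bigr => j _; rewrite !linearN.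
(* The form x x^* P has bidegree (s, k + 2), and dividing by |x|^2 lowers the degree by 2. *)
have bQ : bihom s k Q.
  have := bieig_opX (bieig_opXs bP); rewrite PQ subrK => -[].
  have qZ c : c *: (\sum_j xm j (xm j Q)) = \sum_j xm j (xm j (c *: Q)).
    by rewrite scaler_sumr; apply: eq_bigr => j _; rewrite !linearZ.
  rewrite sum_xm_eul sum_xm_num !qZ => /q_inj EQ /q_inj NQ; split=> //.
  by rewrite -[LHS](addKr (2%:R *: Q)) EQ -scaleNr -scalerDl; congr (_ *: _); ring.
have eP : (k%:R + s%:R) *: (P + Q) = opXs (opD Q).
  have := opD_opXs_eig (subspaceD (bieig_subspace M _ _) bP bQ).
  rewrite (linearD (@opXs F m M) P) /= XsQ subrr (linear0 (@opD F m M)).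
  rewrite (linearD (@opD F m M) P) /= DP add0r => /esym/eqP.
  by rewrite subr_eq0 => /eqP.
have eQ : (m%:R + k%:R - s%:R) *: Q = opX (opDs Q).
  have := opDs_opX_eig bQ; rewrite XQ (linear0 (@opDs F m M)) => /esym/eqP.
  by rewrite subr_eq0 => /eqP.
have QP : ip Q P = 0.
  have /eqP : ip ((m%:R + k%:R - s%:R) *: Q) P = 0 by rewrite eQ ip_opX DsP ip0r.
  rewrite ipZl mulf_eq0 => /orP[|/eqP//].
  by rewrite subr_eq0 -natrD eqr_nat => /eqP e; move: sm; rewrite -e; lia.
have /eqP : ip ((k%:R + s%:R) *: (P + Q)) P = 0 by rewrite eP ip_opXs DP ip0r.
rewrite ipZl ipDl QP addr0 mulf_eq0 -natrD pnatr_eq0 => /orP[|/eqP/ip_eq0//].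
by rewrite addn_eq0 => /andP[_ /eqP s0]; rewrite s0 in s_gt0.
Qed.

End QuadricMultiples.

(** * Null vectors and orthonormal pairs *)

Section NullVectors.
Variables (F : numClosedFieldType) (n : nat).
Local Notation m := (2 + n)%N.
Local Notation Z0 := (Z0 n).
Local Notation Z1 := (Z1 n).

(** Two reflections: one takes the first unit vector to p, the next takes the image of the second
    unit vector to q. The latter fixes p, which is orthogonal to both vectors that it exchanges. *)
Lemma orthoR_rows (p q : 'rV[F]_m) : realmx p -> realmx q ->
  dotr p p = 1 -> dotr q q = 1 -> dotr p q = 0 ->
  exists A : 'M[F]_m, [/\ orthoR A, row Z0 A = p & row Z1 A = q].
Proof.
move=> rp rq pp qq pq.
have rd i : realmx (delta_mx 0 i : 'rV[F]_m) by apply: map_delta_mx.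
have dd (i j : 'I_m) : dotr (delta_mx 0 i) (delta_mx 0 j : 'rV[F]_m) = (i == j)%:R.
  rewrite dotrE (bigD1 i) //= big1 ?addr0 => [|l /negbTE li]; rewrite !mxE ?eqxx /=.
    by rewrite mul1r.
  by rewrite li mul0r.
have [A1 [[o1 r1] e1 _]] := reflection (rd Z0) rp (etrans (dd Z0 Z0) (esym pp)).
have pres (x y : 'rV[F]_m) : dotr (x *m A1) (y *m A1) = dotr x y.
  by rewrite /dotr trmx_mul mulmxA -[x *m A1 *m _]mulmxA o1 mulmx1.
have rx : realmx ((delta_mx 0 Z1 : 'rV[F]_m) *m A1).
  by rewrite /realmx map_mxM rd r1.
have [|A2 [o2 e2 fix2]] := reflection rx rq.
  by rewrite pres dd eqxx qq.
exists (A1 *m A2); split; first exact: orthoRM.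
  by rewrite rowE mulmxA e1 fix2 // pq -e1 pres dd.
by rewrite rowE mulmxA e2.
Qed.

(** For v = x + 'i y with x and y real, a vanishing sum of squares means that x and y are orthogonal
    of equal length; scaled to length one they become two rows of an orthogonal matrix. *)
Lemma null_vector (v : 'I_m -> F) : \sum_i v i * v i = 0 ->
  exists (A : 'M[F]_m) t, orthoR A /\ forall j, v j = t * (A Z0 j - 'i * A Z1 j).
Proof.
move=> v0; pose x j := 'Re (v j); pose y j := 'Im (v j).
have vE j : v j = x j + 'i * y j by rewrite -Crect.
pose Sx := \sum_j x j * x j; pose Sy := \sum_j y j * y j; pose Sxy := \sum_j x j * y j.
have xr j : x j \is Num.real := Creal_Re _.
have yr j : y j \is Num.real := Creal_Im _.
have Sr : [/\ Sx - Sy \is Num.real & 2 * Sxy \is Num.real].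
  split; last by rewrite rpredM ?realn // rpred_sum // => j _; apply: rpredM.
  by rewrite rpredB ?rpred_sum // => j _; apply: rpredM.
have E : (Sx - Sy) + 'i * (2 * Sxy) = 0.
  rewrite -[RHS]v0 /Sx /Sy /Sxy -sumrB !mulr_sumr -big_split; apply: eq_bigr => j _ /=.
  rewrite vE; transitivity (x j * x j + ('i * 'i) * (y j * y j) + 'i * (2 * (x j * y j))).
    by rewrite mulii; ring.
  by ring.
have [Sr1 Sr2] := Sr.
have xy : Sx = Sy.
  by have := congr1 (fun z => 'Re z) E; rewrite Re_rect // raddf0 => /eqP; rewrite subr_eq0 => /eqP.
have xy0 : Sxy = 0.
  have := congr1 (fun z => 'Im z) E; rewrite Im_rect // raddf0 => /eqP.
  by rewrite mulf_eq0 pnatr_eq0 /= => /eqP.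
have Sx_ge0 : 0 <= Sx by apply: sumr_ge0 => j _; rewrite -expr2 real_exprn_even_ge0.
have [S0|S0] := eqVneq Sx 0.
  have sq0 (z : 'I_m -> F) : (forall j, z j \is Num.real) ->
      \sum_j z j * z j = 0 -> forall j, z j = 0.
    move=> zr /eqP; rewrite psumr_eq0 => [/allP z0 j|j _].
      by have := z0 j (mem_index_enum j); rewrite mulf_eq0 orbb => /eqP.
    by rewrite -expr2 real_exprn_even_ge0.
  exists 1%:M, 0; split; first exact: orthoR1.
  by move=> j; rewrite mul0r vE (sq0 x) // (sq0 y) ?mulr0 ?addr0 // -/Sy -xy.
pose t := sqrtC Sx; have tt : t * t = Sx by rewrite -expr2 sqrtCK.
have t0 : t != 0 by rewrite sqrtC_eq0.
have tr : t^* = t by apply/CrealP/ger0_real; rewrite sqrtC_ge0.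
(* The second row is - y / t because row Z0 of [adjm hmx] is (1, - 'i, 0, ...), so this is the
   combination needed later. *)
have [|||||A [oA rA0 rA1]] := @orthoR_rows (\row_j (x j / t)) (\row_j (- (y j / t))).
- by apply/rowP => j; rewrite !mxE rmorphM fmorphV /= tr (CrealP (xr j)).
- by apply/rowP => j; rewrite !mxE rmorphN rmorphM fmorphV /= tr (CrealP (yr j)).
- rewrite dotrE; transitivity (Sx / (t * t)); last by rewrite tt divff.
  by rewrite mulr_suml; apply: eq_bigr => j _; rewrite !mxE; field.
- rewrite dotrE; transitivity (Sy / (t * t)); last by rewrite tt -xy divff.
  by rewrite mulr_suml; apply: eq_bigr => j _; rewrite !mxE; field.
- rewrite dotrE; transitivity (- Sxy / (t * t)); last by rewrite xy0 oppr0 mul0r.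
  by rewrite mulNr mulr_suml -sumrN; apply: eq_bigr => j _; rewrite !mxE; field.
exists A, t; split=> // j.
have := congr1 (fun r : 'rV_m => r 0 j) rA0; have := congr1 (fun r : 'rV_m => r 0 j) rA1.
by rewrite !mxE => -> ->; rewrite vE; field.
Qed.

End NullVectors.

Local Open Scope classical_set_scope.

(** * Vanishing on the null cone *)

Section NullConeVanishing.
Variables (F : numClosedFieldType) (n : nat).
Local Notation m := (2 + n)%N.
Local Notation M := (form_fock F m).
Local Notation gform := {ffun {set 'I_m} -> {mpoly F[m]}}.
Implicit Types (I K : {set 'I_m}) (A B : 'M[F]_m) (P Q : M) (a : 'X_{1..m}).
Local Notation Z0 := (Z0 n).
Local Notation Z1 := (Z1 n).
Local Notation hmx := (hmx F n).
Local Notation lact := (@lact F m M).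

Lemma tope_bihom k I : bihom #|I| k (tope F k I : M).
Proof.
apply/bihomP => K; split.
  apply/dhomogP => a; rewrite mcoeff_msupp tope_coef.
  case: (K == I) => /=; last by rewrite eqxx.
  have [->|_] := eqVneq a (U_(Z0) *+ k)%MM; last by rewrite eqxx.
  by rewrite mdegMn mdeg1 mul1n.
move=> KI; apply/mpolyP => a; rewrite tope_coef mcoeff0.
by have [eK|] := eqVneq K I; [rewrite eK eqxx in KI|].
Qed.

Lemma gdm_tope j k I : j != Z0 -> gdm j (tope F k I) = 0.
Proof.
move=> j0; apply/ffunP => K; rewrite gdmE gpmE gdxE form_coefE.
case: eqP => _; last by rewrite mulr0 mderiv0.
rewrite mulr1 mderivX mulmnE mnm1E eq_sym (negbTE j0) mul0n.
by rewrite scale0r.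
Qed.

Lemma gew_tope j k I : j \in I -> gew j (tope F k I) = 0.
Proof.
move=> jI; rewrite /tope gew_gpm (_ : gew j _ = 0) ?linear0 //.
apply/ffunP => K; rewrite gewE gdxE form_coefE; case: ifP => // jK.
case: eqP => [/setP/(_ j)|_]; last by rewrite scaler0.
by rewrite !inE eqxx jI.
Qed.

Lemma gec_tope j k I : j \notin I -> gec j (tope F k I) = 0.
Proof.
move=> jI; rewrite /tope gec_gpm (_ : gec j _ = 0) ?linear0 //.
apply/ffunP => K; rewrite gecE gdxE form_coefE; case: ifP => // jK.
case: eqP => [/setP/(_ j)|_]; last by rewrite scaler0.
by rewrite !inE eqxx (negbTE jI).
Qed.

Lemma hmx_gram : hmx^T *m hmx = bmx (mx2 0 2%:R 2%:R 0) 1%:M.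
Proof.
rewrite /hmx bmx_tr bmxM mx2_tr mx2M trmx1 mulmx1 !mulrN !mulNr opprK mulii.
by congr (bmx (mx2 _ _ _ _) _); ring.
Qed.

Lemma bmx_Z0 (x y z t : F) j :
  bmx (mx2 x y z t) (1%:M : 'M_n) Z0 j = if j == Z0 then x else if j == Z1 then y else 0.
Proof.
rewrite -(fintype.splitK j) /bmx; case: (fintype.split j) => [j1|j2] /=.
  rewrite block_mxEul mxE /= !eq_lshift.
  by case: j1 => [[|[|]]].
by rewrite block_mxEur mxE.
Qed.

(** Only the derivative in z acts, and dz is already a factor, so d gives 0. In d^* the Gram matrix
    of [hmx] pairs this derivative only with the contraction at Z1, and Z1 is not in I. *)
Lemma topv_hod k I : Z0 \in I -> Z1 \notin I -> @hod F m M #|I| k (topv F k I).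
Proof.
move=> I0 I1; split.
- by rewrite topvE; apply: lact_bihom; apply: tope_bihom.
- rewrite topvE lact_opD ?hmx_unit // opDE big1 ?linear0 // => j _ /=.
  have [->|j0] := eqVneq j Z0; first by rewrite gew_tope // linear0.
  by rewrite -gew_gdm gdm_tope // linear0.
rewrite topvE opDs_lact big1 ?oppr0 // => i _; rewrite big1 // => j _ /=.
have [->|i0] := eqVneq i Z0; last first.
  by rewrite -gec_gdm gdm_tope // linear0 linear0 scaler0.
have [jI|jI] := boolP (j \in I); last by rewrite gec_tope // !linear0.
rewrite hmx_gram bmx_Z0; case: eqP => [_|_]; first by rewrite scale0r.
by case: eqP => [e|_]; rewrite ?scale0r //; rewrite -e jI in I1.
Qed.

Definition cf d Q K : F := ((Q : gform) K)@_(U_(Z0) *+ d).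

Lemma cf_xm d i Q K : cf d.+1 (xm M i Q) K = if i == Z0 then cf d Q K else 0.
Proof.
rewrite /cf /= gxmE mcoeff_XM mulmnE mnm1E; have [->|_] := eqVneq i Z0.
  rewrite mul1n /=; congr (_ @_ _); apply/mnmP => l.
  by rewrite mnmBE !mulmnE !mnm1E; case: eqP => _; rewrite ?mul0n ?mul1n ?subn0 ?subn1.
by [].
Qed.

Lemma cf_linear d c P Q K : cf d (c *: P + Q) K = c * cf d P K + cf d Q K.
Proof. by rewrite /cf !form_coefE mcoeffD mcoeffZ. Qed.

Lemma cfZ d c Q K : cf d (c *: Q) K = c * cf d Q K.
Proof. by rewrite /cf !form_coefE mcoeffZ. Qed.

Lemma cfN d Q K : cf d (- Q) K = - cf d Q K.
Proof. by rewrite /cf !form_coefE mcoeffN. Qed.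

Lemma cf_sum d (T : Type) (r : seq T) (G : T -> M) K :
  cf d (\sum_(i <- r) G i) K = \sum_(i <- r) cf d (G i) K.
Proof.
apply: (big_morph (fun Q => cf d Q K)) => [P Q|].
  by rewrite -[P]scale1r cf_linear mul1r scale1r.
by rewrite /cf form_coefE mcoeff0.
Qed.

(** Only terms with the factor x_Z0 reach a pure power of x_Z0. For x, row Z0 of B B^T turns this
    into a wedge with dx_Z1; for x^* it leaves the contraction by dx_Z0. So the coefficient at K
    comes from Z0 |: (K :\ Z1), a set covered by the hypothesis. *)
Lemma cf_xxs d B P : (forall l, (B *m B^T) Z0 l = if l == Z1 then 2%:R else 0) ->
  (forall I, Z0 \in I -> Z1 \notin I -> cf d (lact B P) I = 0) ->
  forall K, cf d.+2 (lact B (opX (opXs P))) K = 0.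
Proof.
move=> BB c0 K; rewrite lact_opX_gen cfN cf_sum (@big_only1 _ _ _ _ Z0) //; last first.
  by move=> i /negbTE i0 _; rewrite cf_sum big1 // => l _; rewrite cfZ cf_xm i0 mulr0.
rewrite cf_sum (@big_only1 _ _ _ _ Z1) //; last first.
  by move=> l /negbTE l1 _; rewrite cfZ BB l1 mul0r.
rewrite cfZ cf_xm eqxx -lact_opXs /cf /= gewE; case: ifPn => K1; last first.
  by rewrite mcoeff0 mulr0 oppr0.
rewrite mcoeffZ -/(cf d.+1 (opXs (lact B P)) (K :\ Z1)) opXsE cf_sum.
rewrite (@big_only1 _ _ _ _ Z0) //; last by move=> i /negbTE i0 _; rewrite cf_xm i0.
rewrite cf_xm eqxx /cf /= gecE; case: ifPn => K0.
  by rewrite mcoeff0 !mulr0 oppr0.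
rewrite mcoeffZ -/(cf d (lact B P) (Z0 |: (K :\ Z1))) c0 ?mulr0 ?oppr0 //.
  by rewrite !inE eqxx.
by rewrite !inE eqxx.
Qed.

Definition e0 : 'I_m -> F := fun i => (i == Z0)%:R.

Lemma homog_eval_e0 d (p : {mpoly F[m]}) :
  p \is d.-homog -> p.@[e0] = p@_(U_(Z0) *+ d).
Proof.
move=> hp; rewrite mevalE.
have prod_e0 (a : 'X_{1..m}) : a \in msupp p ->
    \prod_i e0 i ^+ a i = (a == (U_(Z0) *+ d)%MM)%:R.
  move=> pa; have da : mdeg a = d := dhomog_mf hp pa.
  have [/forallP a0|] := boolP [forall i, (i != Z0) ==> (a i == 0%N)].
    have -> : a = (U_(Z0) *+ d)%MM.
      apply/mnmP => i; rewrite mulmnE mnm1E; have [<-|i0] := eqVneq Z0 i.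
        rewrite mul1n -da mdegE (bigD1 Z0) //= big1 ?addn0 // => l l0.
        by have := a0 l; rewrite l0 => /eqP.
      by rewrite mul0n; have := a0 i; rewrite eq_sym i0 => /eqP.
    rewrite eqxx big1 // => i _; rewrite mulmnE mnm1E /e0 eq_sym; case: eqP => _.
      by rewrite expr1n.
    by rewrite mul0n expr0.
  rewrite negb_forall => /existsP[l]; rewrite negb_imply => /andP[l0 al].
  rewrite (bigD1 l) //= /e0 (negbTE l0) expr0n (negbTE al) mul0r.
  case: eqP => // ea; move: al; rewrite ea mulmnE mnm1E [Z0 == l]eq_sym (negbTE l0).
  by rewrite mul0n.
rewrite big_seq (eq_bigr (fun a => p@_a * (a == (U_(Z0) *+ d)%MM)%:R)) => [|a pa]; last first.
  by rewrite prod_e0.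
rewrite -big_seq; have [pd|pd] := boolP ((U_(Z0) *+ d)%MM \in msupp p).
  rewrite (bigD1_seq _ pd) ?msupp_uniq //= eqxx mulr1 big1 ?addr0 // => a /negbTE->.
  by rewrite mulr0.
rewrite (memN_msupp_eq0 pd) big_seq big1 // => a pa.
by case: eqP => [ea|_]; rewrite ?mulr0 //; rewrite -ea pa in pd.
Qed.

Definition const_at (b : 'I_m -> F) Q : M :=
  \sum_I gpm (((Q : gform) I).@[b])%:MP (gdx F I).

Lemma const_atE b Q I : (const_at b Q : gform) I = (((Q : gform) I).@[b])%:MP.
Proof.
rewrite sum_ffunE (bigD1 I) //= big1 ?addr0 => [|K /negbTE nK].
  by rewrite gpmE gdxE eqxx mulr1.
by rewrite gpmE gdxE eq_sym nK mulr0.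
Qed.

(** Evaluating at [e0] after the substitution B means evaluating at row Z0 of B before it. Freezing
    the coefficients of Q at that row therefore gives a constant form killed by the invertible
    [lact B]. *)
Lemma const_at_vanish s d B Q : B \in unitmx -> bihom s d Q ->
  (forall K, cf d (lact B Q) K = 0) ->
  forall I, ((Q : gform) I).@[B Z0] = 0.
Proof.
move=> uB bQ c0 I.
pose Qb := const_at (B Z0) Q.
have bQb : bihom s 0 Qb.
  apply/bihomP => K; rewrite const_atE; split.
    by rewrite -[_%:MP]mulr1 mul_mpolyC dhomogZ // dhomog1.
  by case: ((bihomP s d Q).1 bQ K) => _ h /h->; rewrite meval0 mpolyC0.
have eval_eq K : ((lact B Qb : gform) K).@[e0] = ((lact B Q : gform) K).@[e0].
  rewrite /= /glact !sum_ffunE !raddf_sum; apply: eq_bigr => J _ /=.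
  rewrite !gpmE !mevalM const_atE; congr (_ * _).
  rewrite /gsub comp_mpolyC mevalC comp_mpoly_meval; apply: meval_eq => j.
  rewrite tnth_mktuple raddf_sum (bigD1 Z0) //= big1 ?addr0 => [|i i0].
    by rewrite mevalZ mevalXU /e0 eqxx mulr1.
  by rewrite mevalZ mevalXU /e0 (negbTE i0) mulr0.
have LQb : lact B Qb = 0.
  apply/ffunP => K; apply/mpolyP => a; rewrite form_coefE mcoeff0.
  have [hk _] := (bihomP s 0 _).1 (lact_bihom B bQb) K.
  apply/eqP; rewrite -[_ == 0]negbK -mcoeff_msupp; apply/negP => pa.
  have /eqP : mdeg a = 0%N := dhomog_mf hk pa; rewrite mdeg_eq0 => /eqP a0.
  move: pa; rewrite mcoeff_msupp a0 -[0%MM](mulm0n U_(Z0)) -(homog_eval_e0 hk) eval_eq.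
  have [hd _] := (bihomP s d _).1 (lact_bihom B bQ) K.
  by rewrite (homog_eval_e0 hd) [_@_ _]c0 eqxx.
have : Qb = 0 by rewrite -(lact1 Qb) -(mulVmx uB) lact_mul LQb linear0.
move=> /(congr1 (fun P : gform => (P I)@_0%MM)).
by rewrite const_atE form_coefE mcoeff0 mcoeffC eqxx mulr1.
Qed.

Lemma meval_scale d (p : {mpoly F[m]}) t (v : 'I_m -> F) :
  p \is d.-homog -> p.@[fun i => t * v i] = t ^+ d * p.@[v].
Proof.
move=> hp; rewrite !mevalE mulr_sumr big_seq [RHS]big_seq; apply: eq_bigr => a pa.
under eq_bigr do rewrite exprMn.
have da : mdeg a = d := dhomog_mf hp pa.
rewrite big_split /= prodrXr -mdegE da.
by rewrite mulrCA.
Qed.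

(* opX (opXs P) vanishes on the null cone, hence is a multiple of |x|^2. *)
Lemma top_nonvanishing s k P : (0 < s < m)%N -> @hod F m M s k P ->
  (forall A I, orthoR A -> Z0 \in I -> Z1 \notin I -> #|I| = s ->
     ip (topv F k I) (lact A P) = 0) -> P = 0.
Proof.
move=> sm HP vP; have [bP _ _] := HP.
pose Y := opX (opXs P); have bY : bihom s k.+2 Y.
  have := bieig_opX (bieig_opXs bP); rewrite subrK.
  by rewrite /bihom -[k.+2]addn2 natrD -addrA.
have adjU : adjm hmx \in unitmx.
  by rewrite /adjm map_unitmx unitmx_tr hmx_unit.
have vanish A I : orthoR A -> ((Y : gform) I).@[(adjm hmx *m A) Z0] = 0.
  move=> oA; have AU : A \in unitmx by case: oA => /mulmx1_unit[].
  apply: (const_at_vanish _ bY); first by rewrite unitmx_mul adjU AU.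
  apply: cf_xxs => [l|J J0 J1].
    rewrite trmx_mul mulmxA -[_ *m A *m _]mulmxA oA.1 mulmx1 /adjm /hmx.
    rewrite bmx_tr trmx1 !bmx_conj mx2_tr bmx_tr map_mx1 trmx1 !mx2_conj mx2_tr bmxM mulmx1.
    rewrite mx2M bmx_Z0 !(conjC1, conjCi, rmorphN1) /= ?rmorphN /= ?conjCi.
    case: eqP => [->|_]; first by rewrite mulNr mulrN !opprK mulii mulr1 subrr.
    by case: eqP => // _; rewrite mulr1 ?mulNr ?mulrN ?opprK mulii ?opprK.
  rewrite lact_mul; have [sJ|sJ] := eqVneq #|J| s; last first.
    have [_ h] := (bihomP s k _).1 (lact_bihom (adjm hmx) (lact_bihom A bP)) J.
    by rewrite /cf h // mcoeff0.
  (* By adjunction, pairing with [topv] extracts the pure-power coefficient of P after the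
     substitution [adjm hmx *m A], up to conjugation and a nonzero factorial. *)
  have := vP A J oA J0 J1 sJ; rewrite topvE ip_lact => /ip_sym0.
  rewrite /= /gip (bigD1 J) //= big1 ?addr0 => [|K nK]; last first.
    rewrite gpmE gdxE (negbTE nK) mulr0; exact: mdot0r.
  rewrite gpmE gdxE eqxx mulr1 => /eqP; rewrite mdot_conj mdotX conjC_eq0 mulf_eq0.
  rewrite conjC_eq0 pnatr_eq0 => /orP[/eqP //|].
  by rewrite -leqn0 leqNgt prodn_gt0 // => i; rewrite fact_gt0.
have /choice[q qP] : forall I, exists q, (Y : gform) I = (\sum_i 'X_i * 'X_i) * q.
  move=> I; apply: (@quadric_dvd _ _ Z0 Z1) => // v v0.
  have [A [t [oA vE]]] := null_vector v0.
  have [hY _] := (bihomP s k.+2 Y).1 bY I.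
  rewrite (meval_eq (v2 := fun i => t * (adjm hmx *m A) Z0 i)); last first.
    move=> j; rewrite vE; congr (_ * _).
    rewrite mxE big_split_ord /= !big_ord_recl big_ord0 addr0.
    rewrite [X in _ = _ + X]big1 ?addr0 => [|l _]; last first.
      by rewrite /adjm /hmx bmx_tr trmx1 bmx_conj map_mx1 /bmx block_mxEur mxE mul0r.
    rewrite /adjm /hmx bmx_tr trmx1 bmx_conj map_mx1 /bmx !block_mxEul mx2_tr mx2_conj !mxE /=.
    by rewrite conjC1 conjCi mul1r mulNr; congr (A _ _ - 'i * A _ _); apply/val_inj.
  by rewrite (meval_scale t _ hY) vanish // mulr0.
apply: (@hod_xxs_multiple _ _ M s k P [ffun I : {set 'I_m} => q I]) => //.
apply/ffunP => I; rewrite [LHS]qP sum_ffunE mulr_suml; apply: eq_bigr => j _.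
by rewrite /= !gxmE ffunE mulrA.
Qed.

End NullConeVanishing.

(** * Irreducibility and inequivalence *)

Lemma exists_subset_card (T : finType) (A : {set T}) k : (k <= #|A|)%N ->
  exists2 J : {set T}, J \subset A & #|J| = k.
Proof.
move=> kA; exists [set x in take k (enum A)]%SET.
  by apply/fintype.subsetP => x; rewrite inE => /mem_take; rewrite mem_enum.
rewrite cardsE (card_uniqP _) ?take_uniq ?enum_uniq //.
by rewrite size_take -cardE; case: ltngtP kA.
Qed.

Section OrthogonalGroup.
Variables (F : numClosedFieldType) (m : nat).
Implicit Types (A : 'M[F]_m).

Lemma adjm_orthoR A : orthoR A -> adjm A = A^T.
Proof. by case=> _ rA; rewrite /adjm -map_trmx rA. Qed.

Lemma orthoR_tr A : orthoR A -> orthoR A^T.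
Proof.
case=> oA rA; split; first by rewrite trmxK; apply: mulmx1C.
by rewrite /realmx -map_trmx rA.
Qed.

Definition signmx (l : 'I_m) : 'M[F]_m := diag_mx (\row_i (-1) ^+ (i == l)).

Lemma signmx_orthoR l : orthoR (signmx l).
Proof.
split; last first.
  by apply/matrixP => i j; rewrite !mxE rmorphMn rmorphXn rmorphN1.
rewrite tr_diag_mx; apply/matrixP => i j; rewrite mul_diag_mx !mxE.
by rewrite mulrnAr -expr2 sqrr_sign.
Qed.

End OrthogonalGroup.

Section Irreducibility.
Variables (F : numClosedFieldType) (m : nat).
Local Notation M := (form_fock F m).
Local Notation gform := {ffun {set 'I_m} -> {mpoly F[m]}}.
Local Notation lact := (@lact F m M).
Local Notation ip := (@ip F m M).
Local Notation hod := (@hod F m M).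
Variables (T : Type) (G : set T) (rho : T -> M -> M) (toM : T -> 'M[F]_m).
Hypothesis rhoE : forall g, G g -> forall u, rho g u = lact (toM g) u.
Hypothesis toM_orthoR : forall g, G g -> orthoR (toM g).
Hypothesis toM_surj : forall A, orthoR A -> exists2 g, G g & toM g = A.
Implicit Types (W : set M) (u v P Q : M).

Lemma submodule_lact W A u : submodule G rho W -> orthoR A -> W u -> W (lact A u).
Proof. by move=> [_ Wg] /toM_surj[g Gg <-] Wu; rewrite -rhoE //; apply: Wg. Qed.

Lemma hod_submoduleR s k : submodule G rho (hod s k).
Proof. by apply: (hod_submodule rhoE) => g /toM_orthoR[]. Qed.

(** The vector A u - c u lies in W. It is also c (v - u) - A (v - u), and both terms are orthogonal
    to W because W is stable under the adjoint of A. *)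
Lemma projection_eig W v u A c : submodule G rho W -> orthoR A -> W u ->
  (forall y, W y -> ip (v - u) y = 0) -> lact A v = c *: v -> lact A u = c *: u.
Proof.
move=> sW oA Wu uP Av; have [[W0 WP] _] := sW.
have WAu := submodule_lact sW oA Wu.
have Wd : W (lact A u - c *: u).
  by apply: subspaceD sW.1 _ _ => //; apply: subspaceN sW.1 _; apply: subspaceZ sW.1 _.
apply/eqP; rewrite -subr_eq0; apply/eqP/ip_eq0.
set d := lact A u - c *: u in Wd *.
have -> : ip d d = ip (c *: (v - u)) d - ip (lact A (v - u)) d.
  rewrite -ipBl (linearB (lact A)) Av scalerBr; congr (ip _ d).
  by rewrite opprB [RHS]addrC addrA subrK.
rewrite ipZl uP // mulr0 ip_lact uP ?subr0 //.
by rewrite adjm_orthoR //; apply: submodule_lact => //; apply: orthoR_tr.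
Qed.

Lemma line_irreducible s k (e : M) : hod s k e -> e <> 0 ->
  (forall u, hod s k u -> exists c, u = c *: e) -> irreducible G rho (hod s k).
Proof.
move=> He e0 line; split; first exact: hod_submoduleR.
  by move=> H0; apply: e0; move: He; rewrite H0.
move=> W [[W0 WP] _] WH; have [Wz|] := pselect (forall u, W u -> u = 0).
  by left; apply/seteqP; split=> [u /Wz//|_ ->].
move=> /existsNP[u /not_implyP[Wu /eqP u0]]; right; apply/seteqP; split=> // w Hw.
have [c ue] := line _ (WH _ Wu); have [d ->] := line _ Hw.
have c0 : c != 0 by apply: contraNneq u0 => c0; rewrite ue c0 scale0r.
have -> : d *: e = (d / c) *: u + 0 by rewrite addr0 ue scalerA divfK.
exact: WP.
Qed.

Lemma hod_bottom u : hod 0 0 u -> exists c, u = c *: (vac M).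
Proof.
case=> /bihomP bu _ _; exists (((u : gform) finset.set0)@_0%MM).
apply/ffunP => K; rewrite form_coefE gdxE; have [hk hs] := bu K.
have [->|K0] := eqVneq K finset.set0; last first.
  by rewrite scaler0; apply: hs; rewrite cards_eq0.
apply/mpolyP => a; rewrite mcoeffZ mcoeff1; have [->|a0] := eqVneq a 0%MM.
  by rewrite mulr1.
rewrite mulr0; have [h0 _] := bu finset.set0.
apply/eqP; rewrite -[_ == 0]negbK -mcoeff_msupp; apply/negP => pa.
have /eqP : mdeg a = 0%N := dhomog_mf h0 pa.
by rewrite mdeg_eq0 (negbTE a0).
Qed.

Lemma hod_top u : hod m 0 u -> exists c, u = c *: (gdx F [set: 'I_m]%SET : M).
Proof.
case=> /bihomP bu _ _; exists (((u : gform) [set: 'I_m]%SET)@_0%MM).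
apply/ffunP => K; rewrite form_coefE gdxE; have [hk hs] := bu K.
have [->|K0] := eqVneq K [set: 'I_m]%SET; last first.
  rewrite scaler0; apply: hs; rewrite -[X in _ != X]card_ord -cardsT.
  by apply: contra K0 => /eqP cK; rewrite eqEcard finset.subsetT cK leqnn.
apply/mpolyP => a; rewrite mcoeffZ mcoeff1; have [->|a0] := eqVneq a 0%MM.
  by rewrite mulr1.
rewrite mulr0; have [h0 _] := bu [set: 'I_m]%SET.
apply/eqP; rewrite -[_ == 0]negbK -mcoeff_msupp; apply/negP => pa.
have /eqP : mdeg a = 0%N := dhomog_mf h0 pa.
by rewrite mdeg_eq0 (negbTE a0).
Qed.

Lemma gdx_hod I : (I == finset.set0) || (I == [set: 'I_m]%SET) -> hod #|I| 0 (gdx F I).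
Proof.
move=> IE; have bI : bihom #|I| 0 (gdx F I : M).
  apply/bihomP => K; rewrite gdxE; split; first by case: eqP; rewrite ?dhomog1 ?dhomog0.
  by have [->|] := eqVneq K I; rewrite ?eqxx.
split=> //; first by apply: bieig_neg (bieig_opD bI); left; rewrite sub0r.
by apply: bieig_neg (bieig_opDs bI); left; rewrite sub0r.
Qed.

Lemma gdx_neq0 I : (gdx F I : M) <> 0.
Proof.
move=> /(congr1 (fun P : gform => (P I)@_0%MM)); rewrite gdxE form_coefE eqxx mcoeff0.
by rewrite mcoeff1 eqxx => /eqP; rewrite oner_eq0.
Qed.

Lemma bottom_irreducible : irreducible G rho (hod 0 0).
Proof.
have := gdx_hod (I := finset.set0); rewrite eqxx cards0 => /(_ isT) H.
by apply: line_irreducible H (@gdx_neq0 _) _; apply: hod_bottom.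
Qed.

Lemma top_irreducible : irreducible G rho (hod m 0).
Proof.
have := gdx_hod (I := [set: 'I_m]%SET); rewrite eqxx orbT cardsT card_ord => /(_ isT) H.
by apply: line_irreducible H (@gdx_neq0 _) _; apply: hod_top.
Qed.

Lemma signmx_gdx l I : lact (signmx F l) (gdx F I) = (-1) ^+ (l \in I) *: (gdx F I : M).
Proof.
have dS : is_diag_mx (signmx F l) by apply: diag_mx_is_diag.
apply/ffunP => K; apply/mpolyP => a; rewrite diag_coef // form_coefE mcoeffZ gdxE.
have [->|_] := eqVneq K I; last by rewrite !mcoeff0 !mulr0.
rewrite mcoeff1; have [->|_] := eqVneq a 0%MM; last by rewrite !mulr0.
rewrite !mulr1 /weight (bigD1 l) //= big1 ?mulr1 => [|j /negbTE jl].
  by rewrite !mxE !eqxx mulr1n expr1 mnm0E.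
by rewrite !mxE eqxx jl mulr1n expr0 expr1n.
Qed.

Lemma intertwines_lact W (f : M -> M) A u : intertwines G rho W f -> orthoR A ->
  submodule G rho W -> W u -> f (lact A u) = lact A (f u).
Proof. by move=> [_ fg] /toM_surj[g Gg <-] sW Wu; rewrite -!rhoE // fg. Qed.

(* A reflection acts trivially on constants and by -1 on the volume form. *)
Lemma bottom_top_inequiv : (0 < m)%N -> ~ equivalent G rho (hod 0 0) (hod m 0).
Proof.
move=> m_gt0 [f [[fU finj _] fl fg]].
have fi : intertwines G rho (hod 0 0) f by split.
have := gdx_hod (I := finset.set0); rewrite eqxx cards0 => /(_ isT) H.
pose l := Ordinal m_gt0.
have := intertwines_lact fi (signmx_orthoR F l) (hod_submoduleR 0 0) H.
rewrite signmx_gdx inE expr0 scale1r.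
have [c fE] := hod_top (fU _ H); rewrite fE linearZ /= signmx_gdx inE expr1 scaleN1r scalerN.
move=> /(@eq_opp0 _ _ M) cz; apply: (@gdx_neq0 finset.set0); apply: finj.
- by rewrite inE.
- by rewrite inE; case: (hod_subspace M 0 0).
by rewrite fE cz (intertwines0 (hod_subspace M 0 0) fi).
Qed.

End Irreducibility.

(** * The Hodge spaces with 0 < s < m *)

Section GenericIrreducibility.
Variables (F : numClosedFieldType) (n : nat).
Local Notation m := (2 + n)%N.
Local Notation M := (form_fock F m).
Local Notation gform := {ffun {set 'I_m} -> {mpoly F[m]}}.
Local Notation lact := (@lact F m M).
Local Notation ip := (@ip F m M).
Local Notation hod := (@hod F m M).
Local Notation Z0 := (Z0 n).
Local Notation Z1 := (Z1 n).
Local Notation topv := (@topv F n).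
Local Notation tope := (@tope F n).
Variables (T : Type) (G : set T) (rho : T -> M -> M) (toM : T -> 'M[F]_m).
Hypothesis rhoE : forall g, G g -> forall u, rho g u = lact (toM g) u.
Hypothesis toM_orthoR : forall g, G g -> orthoR (toM g).
Hypothesis toM_surj : forall A, orthoR A -> exists2 g, G g & toM g = A.
Implicit Types (W : set M) (u v P Q : M) (I J : {set 'I_m}).

Lemma tope_gxm k I : tope k.+1 I = gxm Z0 (tope k I).
Proof. by rewrite /tope /gxm gpmA -mpolyXD mulmS. Qed.

(** The hypotheses say that column Z0 and the columns in I are standard unit vectors, in the shape
    in which [lact_xm] and [lact_ew] produce the sums. *)
Lemma lact_fix (A : 'M[F]_m) k I :
  (forall (V : lmodType F) (g : 'I_m -> V), \sum_i A i Z0 *: g i = g Z0) ->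
  (forall l (V : lmodType F) (g : 'I_m -> V), l \in I -> \sum_i A i l *: g i = g l) ->
  lact A (tope k I : M) = tope k I.
Proof.
move=> A0 AI; elim: k => [|k IHk]; last first.
  by rewrite tope_gxm [LHS](@lact_xm _ _ M) A0 IHk.
rewrite /tope mulm0n mpolyX0 gpm1l.
have [k] := ubnP #|I|; elim: k I AI => // k IHk I AI.
have [->|[j jI]] := set_0Vmem I; first by rewrite [LHS](@lact_vac _ _ M).
rewrite (cardsD1 j) jI ltnS => Ik.
rewrite (gdx_gew _ jI) [LHS]linearZ; congr (_ *: _).
rewrite [LHS](@lact_ew _ _ M) AI // IHk // => l V g; rewrite !inE => /andP[_].
exact: AI.
Qed.

Lemma tmx_sum (i j l : 'I_n) (V : lmodType F) (g : 'I_m -> V) :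
  \sum_r tmx F i j r (rshift 2 l) *: g r = g (rshift 2 (tperm i j l)).
Proof.
rewrite big_split_ord /= big1 ?add0r => [|r _]; last first.
  by rewrite /tmx /bmx block_mxEur mxE scale0r.
rewrite (bigD1 (tperm i j l)) //= big1 ?addr0 => [|r /negbTE rl].
  by rewrite /tmx /bmx block_mxEdr !mxE tpermK eqxx scale1r.
rewrite /tmx /bmx block_mxEdr !mxE; case: eqP => [e|_]; last by rewrite scale0r.
by rewrite -e tpermK eqxx in rl.
Qed.

Lemma tmx_sum0 (i j : 'I_n) (V : lmodType F) (g : 'I_m -> V) (l : 'I_2) :
  \sum_r tmx F i j r (lshift n l) *: g r = g (lshift n l).
Proof.
rewrite big_split_ord /= [X in _ + X]big1 ?addr0 => [|r _]; last first.
  by rewrite /tmx /bmx block_mxEdl mxE scale0r.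
rewrite (bigD1 l) //= big1 ?addr0 => [|r /negbTE rl].
  by rewrite /tmx /bmx block_mxEul !mxE eqxx scale1r.
by rewrite /tmx /bmx block_mxEul !mxE rl scale0r.
Qed.

(** The transposition commutes with [hmx], as it moves only the other coordinates. Pulling dx_i to
    the front, renaming it dx_j and sorting it back in gives the two signs in [c]. *)
Lemma tmx_topv (i j : 'I_n) k I : Z0 \in I -> Z1 \notin I ->
  rshift 2 i \in I -> rshift 2 j \notin I ->
  exists2 c, c != 0 & lact (tmx F i j) (topv k I) =
    c *: topv k (rshift 2 j |: (I :\ rshift 2 i)).
Proof.
move=> I0 I1 iI jI; set J := rshift 2 j |: _.
have jJ : rshift 2 j \in J by rewrite !inE eqxx.
have L : J :\ rshift 2 j = I :\ rshift 2 i by rewrite setU1K // !inE negb_and jI orbT.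
pose c := (-1) ^+ pos (rshift 2 i) I * (-1) ^+ pos (rshift 2 j) J : F.
exists c; first by rewrite mulf_neq0 ?signr_eq0.
rewrite !topvE -lact_mul tmx_hmx lact_mul -[RHS]linearZ; congr (lact _ _).
have topeE x (K : {set 'I_m}) : x \in K ->
    tope k K = (-1) ^+ pos x K *: gew x (tope k (K :\ x)) :> gform.
  by move=> xK; rewrite gew_gpm -linearZ -gdx_gew.
rewrite (topeE _ _ iI) (topeE _ _ jJ) L [LHS]linearZ scalerA /c -mulrA -expr2 sqrr_sign mulr1.
congr (_ *: _); rewrite [LHS](@lact_ew _ _ M) tmx_sum tpermL lact_fix //.
  by move=> V g; apply: tmx_sum0.
move=> l V g; rewrite -(fintype.splitK l); case: (fintype.split l) => [l1|l2] /=.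
  by move=> _; apply: tmx_sum0.
rewrite tmx_sum !inE eq_rshift => /andP[li lI]; rewrite tpermD // eq_sym //.
by apply: contraNneq jI => <-.
Qed.

Lemma rshift_ex (x : 'I_m) : x != Z0 -> x != Z1 -> exists l, x = rshift 2 l.
Proof.
rewrite -(fintype.splitK x); case: (fintype.split x) => [l|l] /=; last by exists l.
by case: l => [[|[|]]] // ?; rewrite -!val_eqE.
Qed.

Definition perp W k I := forall P, W P -> ip (topv k I) P = 0.

Lemma perp_swap W k I (i j : 'I_n) : submodule G rho W -> Z0 \in I -> Z1 \notin I ->
  rshift 2 i \in I -> rshift 2 j \notin I ->
  perp W k I -> perp W k (rshift 2 j |: (I :\ rshift 2 i)).
Proof.
move=> sW I0 I1 iI jI pI P WP; have [c c0 cE] := tmx_topv k I0 I1 iI jI.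
have oT := tmx_orthoR F i j.
apply: (mulfI c0); rewrite mulr0 -ipZl -cE ip_lact; apply: pI.
rewrite adjm_orthoR //; apply: (submodule_lact rhoE toM_surj sW) => //.
exact: orthoR_tr.
Qed.

(** Elements are exchanged one at a time. Z0 lies in both sets and Z1 in neither, so the exchanged
    indices are among the last n coordinates and a transposition is available. *)
Lemma perp_all W k I J : submodule G rho W -> Z0 \in I -> Z1 \notin I ->
  Z0 \in J -> Z1 \notin J -> #|J| = #|I| -> perp W k I -> perp W k J.
Proof.
move=> sW I0 I1 J0 J1 JI pI.
have [d] := ubnP #|J :\: I|; elim: d J J0 J1 JI => // d IHd J J0 J1 JI.
have [JI0|[x]] := set_0Vmem (J :\: I).
  have /eqP -> // : J == I.
  by rewrite eqEcard JI leqnn andbT -finset.setD_eq0 JI0.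
rewrite !inE => /andP[xI xJ]; rewrite ltnS => cd.
have [IJ0|[y]] := set_0Vmem (I :\: J).
  have IJ : I == J by rewrite eqEcard JI leqnn andbT -finset.setD_eq0 IJ0.
  by rewrite (eqP IJ) xJ in xI.
rewrite !inE => /andP[yJ yI].
have [i xE] : exists l, x = rshift 2 l.
  by apply: rshift_ex; [apply: contraNneq xI => ->|apply: contraTneq xJ => ->].
have [j yE] : exists l, y = rshift 2 l.
  by apply: rshift_ex; [apply: contraNneq yJ => ->|apply: contraTneq yI => ->].
(* K is one exchange closer to I; exchanging y for x in K leads back to J. *)
pose K := y |: (J :\ x).
have yx : y != x by apply: contraNneq yJ => ->.
have K0 : Z0 \in K by rewrite !inE J0 andbT (_ : Z0 != x) ?orbT //; apply: contraNneq xI => <-.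
have K1 : Z1 \notin K.
  rewrite !inE (negbTE J1) andbF orbF; by apply: contraNneq I1 => ->.
have cK : #|K| = #|I|.
  by rewrite cardsU1 !inE (negbTE yJ) andbF /= -JI (cardsD1 x J) xJ.
have KI : K :\: I = (J :\: I) :\ x.
  apply/setP => z; rewrite !inE; have [->|_] := eqVneq z y; last by case: (z == x); rewrite ?andbF.
  by rewrite yI (negbTE yJ) !andbF.
have pK : perp W k K.
  apply: IHd => //; apply: leq_trans cd.
  by rewrite KI [X in (_ < X)%N](cardsD1 x) !inE xI xJ.
have -> : J = x |: (K :\ y).
  by rewrite setU1K ?finset.setD1K // !inE negb_and yJ orbT.
rewrite xE yE; apply: perp_swap => //; rewrite -?xE -?yE.
  by rewrite !inE eqxx.
by rewrite !inE negb_or eq_sym yx eqxx.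
Qed.

Lemma perp_zero W s k I : (0 < s < m)%N -> submodule G rho W -> W `<=` hod s k ->
  Z0 \in I -> Z1 \notin I -> #|I| = s -> perp W k I -> W `<=` [set 0].
Proof.
move=> sm sW WH I0 I1 Is pI P WP /=.
apply: (top_nonvanishing sm (WH _ WP)) => A J oA J0 J1 Js.
apply: (perp_all sW I0 I1 J0 J1 _ pI); first by rewrite Js Is.
exact: (submodule_lact rhoE toM_surj sW).
Qed.

Lemma topv_neq0 k I : topv k I <> 0.
Proof.
move=> v0; have : tope k I = 0 :> M.
  by rewrite -(lact1 (tope k I : M)) -(mulVmx (hmx_unit F n)) lact_mul -topvE v0 linear0.
move=> /(congr1 (fun P : gform => (P I)@_(U_(Z0) *+ k))).
by rewrite tope_coef form_coefE !eqxx mcoeff0 => /eqP; rewrite oner_eq0.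
Qed.

Lemma joint_transfer (W : set M) k I v u : submodule G rho W -> W u ->
  (forall y, W y -> ip (v - u) y = 0) -> joint k I v -> joint k I u.
Proof.
move=> sW Wu uP [JR JN]; split=> [|l].
  exact: (projection_eig rhoE toM_surj sW (rmx_orthoR F n) Wu uP JR).
exact: (projection_eig rhoE toM_surj sW (nmx_orthoR F l) Wu uP (JN l)).
Qed.

Lemma top_dichotomy W s k I : submodule G rho W -> W `<=` hod s k ->
  Z0 \in I -> Z1 \notin I -> W (topv k I) \/ perp W k I.
Proof.
move=> sW WH I0 I1.
have Wb : W `<=` bihom s k by move=> u /WH[].
have [u Wu uP] := bihom_projection (@form_fin F m) sW.1 Wb (topv k I).
have ju := joint_transfer sW Wu uP (joint_top F k I0 I1).
have [c [uc _]] := joint_unique I0 I1 (Wb _ Wu) (leqnn k) ju.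
(* Here c v_I is the projection of v_I onto W: if c is 0, v_I is orthogonal to W, otherwise v_I is a
   multiple of a vector of W. *)
have [c0|c0] := eqVneq c 0; [right|left].
  by move=> P WP; have := uP _ WP; rewrite uc c0 scale0r subr0.
have -> : topv k I = c^-1 *: u by rewrite uc scalerA mulVf // scale1r.
exact: subspaceZ sW.1 Wu.
Qed.

Lemma exists_top_set s : (0 < s < m)%N ->
  exists I, [/\ Z0 \in I, Z1 \notin I & #|I| = s].
Proof.
move=> /andP[s_gt0 sm]; have [|J JA Js] := @exists_subset_card _ (~: [set Z0; Z1]%SET) s.-1.
  by rewrite cardsC1 || rewrite cardsCs finset.setCK cards2 Z01 card_ord; lia.
have ZJ z : z \in [set Z0; Z1]%SET -> z \notin J.
  by move=> zZ; apply/negP => /(fintype.subsetP JA); rewrite finset.in_setC zZ.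
exists (Z0 |: J); split.
- by rewrite !inE eqxx.
- by rewrite !inE negb_or ZJ ?inE ?eqxx ?orbT // eq_sym Z01.
by rewrite cardsU1 ZJ ?inE ?eqxx // Js add1n prednK.
Qed.

Lemma generic_irreducible s k : (0 < s < m)%N -> irreducible G rho (hod s k).
Proof.
move=> sm; have [I [I0 I1 Is]] := exists_top_set sm.
have sH : submodule G rho (hod s k) := hod_submoduleR rhoE toM_orthoR s k.
have Hv : hod s k (topv k I) by rewrite -Is; apply: topv_hod.
split=> //.
  by move=> H0; apply: (@topv_neq0 k I); move: Hv; rewrite H0.
move=> W sW WH; have [Wv|pW] := top_dichotomy sW WH I0 I1; last first.
  left; apply/seteqP; split; first exact: (perp_zero sm sW WH I0 I1 Is pW).
  by move=> _ ->; case: sW => -[].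
right; apply/seteqP; split=> // h Hh.
(* The complement of W in the Hodge space is invariant too. It is orthogonal to v_I, which lies in
   W, so it is zero. *)
pose W' : set M := [set u | hod s k u /\ forall y, W y -> ip u y = 0].
have sW' : submodule G rho W'.
  split.
    split; first by split; [case: (hod_subspace M s k)|move=> y _; rewrite ip0l].
    move=> a u v [Hu uW] [Hv' vW]; split; first by case: (hod_subspace M s k) => _; apply.
    by move=> y Wy; rewrite ip_linear uW // vW // mulr0 addr0.
  move=> g u Gg [Hu uW]; split; first exact: sH.2.
  move=> y Wy; rewrite rhoE // ip_lact uW // adjm_orthoR; last exact: toM_orthoR.
  by apply: (submodule_lact rhoE toM_surj sW) => //; apply/orthoR_tr/toM_orthoR.
have W'0 : W' `<=` [set 0].
  have W'H : W' `<=` hod s k by move=> u [].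
  have pW' : perp W' k I by move=> u [_ uW]; apply: (ip_sym0 (uW _ Wv)).
  exact: (perp_zero sm sW' W'H I0 I1 Is pW').
have Wb : W `<=` bihom s k by move=> u /WH[].
have [u Wu uP] := bihom_projection (@form_fin F m) sW.1 Wb h.
have : W' (h - u).
  split=> //; apply: subspaceD (hod_subspace M s k) _ _ => //.
  by apply: subspaceN (hod_subspace M s k) _; apply: WH.
by move=> /W'0 /= /eqP; rewrite subr_eq0 => /eqP->.
Qed.

(** The image of v_I is a joint eigenvector of degree k' <= k with the same characters, so
    uniqueness forces it to be 0 unless the bidegrees agree. *)
Lemma generic_inequiv s k s' k' : (0 < s < m)%N -> (k' <= k)%N -> (s, k) <> (s', k') ->
  ~ equivalent G rho (hod s k) (hod s' k').
Proof.
move=> sm kk neq [f [[fU finj _] fl fg]]; have [I [I0 I1 Is]] := exists_top_set sm.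
have fi : intertwines G rho (hod s k) f by split.
have sH : submodule G rho (hod s k) := hod_submoduleR rhoE toM_orthoR s k.
have Hv : hod s k (topv k I) by rewrite -Is; apply: topv_hod.
have [JR JN] := joint_top F k I0 I1.
have f_eig A c : orthoR A -> lact A (topv k I) = c *: topv k I ->
    lact A (f (topv k I)) = c *: f (topv k I).
  move=> oA Av; rewrite -(intertwines_lact rhoE toM_surj fi oA sH Hv) Av.
  have f0 := intertwines0 (hod_subspace M s k) fi.
  rewrite -[c *: topv k I]addr0 fl // ?f0 ?addr0 //.
  by case: (hod_subspace M s k).
have [bf _ _] := fU _ Hv.
have [|c [fc cP]] := joint_unique I0 I1 bf kk (Q := f (topv k I)).
  by split=> [|l]; apply: f_eig => //; [exact: rmx_orthoR|exact: nmx_orthoR].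
have c0 : c = 0.
  apply/eqP; apply/negPn/negP => /eqP/cP[s'E k'E]; apply: neq.
  by rewrite s'E k'E Is.
apply: (@topv_neq0 k I); apply: finj.
- by rewrite inE.
- by rewrite inE; case: (hod_subspace M s k).
by rewrite fc c0 scale0r (intertwines0 (hod_subspace M s k) fi).
Qed.

End GenericIrreducibility.

Section AllIndices.
Variables (F : numClosedFieldType) (m : nat).
Local Notation M := (form_fock F m).
Local Notation hod := (@hod F m M).
Variables (T : Type) (G : set T) (rho : T -> M -> M) (toM : T -> 'M[F]_m).
Hypothesis rhoE : forall g, G g -> forall u, rho g u = lact M (toM g) u.
Hypothesis toM_orthoR : forall g, G g -> orthoR (toM g).
Hypothesis toM_surj : forall A, orthoR A -> exists2 g, G g & toM g = A.

Lemma hod_irreducible s k : indices m (s, k) -> irreducible G rho (hod s k).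
Proof.
move=> [[-> ->]|[-> ->]|/= sm].
- exact: bottom_irreducible rhoE toM_orthoR.
- exact: top_irreducible rhoE toM_orthoR.
(* The bound 0 < s < m forces m = 2 + n, which provides the plane of z. The module depends on m, so
   the data of the action are generalised before m is split. *)
move: T G rho toM rhoE toM_orthoR toM_surj; case: m sm => [|[|n]]; [lia|lia|].
by move=> sm T1 G1 rho1 toM1 rhoE1 oR sR; apply: (generic_irreducible rhoE1 oR sR).
Qed.

Lemma hod_inequiv_le s k s' k' : (0 < s < m)%N -> (k' <= k)%N ->
  (s, k) <> (s', k') -> ~ equivalent G rho (hod s k) (hod s' k').
Proof.
move=> sm kk neq.
move: T G rho toM rhoE toM_orthoR toM_surj; case: m sm => [|[|n]]; [lia|lia|].
by move=> sm T1 G1 rho1 toM1 rhoE1 oR sR; apply: (generic_inequiv rhoE1 oR sR).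
Qed.

Lemma hod_inequiv s k s' k' : (0 < m)%N -> indices m (s, k) -> indices m (s', k') ->
  (s, k) <> (s', k') -> ~ equivalent G rho (hod s k) (hod s' k').
Proof.
move=> m_gt0 isk isk' neq eqv.
have eqv' : equivalent G rho (hod s' k') (hod s k).
  by apply: equivalent_sym eqv; apply: hod_submoduleR rhoE toM_orthoR s k.
have neq' : (s', k') <> (s, k) by move=> e; apply: neq.
have bt := bottom_top_inequiv rhoE toM_orthoR toM_surj m_gt0.
have dich : forall s1 k1, indices m (s1, k1) ->
    (0 < s1 < m)%N \/ (k1 = 0%N /\ (s1 = 0%N \/ s1 = m)).
  by move=> s1 k1 [[-> ->]|[-> ->]|]; [right; split; [|left]|right; split; [|right]|left].
case: (dich _ _ isk) => [sm|[k0 s0]]; case: (dich _ _ isk') => [sm'|[k0' s0']].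
(* Equivalence is symmetric, so the module of larger degree may be taken as the source. *)
- case/orP: (leq_total k' k) => kk; first exact: (hod_inequiv_le sm kk neq).
  exact: (hod_inequiv_le sm' kk neq').
- by apply: (hod_inequiv_le sm _ neq eqv); rewrite k0'.
- by apply: (hod_inequiv_le sm' _ neq' eqv'); rewrite k0.
move: eqv eqv' neq; rewrite k0 k0'.
by case: s0 s0' => -> [] ->.
Qed.

End AllIndices.

(** * The decomposition of polynomial forms *)

Section Link.
Variables (R : realType) (m : nat).
Local Notation C := R[i].
Local Notation form := {ffun {set 'I_m} -> {mpoly C[m]}}.
Local Notation M := (form_fock C m).
Implicit Types (i j : 'I_m) (I K : {set 'I_m}) (P Q : form).

Definition toC (g : 'M[R]_m) : 'M[C]_m := map_mx (real_complex R) g.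

Lemma gew_wedge j P : gew j P = wedge j P.
Proof. by apply/ffunP => K; rewrite gewE wedgeE. Qed.

Lemma gec_contr j P : gec j P = contr j P.
Proof. by apply/ffunP => K; rewrite gecE contrE. Qed.

Lemma opX_xop P : opX (P : M) = xop P.
Proof.
rewrite opXE; congr (- _); apply: eq_bigr => j _.
by rewrite -gew_wedge.
Qed.

Lemma opXs_xstar P : opXs (P : M) = xstar P.
Proof. by rewrite opXsE; apply: eq_bigr => j _; rewrite -gec_contr. Qed.

Lemma opD_dop P : opD (P : M) = dop P.
Proof. by rewrite opDE; apply: eq_bigr => j _; rewrite -gew_wedge. Qed.

Lemma opDs_dstar P : opDs (P : M) = dstar P.
Proof.
by rewrite opDsE; congr (- _); apply: eq_bigr => j _; rewrite -gec_contr.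
Qed.

Lemma hodge_hod s k : @hodge R m s k = @hod C m M s k.
Proof.
apply/seteqP; split=> P [].
  move=> hP dP dsP; split; rewrite ?opD_dop ?opDs_dstar //.
  exact/bihomP.
move=> /bihomP hP dP dsP; split; rewrite -?opD_dop -?opDs_dstar //.
Qed.

Lemma word_op_wop w P : word_op w P = wop w (P : M).
Proof. by elim: w => //= b w ->; case: b; rewrite ?opX_xop ?opXs_xstar. Qed.

Lemma wH_wHod s k : @wH R m s k = @wHod C m M s k.
Proof.
apply/funext => w; rewrite /wH /wHod hodge_hod; congr image.
by apply/funext => P; rewrite word_op_wop.
Qed.

Lemma component_comp : @component R m = @comp C m M.
Proof. by apply/funext => sk; rewrite /component /comp wH_wHod. Qed.

(** Since the inverse of g is its transpose, row i of the inverse is column i of g: polynomials and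
    differentials undergo the same substitution. *)
Lemma act_lact g P : orthogonal_group g -> act g P = lact M (toC g) P.
Proof.
move=> og; have gV : invmx g = g^T.
  have ug : g \in unitmx by case/mulmx1_unit: og.
  by rewrite -[LHS]mulmx1 -og mulmxA mulVmx // mul1mx.
apply: eq_bigr => I _.
have E : [tuple \sum_(j < m) (real_complex R (invmx g i j)) *: 'X_j | i < m] =
    [tuple \sum_i toC g i j *: 'X_i | j < m] :> m.-tuple {mpoly C[m]}.
  by apply: eq_mktuple => i; apply: eq_bigr => j _; rewrite gV !mxE.
rewrite /act_poly E.
have -> : act_dxs g I = glact_dx (toC g) I.
  rewrite /act_dxs /glact_dx; elim: (enum I) => //= i l ->.
  by apply: eq_bigr => j _; rewrite mxE gew_wedge.
by [].
Qed.

Lemma toC_orthoR g : orthogonal_group g -> orthoR (toC g).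
Proof.
move=> og; split; first by rewrite /toC map_trmx -map_mxM og map_mx1.
apply/matrixP => i j; rewrite !mxE; apply/CrealP.
by rewrite complex_real.
Qed.

Lemma toC_surj A : orthoR A -> exists2 g, orthogonal_group g & toC g = A.
Proof.
move=> [oA rA]; pose g := map_mx (@complex.Re R) A.
have gA : toC g = A.
  apply/matrixP => i j; rewrite !mxE; apply: RRe_real; apply/CrealP.
  by rewrite -[in RHS]rA mxE.
exists g => //; apply: (@map_mx_inj _ _ (real_complex R)).
by rewrite map_mxM -map_trmx -/(toC g) gA oA map_mx1.
Qed.

End Link.

Theorem theorem1 (R : realType) (m : nat) (m_gt0 : (0 < m)%N) :
  let G := @orthogonal_group R m in
  let rho := @act R m in
  let Hsk := fun sk : nat * nat => @hodge R m sk.1 sk.2 in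
  [/\ is_direct_sum (indices m) (@component R m) setT,
      forall sk, indices m sk ->
        is_direct_sum Omega (wH sk.1 sk.2) (@component R m sk),
      forall sk, indices m sk -> irreducible G rho (Hsk sk),
      forall sk sk', indices m sk -> indices m sk' -> sk <> sk' ->
        ~ equivalent G rho (Hsk sk) (Hsk sk')
    & forall sk, indices m sk ->
        @component R m sk = isotypic G rho (Hsk sk)].
Proof.
move=> G rho Hsk; pose M := form_fock R[i] m.
have rhoE g : G g -> forall u, rho g u = lact M (toC g) u.
  by move=> Gg u; apply: act_lact.
have toR g : G g -> orthoR (toC g) by apply: toC_orthoR.
have toS A : orthoR A -> exists2 g, G g & toC g = A by apply: toC_surj.
have HskE sk : Hsk sk = @hod _ _ M sk.1 sk.2 by apply: hodge_hod.
have irr sk : indices m sk -> irreducible G rho (@hod _ _ M sk.1 sk.2).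
  by case: sk => s k; apply: hod_irreducible rhoE toR toS s k.
have ineq sk sk' : indices m sk -> indices m sk' -> sk <> sk' ->
    ~ equivalent G rho (@hod _ _ M sk.1 sk.2) (@hod _ _ M sk'.1 sk'.2).
  by case: sk sk' => s k [s' k']; apply: hod_inequiv rhoE toR toS s k s' k' m_gt0.
rewrite component_comp; split.
- exact: (direct_sum_comp (@form_fin _ m)).
- by move=> sk _; rewrite wH_wHod; apply: direct_sum_words.
- by move=> sk isk; rewrite HskE; apply: irr.
- by move=> sk sk' isk isk' neq; rewrite !HskE; apply: ineq.
move=> sk isk; rewrite HskE; apply: (isotypic_comp (@form_fin _ m) rhoE) => //.
  by move=> g /toR[].
move=> g /toR/[dup] oA /orthoR_tr/toS[g' Gg' g'E]; exists g' => //.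
by rewrite g'E adjm_orthoR.
Qed.
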